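(* Let $T$ be a 3-sufficiently subdivided finite tree with at least one essential vertex. Then $\mathcal D^3T$ is $\mathcal S_3$-equivariantly homotopy equivalent to the following directed multigraph $G(3,T)$. Its vertices are the six permutations $ijk$ of $012$ (with $ijk$ standing for the configuration $(i,j,k)$, and $\mathcal S_3$ acting by permuting coordinates). Its edges are: $m_2+m_3$ edges along each of the directed pairs $012\to201$, $201\to120$, $120\to012$, $102\to021$, $021\to210$, $210\to102$, and $m_2+m_3$ edges in each direction between each of the pairs $\{012,102\}$, $\{201,210\}$, $\{120,021\}$; plus $m_2$ edges in each direction between each of the pairs $\{201,102\}$, $\{012,021\}$, $\{120,210\}$. The action of $\mu\in\mathcal S_3$ sends each edge from $x$ to $y$ homeomorphically, preserving orientation, onto an edge from $x\cdot\mu$ to $y\cdot\mu$ of the same family (multiplicity class).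
   Context: A tree $T$ is $n$-sufficiently subdivided if every path between distinct vertices of degree $\neq2$ passes through at least $n-1$ edges. An essential vertex is a vertex of degree at least $3$. The discretized configuration space $\mathcal D^nT$ is the subcomplex of the product cell complex $T^n$ consisting of cells $(a_1,\dots,a_n)$ with pairwise disjoint closures; $\mathcal S_n$ acts by $(a_1,\dots,a_n)\cdot\sigma=(a_{\sigma(1)},\dots,a_{\sigma(n)})$. For $r\ge1$, $m_r=\sum_v\binom{d(v)-1}{r}$ over vertices $v$ with degree $d(v)>r$. Vertices of $T$ are numbered $0,1,2,\dots$ in the order of a depth-first (leftmost-branch-first) walk from a root $0$ of degree one in a planar embedding. *)

(* Defs.v *)
From HB Require Import structures.
From mathcomp Require Import all_boot all_order all_algebra all_fingroup.
From mathcomp Require Import all_classical all_reals all_analysis.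
Set Implicit Arguments. Unset Strict Implicit. Unset Printing Implicit Defensive.
Import Order.TTheory GRing.Theory Num.Theory.
Import numFieldNormedType.Exports.
Local Open Scope classical_set_scope.
Local Open Scope ring_scope.

Section Trees.
Variables (V : finType) (e : rel V).

Definition is_tree : Prop :=
  [/\ symmetric e, irreflexive e, (forall u v, connect e u v)
    & forall p : seq V, uniq p -> (3 <= size p)%N -> ~~ path.cycle e p].

Definition deg (v : V) : nat := #|[set u | e v u]%SET|.

Definition essential (v : V) : Prop := (3 <= deg v)%N.

(* every path between distinct vertices of degree <> 2 has >= n-1 edges;
   a path from u is [u :: p], its number of edges is size p *)
Definition suff_subdivided (n : nat) : Prop :=
  forall (u v : V) (p : seq V), u != v -> deg u != 2%N -> deg v != 2%N ->
    path.path e u p -> last u p = v -> (n - 1 <= size p)%N.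

Definition m_r (r : nat) : nat := (\sum_(v : V | (r < deg v)%N) 'C(deg v - 1, r))%N.

(* cells of T: vertices and edges, given by their (closed) vertex sets *)
Definition is_cell (c : {set V}) : bool :=
  (#|c| == 1)%N || [exists u, exists v, e u v && (c == [set u; v]%SET)].

(* Geometric realization: a point of |T| is a row vector of barycentric
   coordinates indexed by the vertices; the closed cell with vertex set c
   is the simplex spanned by the vertices of c. *)
Definition vcoord (R : realType) (y : 'rV[R]_#|V|) (v : V) : R := y 0 (enum_rank v).

Definition in_closed_cell (R : realType) (c : {set V}) (y : 'rV[R]_#|V|) : Prop :=
  [/\ forall v, v \notin c -> vcoord y v = 0,
      forall v, 0 <= vcoord y v
    & \sum_(v : V) vcoord y v = 1].

(* the discretized configuration space D^n T, realized in |T|^n, a point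
   being the n x #|V| matrix whose p-th row is the position of point p:
   union of the products of closed cells c_1 x ... x c_n with pairwise
   disjoint closures *)
Definition Dconf (R : realType) (n : nat) : set 'M[R]_(n, #|V|) :=
  fun A => exists c : 'I_n -> {set V},
    [/\ forall p, is_cell (c p),
        forall p q, p != q -> (c p :&: c q == finset.set0)%SET
      & forall p, in_closed_cell (c p) (row p A)].

End Trees.

Definition actD (R : realType) (n m : nat) (A : 'M[R]_(n, m)) (s : 'S_n) : 'M[R]_(n, m) :=
  \matrix_(p, j) A (s p) j.

(* Vertices: permutations x : 'S_3, x standing for the configuration   *)
(* (x 0, x 1, x 2).  The S_3 action on vertices is x.mu = mu * x       *)
(* (as functions: p |-> x (mu p)).                                     *)
(* Families k = 0,1,2: an edge of family k goes from x to x * gen k,   *)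
(* i.e. gen k applied to the values:                                   *)
(*   family 0: gen = (0 -> 2 -> 1 -> 0), multiplicity m2+m3,           *)
(*             giving 012->201->120->012 and 102->021->210->102;       *)
(*   family 1: gen = (0 1), multiplicity m2+m3,                        *)
(*             giving both directions between {012,102},{201,210},     *)
(*             {120,021};                                              *)
(*   family 2: gen = (1 2), multiplicity m2,                           *)
(*             giving both directions between {201,102},{012,021},     *)
(*             {120,210}.                                              *)
Definition gen (k : 'I_3) : 'S_3 :=
  if nat_of_ord k == 0%N then (tperm (inord 0) (inord 2) * tperm (inord 0) (inord 1))%g
  else if nat_of_ord k == 1%N then tperm (inord 0) (inord 1)
  else tperm (inord 1) (inord 2).

Definition mult (m2 m3 : nat) (k : 'I_3) : nat :=
  if nat_of_ord k == 2%N then m2 else (m2 + m3)%N.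

(* coordinates for the realization: one per vertex, one per potential edge
   (x, k, i) (edge number i of family k starting at x; only i < mult k
   are actual edges) *)
Definition GI (N : nat) : finType := ('S_3 + ('S_3 * 'I_3 * 'I_N))%type.

Definition gdelta (R : realType) (N : nat) (j : GI N) : 'rV[R]_#|GI N| :=
  \row_i (i == enum_rank j)%:R.

(* Geometric realization of G(3,T): edge (x,k,i) is realized (subdivided
   at an interior point) as the union of the segment from the vertex x to
   the edge-point (x,k,i) and the segment from it to the vertex x * gen k.
   Orientation: from x to x * gen k. *)
Definition Greal (R : realType) (m2 m3 : nat) : set 'rV[R]_#|GI (m2 + m3)| :=
  fun y => exists (x : 'S_3) (k : 'I_3) (i : 'I_(m2 + m3)),
    (i < mult m2 m3 k)%N /\
    exists t : R, 0 <= t <= 1 /\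
      (y = (1 - t) *: gdelta R (inl x) + t *: gdelta R (inr (x, k, i))
       \/ y = (1 - t) *: gdelta R (inr (x, k, i)) + t *: gdelta R (inl (x * gen k)%g)).

(* the S_3 action on G(3,T): mu maps the edge (x,k,i) (from x to x*gen k)
   orientation-preservingly onto the edge (mu*x,k,i) of the same family
   (from x.mu = mu*x to (x * gen k).mu = mu*x*gen k) *)
Definition piG (N : nat) (mu : 'S_3) (j : GI N) : GI N :=
  match j with
  | inl x => inl (mu * x)%g
  | inr (x, k, i) => inr ((mu * x)%g, k, i)
  end.

Definition actG (R : realType) (N : nat) (y : 'rV[R]_#|GI N|) (mu : 'S_3)
  : 'rV[R]_#|GI N| :=
  \row_i y 0 (enum_rank (piG (mu^-1)%g (enum_val i))).

Definition equiv_htpy_equiv (R : realType) (gT : finGroupType)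
  (U W : topologicalType) (aU : U -> gT -> U) (aW : W -> gT -> W)
  (X : set U) (Y : set W) : Prop :=
  exists (f : U -> W) (g : W -> U) (H : (R * U)%type -> U) (K : (R * W)%type -> W),
  [/\ {within X, continuous f} /\ {within Y, continuous g},
      (forall x, X x -> Y (f x)) /\ (forall y, Y y -> X (g y)),
      (forall x mu, X x -> f (aU x mu) = aW (f x) mu) /\
      (forall y mu, Y y -> g (aW y mu) = aU (g y) mu),
      {within `[0, 1] `*` X, continuous H} /\
      (forall x, X x -> H (0, x) = g (f x) /\ H (1, x) = x) /\
      (forall t x, 0 <= t <= 1 -> X x -> X (H (t, x))) /\
      (forall t x mu, 0 <= t <= 1 -> X x -> H (t, aU x mu) = aU (H (t, x)) mu)
    & {within `[0, 1] `*` Y, continuous K} /\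
      (forall y, Y y -> K (0, y) = f (g y) /\ K (1, y) = y) /\
      (forall t y, 0 <= t <= 1 -> Y y -> Y (K (t, y))) /\
      (forall t y mu, 0 <= t <= 1 -> Y y -> K (t, aW y mu) = aW (K (t, y)) mu)].

(* Main.v *)
(* Root T at a leaf, order its vertices, and let the points of a configuration flow one after
   the other towards the root, a point waiting at a branch vertex for its smaller siblings.
   This is the discrete gradient field of Farley and Sabalka. For three points no cell of
   dimension at least two is critical, so D^3 T collapses equivariantly onto a graph on which
   S_3 acts freely. Contracting the forest of flow lines leaves six vertices, the orders of
   the three points on the segment next to the root, and one orbit of edges x -> x g for each
   orbit of critical 1-cells. There are 3 m_2 + 2 m_3 such orbits. Their labels g depend on T,
   but sliding the ends of an edge along the other edges multiplies its label by products of
   theirs; one orbit carries the transposition (1 2) and another one moves 0, these two labels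
   generate S_3, and so the labels can be turned into those of G(3, T). *)

Require Import Defs.
From HB Require Import structures.
From mathcomp Require Import all_boot all_order all_algebra all_fingroup.
From mathcomp Require Import all_classical all_reals all_analysis.
From mathcomp Require Import zify ring lra.
Set Implicit Arguments. Unset Strict Implicit. Unset Printing Implicit Defensive.
Import Order.TTheory GRing.Theory Num.Theory.
Import numFieldNormedType.Exports.
Local Open Scope classical_set_scope.
Local Open Scope ring_scope.

(** In a critical cell every moving point yields to a smaller sibling waiting below the same vertex.
    Disjoint edges cannot end in the same vertex, so two moving points would need two waiting ones;
    with three points this is impossible, and dimension two is excluded. The number [3 m_2 + 2 m_3]
    comes from a count of critical triples grouped by branch vertex. This count and two labels are
    all that has to be known about the edges, because every other label can be prescribed at will
    once those two are present. The obstacle is to perform all moves without quotients or gluing.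
    Spaces are subsets of matrix spaces; maps are formulas in sums, products, minima and maxima that
    make sense on the whole matrix space, and a full orbit of free faces is collapsed by one sum
    over the orbit, which makes the map equivariant. Graphs are simplicial complexes, where loops
    and multiple edges do not exist; hence loops and parallel edges have to be carried by subdivided
    petals, and every slide has to make sure that the edge it creates is new. *)

Section Continuity.
Variables (R : realType) (T : topologicalType).
Implicit Types f g : T -> R.

Lemma continuous_mx m n (F : T -> 'M[R]_(m, n)) :
  (forall i j, continuous (fun x => F x i j)) -> continuous F.
Proof.
move=> Fc x A [P MP sPA]; have FF := nbhs_filter x.
have H : \forall y \near x, forall i j, P i j (F y i j).
  apply: filter_forall => i; apply: filter_forall => j.
  exact: (Fc i j x (P i j) (MP i j)).
by apply: filterS H => y Hy; apply: sPA.
Qed.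

Lemma continuous_coord m n (F : T -> 'M[R]_(m, n)) i j :
  continuous F -> continuous (fun x => F x i j).
Proof.
move=> Fc x; apply: (@continuous_comp _ _ _ F (fun M : 'M[R]_(m, n) => M i j)).
  exact: Fc.
exact: coord_continuous.
Qed.

Lemma continuous_add f g :
  continuous f -> continuous g -> continuous (fun x => f x + g x).
Proof. by move=> fc gc x; apply: (@continuousD R R^o T f g x (fc x) (gc x)). Qed.

Lemma continuous_mul f g :
  continuous f -> continuous g -> continuous (fun x => f x * g x).
Proof. by move=> fc gc x; apply: (@continuousM R T f g x (fc x) (gc x)). Qed.

Lemma continuous_sub f g :
  continuous f -> continuous g -> continuous (fun x => f x - g x).
Proof. by move=> fc gc x; apply: (@continuousB R R^o T f g x (fc x) (gc x)). Qed.

Lemma continuous_minr f g :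
  continuous f -> continuous g -> continuous (fun x => Num.min (f x) (g x)).
Proof. by move=> fc gc x; apply: (@continuous_min R T f g x (fc x) (gc x)). Qed.

Lemma continuous_maxr f g :
  continuous f -> continuous g -> continuous (fun x => Num.max (f x) (g x)).
Proof. by move=> fc gc x; apply: (@continuous_max R T f g x (fc x) (gc x)). Qed.

Lemma continuous_const (c : R) : continuous (fun _ : T => c).
Proof. by move=> x; apply: cvg_cst. Qed.

Lemma continuous_bigop (op : R -> R -> R) (c : R) :
  (forall f g, continuous f -> continuous g -> continuous (fun x => op (f x) (g x))) ->
  forall (J : Type) (r : seq J) (P : pred J) (F : J -> T -> R),
  (forall j, P j -> continuous (F j)) ->
  continuous (fun x => \big[op/c]_(j <- r | P j) F j x).
Proof.
move=> opc J r P F Fc; elim: r => [|j r IH].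
  have -> : (fun x => \big[op/c]_(j <- [::] | P j) F j x) = (fun=> c).
    by apply/funext => x; rewrite big_nil.
  exact: continuous_const.
have -> : (fun x => \big[op/c]_(j <- j :: r | P j) F j x) =
  if P j then fun x => op (F j x) (\big[op/c]_(j <- r | P j) F j x)
  else fun x => \big[op/c]_(j <- r | P j) F j x.
  by apply/funext => x; rewrite big_cons; case: ifP.
by case: ifP => // /Fc Fj; apply: opc.
Qed.

Lemma continuous_bigsum (J : Type) (r : seq J) (P : pred J) (F : J -> T -> R) :
  (forall j, P j -> continuous (F j)) ->
  continuous (fun x => \sum_(j <- r | P j) F j x).
Proof. exact/continuous_bigop/continuous_add. Qed.

Lemma continuous_bigprod (J : Type) (r : seq J) (P : pred J) (F : J -> T -> R) :
  (forall j, P j -> continuous (F j)) ->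
  continuous (fun x => \prod_(j <- r | P j) F j x).
Proof. exact/continuous_bigop/continuous_mul. Qed.

Lemma continuous_bigmin (J : Type) (r : seq J) (P : pred J) (F : J -> T -> R) c :
  (forall j, P j -> continuous (F j)) ->
  continuous (fun x => \big[Num.min/c]_(j <- r | P j) F j x).
Proof. exact/continuous_bigop/continuous_minr. Qed.
End Continuity.

(** * Equivariant homotopy equivalences *)

Section EquivariantHomotopy.
Variables (R : realType) (gT : finGroupType).

(** In contrast to [equiv_htpy_equiv] the maps are continuous on the ambient spaces and not only
    within [X] and [Y]. Compositions then need no side conditions. *)
Definition ghe (U W : topologicalType) (aU : U -> gT -> U) (aW : W -> gT -> W)
    (X : set U) (Y : set W) : Prop :=
  exists (f : U -> W) (g : W -> U) (H : (R * U)%type -> U) (K : (R * W)%type -> W),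
  [/\ continuous f /\ continuous g,
      (forall x, X x -> Y (f x)) /\ (forall y, Y y -> X (g y)),
      (forall x mu, X x -> f (aU x mu) = aW (f x) mu) /\
      (forall y mu, Y y -> g (aW y mu) = aU (g y) mu),
      continuous H /\
      (forall x, X x -> H (0, x) = g (f x) /\ H (1, x) = x) /\
      (forall t x, 0 <= t <= 1 -> X x -> X (H (t, x))) /\
      (forall t x mu, 0 <= t <= 1 -> X x -> H (t, aU x mu) = aU (H (t, x)) mu)
    & continuous K /\
      (forall y, Y y -> K (0, y) = f (g y) /\ K (1, y) = y) /\
      (forall t y, 0 <= t <= 1 -> Y y -> Y (K (t, y))) /\
      (forall t y mu, 0 <= t <= 1 -> Y y -> K (t, aW y mu) = aW (K (t, y)) mu)].

Lemma ghe_equiv_htpy_equiv (U W : topologicalType) aU aW (X : set U) (Y : set W) :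
  ghe aU aW X Y -> equiv_htpy_equiv R aU aW X Y.
Proof.
move=> [f [g [H [K [[fc gc] XY fg [Hc HH] [Kc KK]]]]]].
exists f, g, H, K; split=> //; split=> //; exact: continuous_subspaceT.
Qed.

Lemma ghe_sym (U W : topologicalType) aU aW (X : set U) (Y : set W) :
  ghe aU aW X Y -> ghe aW aU Y X.
Proof.
move=> [f [g [H [K [[fc gc] [XY YX] [fe ge] HH KK]]]]].
by exists g, f, K, H; split.
Qed.

Lemma continuous_comp_pair (T U W : topologicalType) (F : (T * U)%type -> W)
    (S : topologicalType) (u : S -> T) (v : S -> U) :
  continuous F -> continuous u -> continuous v -> continuous (fun s => F (u s, v s)).
Proof.
move=> Fc uc vc s; apply: (@continuous_comp _ _ _ (fun s => (u s, v s)) F).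
  by apply: cvg_pair; [exact: uc|exact: vc].
exact: Fc.
Qed.

Lemma continuous_compose (T U W : topologicalType) (f : T -> U) (g : U -> W) :
  continuous f -> continuous g -> continuous (fun x => g (f x)).
Proof. by move=> fc gc x; apply: continuous_comp; [exact: fc|exact: gc]. Qed.

Lemma continuous_fstE (T U : topologicalType) : continuous (@fst T U).
Proof. by move=> x; apply: cvg_fst. Qed.

Lemma continuous_sndE (T U : topologicalType) : continuous (@snd T U).
Proof. by move=> x; apply: cvg_snd. Qed.

(* In a vector space two homotopies [H1 : a ~ b], [H2 : b ~ c] concatenate without
   gluing, as the sum of reparametrized copies minus the middle map. *)
Lemma htpy_concat m n (aU : 'M[R]_(m, n) -> gT -> 'M[R]_(m, n))
    (X : set 'M[R]_(m, n)) (H1 H2 : (R * 'M[R]_(m, n))%type -> 'M[R]_(m, n)) :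
  continuous H1 -> continuous H2 ->
  (forall x, X x -> H1 (1, x) = H2 (0, x)) ->
  (forall t x, 0 <= t <= 1 -> X x -> X (H1 (t, x))) ->
  (forall t x, 0 <= t <= 1 -> X x -> X (H2 (t, x))) ->
  (forall t x mu, 0 <= t <= 1 -> X x -> H1 (t, aU x mu) = aU (H1 (t, x)) mu) ->
  (forall t x mu, 0 <= t <= 1 -> X x -> H2 (t, aU x mu) = aU (H2 (t, x)) mu) ->
  (forall x mu, X x -> X (aU x mu)) ->
  exists H : (R * 'M[R]_(m, n))%type -> 'M[R]_(m, n),
    [/\ continuous H, forall x, X x -> H (0, x) = H1 (0, x),
      forall x, X x -> H (1, x) = H2 (1, x),
      forall t x, 0 <= t <= 1 -> X x -> X (H (t, x)) &
      forall t x mu, 0 <= t <= 1 -> X x -> H (t, aU x mu) = aU (H (t, x)) mu].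
Proof.
move=> c1 c2 H12 X1 X2 e1 e2 Xa.
pose u (t : R) := Num.min (2 * t) 1; pose v (t : R) := Num.max (2 * t - 1) 0.
pose H (p : (R * 'M[R]_(m, n))%type) := H1 (u p.1, p.2) + H2 (v p.1, p.2) - H1 (1, p.2).
have uv t : 0 <= t <= 1 ->
  (exists2 s, 0 <= s <= 1 & forall x, X x -> H (t, x) = H1 (s, x)) \/
  (exists2 s, 0 <= s <= 1 & forall x, X x -> H (t, x) = H2 (s, x)).
  move=> /andP[t0 t1]; case: (leP (2 * t) 1) => ht; [left|right].
    exists (2 * t); first by rewrite ht andbT; lra.
    move=> x Xx; rewrite /H /u /v /=.
    have -> : Num.min (2 * t) 1 = 2 * t by apply/min_idPl.
    have -> : Num.max (2 * t - 1) 0 = 0 by apply/max_idPr; lra.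
    by rewrite -H12 // addrK.
  exists (2 * t - 1); first by apply/andP; split; lra.
  move=> x Xx; rewrite /H /u /v /=.
  have -> : Num.min (2 * t) 1 = 1 by apply/min_idPr; lra.
  have -> : Num.max (2 * t - 1) 0 = 2 * t - 1 by apply/max_idPl; lra.
  by rewrite addrC addKr.
have cc i : continuous (fun x : (R * 'M[R]_(m, n))%type => 2 * x.1 - i : R).
  apply: continuous_sub; last exact: continuous_const.
  by apply: continuous_mul; [exact: continuous_const|exact: continuous_fstE].
exists H; split.
- apply: continuous_mx => i j.
  have -> : (fun x : (R * 'M[R]_(m, n))%type => H x i j) =
    (fun x => H1 (u x.1, x.2) i j + H2 (v x.1, x.2) i j - H1 (1, x.2) i j).
    by apply/funext => x; rewrite /H !mxE.
  apply: continuous_sub; [apply: continuous_add|]; apply: continuous_coord;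
    apply: continuous_comp_pair => //; try exact: continuous_sndE.
  + apply: continuous_minr; last exact: continuous_const.
    by apply: continuous_mul; [exact: continuous_const|exact: continuous_fstE].
  + apply: continuous_maxr; last exact: continuous_const.
    exact: cc.
  + exact: continuous_const.
- move=> x Xx; rewrite /H /u /v /=.
  rewrite mulr0 (min_idPl ler01) sub0r.
  have -> : Num.max (- 1) 0 = 0 :> R by apply/max_idPr; lra.
  by rewrite -H12 // addrK.
- move=> x Xx; rewrite /H /u /v /=.
  have -> : Num.min (2 * 1) 1 = 1 :> R by apply/min_idPr; lra.
  have -> : 2 * 1 - 1 = 1 :> R by lra.
  rewrite (max_idPl ler01).
  by rewrite addrC addKr.
- by move=> t x /uv[[s s01 Hs]|[s s01 Hs]] Xx; rewrite Hs //; [exact: X1|exact: X2].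
- move=> t x mu /uv[[s s01 Hs]|[s s01 Hs]] Xx; rewrite !Hs //; try exact: Xa.
    exact: e1.
  exact: e2.
Qed.

Lemma ghe_trans m1 n1 m2 n2 m3 n3 aU aW aZ
    (X : set 'M[R]_(m1, n1)) (Y : set 'M[R]_(m2, n2)) (Z : set 'M[R]_(m3, n3)) :
  (forall x mu, X x -> X (aU x mu)) -> (forall x mu, Z x -> Z (aZ x mu)) ->
  ghe aU aW X Y -> ghe aW aZ Y Z -> ghe aU aZ X Z.
Proof.
move=> Xa Za
  [f [g [H [K [[fc gc] [XY YX] [fe ge] [Hc [H01 [HX He]]] [Kc [K01 [KY Ke]]]]]]]]
  [f' [g' [H' [K' [[fc' gc'] [YZ ZY] [fe' ge'] [Hc' [H01' [HX' He']]] [Kc' [K01' [KY' Ke']]]]]]]].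
(* The inner homotopy transported by the outer maps: it runs from [g (g' (f' (f x)))] to [g (f x)],
   where [H] takes over. [c2] is its counterpart on [Z]. *)
have c1 : continuous (fun p : (R * 'M[R]_(m1, n1))%type => g (H' (p.1, f p.2))).
  apply: continuous_compose gc; apply: continuous_comp_pair => //; first exact: continuous_fstE.
  by apply: continuous_compose fc; exact: continuous_sndE.
have c2 : continuous (fun p : (R * 'M[R]_(m3, n3))%type => f' (K (p.1, g' p.2))).
  apply: continuous_compose fc'; apply: continuous_comp_pair => //; first exact: continuous_fstE.
  by apply: continuous_compose gc'; exact: continuous_sndE.
have [||||||L [Lc L0 L1 LX Le]] := @htpy_concat _ _ aU X _ H c1 Hc => //.
- by move=> x Xx /=; rewrite (H01' _ (XY _ Xx)).2 (H01 _ Xx).1.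
- by move=> t x t01 Xx /=; apply/YX/HX' => //; apply: XY.
- move=> t x mu t01 Xx /=; rewrite fe // He' //; last exact: XY.
  by rewrite ge //; apply: HX' => //; apply: XY.
have [||||||M [Mc M0 M1 MZ Me]] := @htpy_concat _ _ aZ Z _ K' c2 Kc' => //.
- by move=> x Xx /=; rewrite (K01 _ (ZY _ Xx)).2 (K01' _ Xx).1.
- by move=> t x t01 Xx /=; apply/YZ/KY => //; apply: ZY.
- move=> t x mu t01 Xx /=; rewrite ge' // Ke //; last exact: ZY.
  by rewrite fe' //; apply: KY => //; apply: ZY.
exists (fun x => f' (f x)), (fun z => g (g' z)), L, M; split.
- by split; apply: continuous_compose.
- by split=> x Xx; [apply/YZ/XY|apply/YX/ZY].
- split=> x mu Xx; first by rewrite fe // fe' //; apply: XY.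
  by rewrite ge' // ge //; apply: ZY.
- split=> //; split=> // x Xx; rewrite L0 // L1 //=.
  by rewrite (H01' _ (XY _ Xx)).1 (H01 _ Xx).2.
- split=> //; split=> // x Xx; rewrite M0 // M1 //=.
  by rewrite (K01 _ (ZY _ Xx)).1 (K01' _ Xx).2.
Qed.

(** [D] has to keep [Y] inside [Y] but may move its points. This weak form is what the cubical
    collapse provides, since its map also stretches the surviving cells. The inclusion is the
    inverse, and [D] run backwards is the homotopy on either side. *)
Lemma ghe_wdr m n (a : 'M[R]_(m, n) -> gT -> 'M[R]_(m, n)) (X Y : set 'M[R]_(m, n))
    (D : (R * 'M[R]_(m, n))%type -> 'M[R]_(m, n)) :
  continuous D -> Y `<=` X ->
  (forall x, X x -> D (0, x) = x) -> (forall x, X x -> Y (D (1, x))) ->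
  (forall t x, 0 <= t <= 1 -> X x -> X (D (t, x))) ->
  (forall t x, 0 <= t <= 1 -> Y x -> Y (D (t, x))) ->
  (forall t x mu, 0 <= t <= 1 -> X x -> D (t, a x mu) = a (D (t, x)) mu) ->
  ghe a a X Y.
Proof.
move=> Dc YX D0 D1 DX DY De.
have t1 : (0 : R) <= 1 <= (1 : R) by apply/andP; split; lra.
pose H (p : (R * 'M[R]_(m, n))%type) := D (1 - p.1, p.2).
have Hc : continuous H.
  apply: continuous_comp_pair => //; last exact: continuous_sndE.
  by apply: continuous_sub; [exact: continuous_const|exact: continuous_fstE].
have flip t : 0 <= t <= 1 -> (0 : R) <= 1 - t <= 1.
  by move=> /andP[? ?]; apply/andP; split; lra.
exists (fun x => D (1, x)), id, H, H; split.
- split; last by move=> x; exact: cvg_id.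
  apply: (continuous_comp_pair Dc); first exact: continuous_const.
  by move=> x; exact: cvg_id.
- by split.
- by split=> // x mu Xx; rewrite De.
- split=> //; split; first by move=> x Xx; rewrite /H /= subr0 subrr D0.
  by split=> [t x|t x mu] /flip t01 Xx; [apply: DX|rewrite /H De].
- split=> //; split; first by move=> x Yx; rewrite /H /= subr0 subrr D0 //; apply: YX.
  by split=> [t x|t x mu] /flip t01 Xx; [apply: DY|rewrite /H De //; apply: YX].
Qed.

(** Constant homotopies suffice, as [f] and [g] are mutually inverse between [X] and [Y], if not on
    the ambient spaces. *)
Lemma ghe_homeo (U W : topologicalType) aU aW (X : set U) (Y : set W) f g :
  continuous f -> continuous g -> (forall x, X x -> Y (f x)) ->
  (forall y, Y y -> X (g y)) -> (forall x, X x -> g (f x) = x) ->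
  (forall y, Y y -> f (g y) = y) ->
  (forall x mu, X x -> f (aU x mu) = aW (f x) mu) ->
  (forall y mu, Y y -> Y (aW y mu)) -> (forall x mu, X x -> X (aU x mu)) ->
  ghe aU aW X Y.
Proof.
move=> fc gc XY YX gf fg fe Ya Xa.
exists f, g, snd, snd; split => //.
- split=> // y mu Yy; rewrite -[in LHS](fg _ Yy) -fe ?gf //; last exact: YX.
  by apply: Xa; apply: YX.
- by split; [exact: continuous_sndE|split=> //; move=> x Xx /=; rewrite gf].
- by split; [exact: continuous_sndE|split=> //; move=> x Xx /=; rewrite fg].
Qed.
End EquivariantHomotopy.

(** * Simplicial complexes and collapses *)

Section Realization.
Variables (R : realType) (I : finType).

Definition co (y : 'rV[R]_#|I|) (i : I) : R := y 0 (enum_rank i).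
Definition vec (f : I -> R) : 'rV[R]_#|I| := \row_j f (enum_val j).

Lemma co_vec f i : co (vec f) i = f i.
Proof. by rewrite /co mxE enum_rankK. Qed.

Lemma vecP y z : (forall i, co y i = co z i) -> y = z.
Proof.
move=> yz; apply/rowP => j; have := yz (enum_val j).
by rewrite /co enum_valK.
Qed.

Lemma continuous_vec (T : topologicalType) (F : T -> I -> R) :
  (forall i, continuous (fun x => F x i)) -> continuous (fun x => vec (F x)).
Proof.
move=> Fc; apply: continuous_mx => i j.
have -> : (fun x => vec (F x) i j) = (fun x => F x (enum_val j)).
  by apply/funext => x; rewrite mxE.
exact: Fc.
Qed.

Lemma continuous_co (T : topologicalType) (F : T -> 'rV[R]_#|I|) i :
  continuous F -> continuous (fun x => co (F x) i).
Proof. by move=> Fc; apply: continuous_coord. Qed.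

Definition supp (y : 'rV[R]_#|I|) : {set I} := finset (fun i => co y i != 0).

Lemma in_supp y i : (i \in supp y) = (co y i != 0).
Proof. by rewrite inE. Qed.

(** A simplex contributes its interior only, so deleting a pair of simplices from [K] deletes two
    open simplices from the space. *)
Definition real (K : {set {set I}}) : set 'rV[R]_#|I| :=
  [set y | [/\ forall i, 0 <= co y i, \sum_i co y i = 1 & supp y \in K]].

Lemma supp_neq0 y : \sum_i co y i = 1 -> supp y != finset.set0.
Proof.
move=> y1; apply/negP => /eqP y0; have := oner_neq0 R.
rewrite -y1 big1 ?eqxx // => i _; apply/eqP/negPn.
by rewrite -in_supp y0 inE.
Qed.
End Realization.

Section Action.
Variables (R : realType) (I : finType) (gT : finGroupType) (pi : gT -> I -> I).

Definition is_act := (forall i, pi 1%g i = i) /\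
  (forall a b i, pi (a * b)%g i = pi a (pi b i)).

Hypothesis piact : is_act.

Lemma pi_id i : pi 1%g i = i. Proof. exact: piact.1. Qed.
Lemma pi_comp a b i : pi (a * b)%g i = pi a (pi b i). Proof. exact: piact.2. Qed.
Lemma piK a : cancel (pi a) (pi a^-1%g).
Proof. by move=> i; rewrite -pi_comp mulVg pi_id. Qed.
Lemma piVK a : cancel (pi a^-1%g) (pi a).
Proof. by move=> i; rewrite -pi_comp mulgV pi_id. Qed.
Lemma pi_inj a : injective (pi a). Proof. exact: can_inj (piK a). Qed.

Lemma mem_pi_imset a (A : {set I}) i : (i \in pi a @: A) = (pi a^-1%g i \in A).
Proof. by rewrite -{1}(piVK a i) mem_imset //; apply: pi_inj. Qed.

Lemma imset_piK a : cancel (fun A : {set I} => pi a @: A) (fun A => pi a^-1%g @: A).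
Proof. by move=> A; apply/setP => i; rewrite !mem_pi_imset invgK piK. Qed.

Lemma imset_pi_comp a b (A : {set I}) : pi (a * b)%g @: A = pi a @: (pi b @: A).
Proof. by apply/setP => i; rewrite !mem_pi_imset invMg pi_comp. Qed.

Lemma imset_pi1 (A : {set I}) : pi 1%g @: A = A.
Proof. by apply/setP => i; rewrite mem_pi_imset invg1 pi_id. Qed.

(** The inverse makes the vertex [i] travel to [pi mu i]. For [piG] this is [actG]. *)
Definition actI (y : 'rV[R]_#|I|) (mu : gT) : 'rV[R]_#|I| :=
  \row_i y 0 (enum_rank (pi (mu^-1)%g (enum_val i))).

Lemma co_act y mu i : co (actI y mu) i = co y (pi mu^-1%g i).
Proof. by rewrite /co mxE enum_rankK. Qed.

Lemma supp_act y mu : supp (actI y mu) = pi mu @: supp y.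
Proof. by apply/setP => i; rewrite mem_pi_imset !in_supp co_act. Qed.

Definition inv_cplx (K : {set {set I}}) :=
  forall mu (k : {set I}), k \in K -> pi mu @: k \in K.

Lemma real_act (K : {set {set I}}) : inv_cplx K ->
  forall y mu, real K y -> real K (actI y mu).
Proof.
move=> Kinv y mu [y0 y1 yK]; split; last by rewrite supp_act Kinv.
  by move=> i; rewrite co_act.
rewrite -y1 (reindex_inj (@pi_inj mu)) /=.
by apply: eq_bigr => i _; rewrite co_act piK.
Qed.
End Action.

Section Collapse.
Variables (R : realType) (I : finType) (gT : finGroupType) (pi : gT -> I -> I).
Hypothesis piact : is_act pi.
Variables (K : {set {set I}}) (S : {set {set I} * I}).

(* [(s, w)] in [S] stands for the free face [s] of the simplex [w |: s]. *)
Hypothesis Sinv : forall mu j, j \in S -> (pi mu @: j.1, pi mu j.2) \in S.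
Hypothesis Sw : forall j, j \in S -> j.2 \notin j.1 /\ j.1 != finset.set0.
Hypothesis Sdown : forall j (k : {set I}), j \in S -> k \subset j.2 |: j.1 ->
  k != finset.set0 -> k \in K.
Hypothesis Sfree : forall j (k : {set I}), j \in S -> k \in K ->
  j.1 \subset k -> k \subset j.2 |: j.1.
Hypothesis Suniq : forall i j (k : {set I}), i \in S -> j \in S -> k \in K ->
  i.1 \subset k -> j.1 \subset k -> i = j.

Definition collapsed : {set {set I}} :=
  [set k in K | [forall j in S, ~~ (j.1 \subset k)]]%SET.

(** On points with nonnegative coordinates [s j] is positive exactly when all vertices of the face
    [j.1] carry mass. Along [dir j] each of them gives up [s j] and [j.2] collects the total, so at
    time 1 the smallest coordinate of the face is exhausted. Summing over all of [S] keeps the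
    formula continuous and equivariant; by [Suniq] at most one summand is nonzero at a point of the
    complex. *)
Let s (j : {set I} * I) (y : 'rV[R]_#|I|) : R := \big[Num.min/1]_(i in j.1) co y i.
Let dir (j : {set I} * I) (i : I) : R := (i == j.2)%:R * #|j.1|%:R - (i \in j.1)%:R.
Let D (p : (R * 'rV[R]_#|I|)%type) : 'rV[R]_#|I| :=
  vec (fun i => co p.2 i + p.1 * \sum_(j in S) s j p.2 * dir j i).

Let Dc : continuous D.
Proof.
apply: continuous_vec => i.
have cc k : continuous (fun x : (R * 'rV[R]_#|I|)%type => co x.2 k).
  by apply: continuous_co; exact: continuous_sndE.
apply: continuous_add; first exact: cc.
apply: continuous_mul; first exact: continuous_fstE.
apply: continuous_bigsum => j _; apply: continuous_mul; last exact: continuous_const.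
by apply: continuous_bigmin.
Qed.

Let s_ge0 j y : (forall i, 0 <= co y i) -> 0 <= s j y.
Proof. by move=> y0; apply: le_bigmin. Qed.

Let s_eq0 (j : {set I} * I) y : (forall i, 0 <= co y i) -> ~~ (j.1 \subset supp y) -> s j y = 0.
Proof.
move=> y0 /fintype.subsetPn[i ij]; rewrite in_supp negbK => /eqP yi.
by apply/eqP; rewrite eq_le s_ge0 // andbT -yi; apply: bigmin_le_cond.
Qed.

Let s_le (j : {set I} * I) y i : i \in j.1 -> s j y <= co y i.
Proof. by move=> ij; apply: bigmin_le_cond. Qed.

Let s_attained (j : {set I} * I) y : j.1 != finset.set0 -> (forall i, co y i <= 1) ->
  exists2 i, i \in j.1 & s j y = co y i.
Proof.
move=> /set0Pn[i0 i0j] y1.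
by have [i ij e] := @eq_bigmin _ _ I 1 i0 (mem j.1) (co y) i0j (fun i _ => y1 i); exists i.
Qed.

Let co_le1 (y : 'rV[R]_#|I|) : (forall i, 0 <= co y i) -> \sum_i co y i = 1 -> forall i, co y i <= 1.
Proof.
by move=> y0 <- i; rewrite (bigD1 i) //= lerDl sumr_ge0.
Qed.

Let sum_dir (j : {set I} * I) : \sum_i dir j i = 0.
Proof.
rewrite sumrB (bigD1 j.2) //= eqxx mul1r big1 ?addr0; last by move=> i /negbTE->; rewrite mul0r.
rewrite -[X in X%:R - _]sum1_card natr_sum big_mkcond /= -sumrB big1 // => i _.
by case: (i \in j.1); rewrite subrr.
Qed.

Let D_none t (y : 'rV[R]_#|I|) : (forall j : {set I} * I, j \in S -> ~~ (j.1 \subset supp y)) ->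
  (forall i, 0 <= co y i) -> D (t, y) = y.
Proof.
move=> ns y0; apply: vecP => i; rewrite co_vec /= big1 ?mulr0 ?addr0 // => j jS.
by rewrite s_eq0 ?mul0r // ns.
Qed.

Let D_one t (y : 'rV[R]_#|I|) (j : {set I} * I) : j \in S -> j.1 \subset supp y -> real K y ->
  forall i, co (D (t, y)) i = co y i + t * (s j y * dir j i).
Proof.
move=> jS jy [y0 y1 yK] i; rewrite co_vec /= (bigD1 j) //= big1 ?addr0 // => k /andP[kS kj].
rewrite s_eq0 ?mul0r //; apply: contra kj => ky.
by apply/eqP/(@Suniq k j (supp y)).
Qed.

Let D_real t (y : 'rV[R]_#|I|) : 0 <= t <= 1 -> real K y ->
  real K (D (t, y)) /\ (forall j : {set I} * I, j \in S -> t = 1 -> ~~ (j.1 \subset supp (D (t, y)))).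
Proof.
move=> /andP[t0 t1] yK; have [y0 y1 ysK] := yK.
have [/existsP[j /andP[jS jy]]|/existsPn none] :=
  boolP [exists j, (j \in S) && (j.1 \subset supp y)]; last first.
  have nn j : j \in S -> ~~ (j.1 \subset supp y).
    by move=> jS; have := none j; rewrite jS.
  by rewrite D_none //; split=> // j jS _; apply: nn.
have DE := D_one t jS jy yK; have [jw jn] := Sw jS.
have Dpos i : 0 <= co (D (t, y)) i.
  rewrite DE /dir; have [ij|ij] := boolP (i \in j.1).
    have -> : i == j.2 = false by apply: contraNF jw => /eqP <-.
    rewrite mul0r sub0r mulrN1 mulrN subr_ge0.
    apply: le_trans (s_le y ij); rewrite -[leRHS]mul1r.
    by apply: ler_wpM2r => //; apply: s_ge0.
  rewrite subr0 addr_ge0 // mulr_ge0 // mulr_ge0 ?s_ge0 // mulr_ge0 ?ler0n //.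
have Dsum : \sum_i co (D (t, y)) i = 1.
  under eq_bigr do rewrite DE.
  by rewrite big_split /= y1 -mulr_sumr -mulr_sumr sum_dir !mulr0 addr0.
have Dsub : supp (D (t, y)) \subset j.2 |: j.1.
  have ysub := Sfree jS ysK jy.
  apply/fintype.subsetP => i; rewrite in_supp; apply: contraR => ij.
  have yi : co y i = 0.
    by apply/eqP; apply: contraNT ij => yi; apply: (fintype.subsetP ysub); rewrite in_supp.
  move: ij; rewrite in_setU1 negb_or => /andP[/negbTE ij /negbTE ij1].
  by rewrite DE yi /dir ij ij1 mul0r subrr !mulr0 addr0.
have DK : supp (D (t, y)) \in K by apply: Sdown jS Dsub _; apply: supp_neq0.
(* A free face that survives in the support would lie in the full simplex, hence be [j.1] by
   uniqueness; but [j.1] has lost the vertex where the minimum was attained. *)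
split=> // k kS t1E; apply/negP => kD.
have [i ij si] := s_attained jn (co_le1 y0 y1).
have iD : i \notin supp (D (t, y)).
  rewrite in_supp negbK DE t1E mul1r /dir ij.
  have -> : i == j.2 = false by apply: contraNF jw => /eqP <-.
  by rewrite mul0r sub0r mulrN1 si subrr.
have tauK : j.2 |: j.1 \in K.
  by apply: Sdown jS (subxx _) _; apply/set0Pn; exists j.2; rewrite setU11.
have kj := Suniq kS jS tauK (fintype.subset_trans kD Dsub) (finset.subsetUr _ _).
by move/fintype.subsetP: kD => /(_ i); rewrite kj => /(_ ij); rewrite (negbTE iD).
Qed.

Let D_equiv t y mu : D (t, actI pi y mu) = actI pi (D (t, y)) mu.
Proof.
apply: vecP => i; rewrite (co_act pi) !co_vec /= (co_act pi); congr (_ + _ * _).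
have hK a : cancel (fun j : {set I} * I => (pi a @: j.1, pi a j.2))
               (fun j => (pi a^-1%g @: j.1, pi a^-1%g j.2)).
  by move=> [k w] /=; rewrite (imset_piK piact) (piK piact).
rewrite (reindex_inj (can_inj (hK mu))) /=; apply: eq_big => [j|j jS].
  apply/idP/idP => [|/Sinv//] /(Sinv mu^-1%g) /=.
  by rewrite (imset_piK piact) (piK piact); case: j.
congr (_ * _).
  rewrite /s /= bigmin_imset.
  by apply: eq_bigr => k _; rewrite (co_act pi) (piK piact).
rewrite /dir /= (mem_pi_imset piact) card_imset; last exact: (@pi_inj _ _ _ piact mu).
by rewrite -{1}(piVK piact mu i) (inj_eq (@pi_inj _ _ _ piact mu)).
Qed.

Theorem collapse_ghe : ghe R (actI pi) (actI pi) (@real R I K) (@real R I collapsed).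
Proof.
apply: (@ghe_wdr _ _ _ _ _ _ _ D Dc).
- by move=> y [y0 y1 yK]; split=> //; move: yK; rewrite inE => /andP[].
- move=> y [y0 y1 yK]; apply: vecP => i; rewrite co_vec /= mul0r addr0 //.
- move=> y yK; have t1 : (0 : R) <= 1 <= (1 : R) by apply/andP; split; lra.
  have [[z0 z1 zK] zS] := D_real t1 yK; split=> //; rewrite inE zK /=.
  by apply/forall_inP => j jS; apply: zS.
- by move=> t y t01 /(D_real t01)[].
- move=> t y t01 [y0 y1]; rewrite inE => /andP[yK /forall_inP yS].
  rewrite D_none //; split=> //; rewrite inE yK; exact/forall_inP.
- by move=> t y mu _ _; apply: D_equiv.
Qed.
End Collapse.

Section Reindex.
Variables (R : realType) (I J : finType) (gT : finGroupType).
Variables (piI : gT -> I -> I) (piJ : gT -> J -> J) (iota : J -> I).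
Hypotheses (actI_ : is_act piI) (actJ_ : is_act piJ) (iota_inj : injective iota).
Hypothesis iotaE : forall mu j, iota (piJ mu j) = piI mu (iota j).
Variable K : {set {set J}}.
Hypothesis Kinv : inv_cplx piJ K.

Definition reindexed : {set {set I}} := [set iota @: (k : {set J}) | k in K]%SET.

Let f (y : 'rV[R]_#|J|) : 'rV[R]_#|I| := vec (fun i => \sum_(j | iota j == i) co y j).
Let g (z : 'rV[R]_#|I|) : 'rV[R]_#|J| := vec (fun j => co z (iota j)).

Let gf y : g (f y) = y.
Proof.
apply: vecP => j; rewrite !co_vec (bigD1 j) //= big1 ?addr0 // => k /andP[/eqP/iota_inj->].
by rewrite eqxx.
Qed.

Let f_out y i : i \notin codom iota -> co (f y) i = 0.
Proof.
move=> ni; rewrite co_vec big1 // => j /eqP ji; case/negP: ni.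
by rewrite -ji codom_f.
Qed.

Let supp_f y : supp (f y) = iota @: supp y.
Proof.
apply/setP => i; rewrite in_supp; have [/codomP[j ->]|ni] := boolP (i \in codom iota).
  by rewrite mem_imset // in_supp -[in RHS](gf y) [in RHS]/g [in RHS]co_vec.
rewrite f_out // eqxx; apply/esym/negbTE; apply: contra ni => /imsetP[j _ ->].
exact: codom_f.
Qed.

Let sum_f (z : 'rV[R]_#|I|) : (forall i, i \notin codom iota -> co z i = 0) ->
  \sum_i co z i = \sum_j co z (iota j).
Proof.
move=> z0; rewrite (bigID (mem (codom iota))) /= [X in _ + X]big1 ?addr0 //.
rewrite (eq_bigl (fun i => i \in iota @: finset.setT)); last first.
  move=> i; apply/codomP/imsetP => [[j ->]|[j _ ->]]; last by exists j.
  by exists j => //; rewrite inE.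
rewrite big_imset /=; last by move=> a b _ _; apply: iota_inj.
by apply: eq_bigl => j; rewrite inE.
Qed.

Lemma reindex_ghe :
  ghe R (actI piJ) (actI piI) (@real R J K) (@real R I reindexed).
Proof.
have fY (y : 'rV[R]_#|J|) : real K y -> real reindexed (f y).
  move=> [y0 y1 yK]; split.
  - by move=> i; rewrite co_vec sumr_ge0.
  - rewrite sum_f; last exact: f_out.
    by rewrite -y1; apply: eq_bigr => j _; rewrite -[in RHS](gf y) [in RHS]co_vec.
  - by rewrite supp_f; apply: imset_f.
have z_out (z : 'rV[R]_#|I|) : real reindexed z -> forall i, i \notin codom iota -> co z i = 0.
  move=> [_ _ /imsetP[k kK zk]] i ni; apply/eqP; apply: contraNT ni.
  by rewrite -in_supp zk => /imsetP[j _ ->]; apply: codom_f.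
have fg (z : 'rV[R]_#|I|) : real reindexed z -> f (g z) = z.
  move=> zY; apply: vecP => i; have [/codomP[j ->]|ni] := boolP (i \in codom iota).
    rewrite co_vec (bigD1 j) //= big1 ?addr0 ?co_vec // => k /andP[/eqP/iota_inj->].
    by rewrite eqxx.
  by rewrite f_out // (z_out _ zY).
have gY (z : 'rV[R]_#|I|) : real reindexed z -> real K (g z).
  move=> zY; have [z0 z1 /imsetP[k kK zk]] := zY; split.
  - by move=> j; rewrite co_vec.
  - by rewrite -z1 (sum_f (z_out _ zY)); apply: eq_bigr => j _; rewrite co_vec.
  - rewrite (_ : supp _ = k) //; apply/setP => j.
    by rewrite in_supp co_vec -in_supp zk mem_imset.
have Iinv : inv_cplx piI reindexed.
  move=> mu _ /imsetP[k kK ->]; apply/imsetP; exists (piJ mu @: k); first exact: Kinv.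
  by rewrite -!imset_comp; apply: eq_imset => j /=.
apply: (@ghe_homeo _ _ _ _ _ _ _ _ f g) => //.
- apply: continuous_vec => i; apply: continuous_bigsum => j _.
  by apply: continuous_co => x; apply: cvg_id.
- by apply: continuous_vec => j; apply: continuous_co => x; apply: cvg_id.
- move=> y mu yK; apply: vecP => i; rewrite (co_act piI) !co_vec.
  rewrite [RHS](reindex_inj (@pi_inj _ _ _ actJ_ mu^-1%g)) /=; apply: eq_big => j.
    by rewrite iotaE (inj_eq (@pi_inj _ _ _ actI_ _)).
  by rewrite (co_act piJ).
- by move=> z mu; apply: real_act.
- by move=> z mu; apply: real_act.
Qed.
End Reindex.

(** * Collapses of cubical complexes *)

Section Cubical.
Variables (R : realType) (V : finType) (n : nat).
Local Notation X := ('I_n * V)%type.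

(** Row [p] holds the barycentric coordinates of the [p]-th point. A product cell is encoded by the
    set of pairs (point, vertex) that may carry mass. *)
Definition ent (A : 'M[R]_(n, #|V|)) (x : X) : R := A x.1 (enum_rank x.2).
Definition mxof (f : X -> R) : 'M[R]_(n, #|V|) := \matrix_(p, j) f (p, enum_val j).
Definition csupp A : {set X} := finset (fun x => ent A x != 0).
Definition cub (K : {set {set X}}) : set 'M[R]_(n, #|V|) :=
  [set A | [/\ forall x, 0 <= ent A x, forall p, \sum_v ent A (p, v) = 1 & csupp A \in K]].
(** Row [p] of [actD A s] is row [s p] of [A], so the mass of row [q] moves to row [s^-1 q]. *)
Definition px (s : 'S_n) (x : X) : X := ((s^-1)%g x.1, x.2).

Lemma ent_mxof f x : ent (mxof f) x = f x.
Proof. by case: x => p v; rewrite /ent mxE enum_rankK. Qed.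

Lemma mxofP A B : (forall x, ent A x = ent B x) -> A = B.
Proof.
by move=> AB; apply/matrixP => p j; have := AB (p, enum_val j); rewrite /ent /= enum_valK.
Qed.

Lemma in_csupp A x : (x \in csupp A) = (ent A x != 0).
Proof. by rewrite inE. Qed.

Lemma px_act : is_act px.
Proof.
split=> [[p v]|a b [p v]]; first by rewrite /px invg1 perm1.
by rewrite /px invMg permM.
Qed.

Lemma ent_actD A (s : 'S_n) x : ent (actD A s) x = ent A (px s^-1%g x).
Proof. by case: x => p v; rewrite /ent mxE /px invgK. Qed.

Lemma csupp_actD A (s : 'S_n) : csupp (actD A s) = px s @: csupp A.
Proof. by apply/setP => x; rewrite (mem_pi_imset px_act) !in_csupp ent_actD. Qed.

Lemma cub_act K : inv_cplx px K -> forall A s, cub K A -> cub K (actD A s).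
Proof.
move=> Kinv A s [A0 A1 AK]; split; last by rewrite csupp_actD Kinv.
  by move=> x; rewrite ent_actD.
move=> p; rewrite -(A1 (s p)); apply: eq_bigr => v _.
by rewrite ent_actD /px invgK.
Qed.

Lemma continuous_mxof (T : topologicalType) (F : T -> X -> R) :
  (forall x, continuous (fun t => F t x)) -> continuous (fun t => mxof (F t)).
Proof.
move=> Fc; apply: continuous_mx => p j.
have -> : (fun t => mxof (F t) p j) = (fun t => F t (p, enum_val j)).
  by apply/funext => t; rewrite mxE.
exact: Fc.
Qed.

Lemma continuous_ent (T : topologicalType) (F : T -> 'M[R]_(n, #|V|)) x :
  continuous F -> continuous (fun t => ent (F t) x).
Proof. by move=> Fc; apply: continuous_coord. Qed.
End Cubical.

Section CubicalCollapse.
Variables (R : realType) (V : finType) (n : nat).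
Local Notation X := ('I_n * V)%type.
Variables (K : {set {set X}}) (S : {set {set X} * ('I_n * V * V)}).

Definition fp (j : {set X} * ('I_n * V * V)) : 'I_n := j.2.1.1.
Definition fv (j : {set X} * ('I_n * V * V)) : V := j.2.1.2.
Definition fw (j : {set X} * ('I_n * V * V)) : V := j.2.2.
Definition pair_act (s : 'S_n) (j : {set X} * ('I_n * V * V)) :=
  (px s @: j.1, ((s^-1)%g (fp j), fv j, fw j)).

(* [(s, (p, v, w))] in [S] stands for the free face [s] of the cell obtained by letting
   the [p]-th point, at [v] in [s], run over the edge [v w]. *)
Hypothesis K2 : forall (k : {set X}) p, k \in K -> (#|finset (fun v => (p, v) \in k)| <= 2)%N.
Hypothesis Kdown : forall k k' : {set X}, k \in K -> k' \subset k ->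
  (forall p, exists v, (p, v) \in k') -> k' \in K.
Hypothesis Sinv : forall s j, j \in S -> pair_act s j \in S.
Hypothesis Sw : forall j, j \in S ->
  [/\ (fp j, fv j) \in j.1, (fp j, fw j) \notin j.1 & (fp j, fw j) |: j.1 \in K].
Hypothesis Sfree : forall j (k : {set X}), j \in S -> k \in K ->
  j.1 \subset k -> k \subset (fp j, fw j) |: j.1.
Hypothesis Suniq : forall i j (k : {set X}), i \in S -> j \in S -> k \in K ->
  i.1 \subset k -> j.1 \subset k -> i = j.

Definition ccollapsed : {set {set X}} :=
  [set k in K | [forall j in S, ~~ (j.1 \subset k)]]%SET.

(* The self-map of an edge stretching its middle half over the whole edge. *)
Let E (x : R) : R := Num.min 1 (Num.max 0 (2 * x - 2^-1)).

Let E_bounds x : 0 <= E x <= 1.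
Proof. by rewrite /E le_min ler01 le_max lexx /= ge_min lexx. Qed.

Let E_small x : 4 * x <= 1 -> E x = 0.
Proof.
move=> x4; rewrite /E; have -> : Num.max 0 (2 * x - 2^-1) = 0 by apply/max_idPl; lra.
by apply/min_idPr; lra.
Qed.

Let E0 : E 0 = 0. Proof. by apply: E_small; lra. Qed.

Let E_sum x y : x + y = 1 -> E x + E y = 1.
Proof.
move=> xy; rewrite /E; have -> : y = 1 - x by lra.
have [h|h] := leP 1 (Num.max 0 (2 * x - 2^-1)); have [h'|h'] := leP 1 (Num.max 0 (2 * (1 - x) - 2^-1));
 move: h h'; case: (leP 0 (2 * x - 2^-1)) => ?; case: (leP 0 (2 * (1 - x) - 2^-1)) => ? ? ?; lra.
Qed.

Let Ec (T : topologicalType) (F : T -> R) : continuous F -> continuous (fun t => E (F t)).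
Proof.
move=> Fc; apply: continuous_minr; first exact: continuous_const.
apply: continuous_maxr; first exact: continuous_const.
apply: continuous_sub; last exact: continuous_const.
by apply: continuous_mul => //; exact: continuous_const.
Qed.

(** Pushing the point [fp j] along its edge leaves the other rows as they are, so a push limited by
    their coordinates would never empty anything. The map [E] makes room: it annihilates coordinates
    up to 1/4. The push is cut off at four times the coordinates of the face outside the vertex
    [fv j]. Where the cutoff is effective, one of these is below 1/4 and [E] kills it; elsewhere all
    the mass at [fv j] is moved away. *)
Let s (j : {set X} * ('I_n * V * V)) (A : 'M[R]_(n, #|V|)) : R :=
  Num.min (E (ent A (fp j, fv j))) (\big[Num.min/1]_(x in j.1 :\ (fp j, fv j)) (4 * ent A x)).
Let dir (j : {set X} * ('I_n * V * V)) (x : X) : R :=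
  (x == (fp j, fw j))%:R - (x == (fp j, fv j))%:R.
Let D (q : (R * 'M[R]_(n, #|V|))%type) : 'M[R]_(n, #|V|) :=
  mxof (fun x => ent q.2 x + q.1 * (E (ent q.2 x) - ent q.2 x + \sum_(j in S) s j q.2 * dir j x)).

Let Dc : continuous D.
Proof.
apply: continuous_mxof => x.
have cc k : continuous (fun q : (R * 'M[R]_(n, #|V|))%type => ent q.2 k).
  by apply: continuous_ent; exact: continuous_sndE.
apply: continuous_add; first exact: cc.
apply: continuous_mul; first exact: continuous_fstE.
apply: continuous_add; first by apply: continuous_sub; [apply: Ec|]; exact: cc.
apply: continuous_bigsum => j _; apply: continuous_mul; last exact: continuous_const.
apply: continuous_minr; first by apply: Ec; exact: cc.
apply: continuous_bigmin => k _; apply: continuous_mul; last exact: cc.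
exact: continuous_const.
Qed.

Let s_ge0 (j : {set X} * ('I_n * V * V)) (A : 'M[R]_(n, #|V|)) : (forall x, 0 <= ent A x) -> 0 <= s j A.
Proof.
move=> A0; rewrite /s le_min; have /andP[-> _] := E_bounds (ent A (fp j, fv j)).
by apply: le_bigmin => // x _; apply: mulr_ge0.
Qed.

Let s_eq0 (j : {set X} * ('I_n * V * V)) (A : 'M[R]_(n, #|V|)) : (forall x, 0 <= ent A x) ->
  ~~ (j.1 \subset csupp A) -> s j A = 0.
Proof.
move=> A0 /fintype.subsetPn[x xj]; rewrite in_csupp negbK => /eqP Ax.
apply/eqP; rewrite eq_le s_ge0 // andbT /s ge_min.
have [<-|xp] := eqVneq x (fp j, fv j); first by rewrite Ax E0 lexx.
apply/orP; right; rewrite -[leRHS](_ : 4 * ent A x = 0); last by rewrite Ax mulr0.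
by apply: bigmin_le_cond; rewrite in_setD1 xp.
Qed.

Let s_attained (j : {set X} * ('I_n * V * V)) (A : 'M[R]_(n, #|V|)) : s j A = E (ent A (fp j, fv j)) \/
  exists2 x, x \in j.1 :\ (fp j, fv j) & E (ent A x) = 0.
Proof.
rewrite /s; have [h|h] := leP (E (ent A (fp j, fv j))) (\big[Num.min/1]_(x in j.1 :\ (fp j, fv j)) (4 * ent A x)).
  by left.
right; have /andP[_ E1] := E_bounds (ent A (fp j, fv j)).
apply: contrapT => nx; move: (lt_le_trans h E1); rewrite ltNge => /negP; apply.
apply: le_bigmin => // x xj; rewrite leNgt; apply/negP => x1; apply: nx; exists x => //.
exact/E_small/ltW.
Qed.

(** By [K2] a row has at most two nonzero coordinates, [x] and [1 - x], and [E] respects this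
    symmetry. *)
Let row_sum_E (A : 'M[R]_(n, #|V|)) p : cub K A -> \sum_v E (ent A (p, v)) = 1.
Proof.
move=> [A0 A1 AK]; have := K2 p AK; have := A1 p.
pose B := finset (fun v => (p, v) \in csupp A); rewrite -/B.
have out v : v \notin B -> ent A (p, v) = 0.
  by rewrite inE in_csupp negbK => /eqP.
have bigB (F : R -> R) : F 0 = 0 -> \sum_v F (ent A (p, v)) = \sum_(v in B) F (ent A (p, v)).
  move=> F0; rewrite [RHS]big_mkcond; apply: eq_bigr => v _; case: ifPn => // /out->.
  by rewrite F0.
rewrite (bigB id) // (bigB E) //; rewrite leq_eqVlt => AB /orP[|].
  move=> /cards2P[u [v [uv Buv]]]; move: AB; rewrite Buv.
  rewrite !big_setU1 ?inE //= !big_set1; exact: E_sum.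
rewrite ltnS leq_eqVlt ltnS leqn0 => /orP[/cards1P[u Bu]|/eqP/cards0_eq B0]; move: AB.
  by rewrite Bu !big_set1 => ->; have := E_sum (addr0 1); rewrite E0 addr0.
by rewrite B0 big_set0 => /esym/eqP; rewrite oner_eq0.
Qed.

Let sum_dir (j : {set X} * ('I_n * V * V)) p : \sum_v dir j (p, v) = 0.
Proof.
have eq1 (u : V) : \sum_v ((p, v) == (fp j, u))%:R = (p == fp j)%:R :> R.
  rewrite (bigD1 u) //= big1 ?addr0 ?xpair_eqE ?eqxx ?andbT // => v /negbTE vu.
  by rewrite xpair_eqE vu andbF.
by rewrite sumrB !eq1 subrr.
Qed.

Let D_none t (A : 'M[R]_(n, #|V|)) : (forall j, j \in S -> ~~ (j.1 \subset csupp A)) ->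
  (forall x, 0 <= ent A x) ->
  forall x, ent (D (t, A)) x = ent A x + t * (E (ent A x) - ent A x).
Proof.
move=> ns A0 x; rewrite ent_mxof /= [X in _ * (_ + X)]big1 ?addr0 // => j jS.
by rewrite s_eq0 ?mul0r // ns.
Qed.

Let D_one t (A : 'M[R]_(n, #|V|)) (j : {set X} * ('I_n * V * V)) :
  j \in S -> j.1 \subset csupp A -> cub K A ->
  forall x, ent (D (t, A)) x = ent A x + t * (E (ent A x) - ent A x + s j A * dir j x).
Proof.
move=> jS jA [A0 A1 AK] x; rewrite ent_mxof /= (bigD1 j) //= [X in _ + _ * (_ + (_ + X))]big1 ?addr0 //; last first.
  move=> k /andP[kS kj]; rewrite s_eq0 ?mul0r //; apply: contra kj => kA.
  by apply/eqP/(@Suniq k j (csupp A)).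
Qed.

Let supp_rows (A : 'M[R]_(n, #|V|)) : (forall p, \sum_v ent A (p, v) = 1) ->
  forall p, exists v, (p, v) \in csupp A.
Proof.
move=> A1 p; apply: contrapT => nv; have := oner_neq0 R.
rewrite -(A1 p) big1 ?eqxx // => v _; apply/eqP/negPn/negP => v0; apply: nv.
by exists v; rewrite in_csupp.
Qed.

Let conv_ge0 t a : 0 <= t <= 1 -> 0 <= a -> 0 <= a + t * (E a - a).
Proof.
move=> /andP[t0 t1] a0; have /andP[e0 _] := E_bounds a.
have -> : a + t * (E a - a) = (1 - t) * a + t * E a by ring.
by rewrite addr_ge0 // mulr_ge0 // subr_ge0.
Qed.

(** The disjunction is used twice: with [t = 1] it shows that the final map lands in the collapsed
    complex, with the other alternative that the collapsed complex is preserved at all times. *)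
Let D_cub t (A : 'M[R]_(n, #|V|)) : 0 <= t <= 1 -> cub K A ->
  cub K (D (t, A)) /\
  (t = 1 \/ (forall j, j \in S -> ~~ (j.1 \subset csupp A)) ->
   forall j, j \in S -> ~~ (j.1 \subset csupp (D (t, A)))).
Proof.
move=> t01 AK; have [A0 A1 AsK] := AK; have /andP[t0 t1] := t01.
have [/existsP[j /andP[jS jA]]|/existsPn none] :=
  boolP [exists j, (j \in S) && (j.1 \subset csupp A)]; last first.
  have nn j : j \in S -> ~~ (j.1 \subset csupp A).
    by move=> jS; have := none j; rewrite jS.
  have DE := D_none t nn A0.
  have Dsub : csupp (D (t, A)) \subset csupp A.
    apply/fintype.subsetP => x; rewrite !in_csupp DE; apply: contra => /eqP->.
    by rewrite E0 subrr mulr0 addr0.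
  have D1 p : \sum_v ent (D (t, A)) (p, v) = 1.
    under eq_bigr do rewrite DE.
    by rewrite big_split /= -mulr_sumr sumrB A1 row_sum_E // subrr mulr0 addr0.
  split; last first.
    by move=> _ j /nn; apply: contra => h; apply: fintype.subset_trans h Dsub.
  split => //; first by move=> x; rewrite DE conv_ge0.
  by apply: Kdown AsK Dsub _; apply: supp_rows.
have DE := D_one t jS jA AK; have [jv jw tauK] := Sw jS.
have vw : fv j != fw j by apply: contraNN jw => /eqP <-.
have Dpos x : 0 <= ent (D (t, A)) x.
  rewrite DE /dir; have [xv|xv] := eqVneq x (fp j, fv j).
    have -> : x == (fp j, fw j) = false by rewrite xv xpair_eqE (negbTE vw) andbF.
    rewrite sub0r mulrN1 mulrDr -mulrDr.
    have sE : s j A <= E (ent A x) by rewrite xv /s ge_min lexx.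
    have -> : ent A x + t * (E (ent A x) - ent A x - s j A) =
      (1 - t) * ent A x + t * (E (ent A x) - s j A) by ring.
    by rewrite addr_ge0 // mulr_ge0 // subr_ge0.
  rewrite subr0 mulrDr addrA addr_ge0 ?conv_ge0 // mulr_ge0 // mulr_ge0 ?s_ge0 //.
have D1 p : \sum_v ent (D (t, A)) (p, v) = 1.
  under eq_bigr do rewrite DE.
  by rewrite big_split /= -mulr_sumr big_split /= -mulr_sumr sum_dir sumrB A1 row_sum_E // subrr !mulr0 !addr0 mulr0 addr0.
have Dsub : csupp (D (t, A)) \subset (fp j, fw j) |: j.1.
  have Asub := Sfree jS AsK jA.
  apply/fintype.subsetP => x; rewrite in_csupp; apply: contraR => xj.
  have Ax : ent A x = 0.
    by apply/eqP; apply: contraNT xj => Ax; apply: (fintype.subsetP Asub); rewrite in_csupp.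
  move: xj; rewrite in_setU1 negb_or => /andP[/negbTE xw xj1].
  have -> := DE x; rewrite Ax /dir xw E0.
  have -> : x == (fp j, fv j) = false by apply: contraNF xj1 => /eqP->.
  by rewrite !subrr mulr0 addr0 mulr0 addr0.
have DK : csupp (D (t, A)) \in K by apply: Kdown tauK Dsub _; apply: supp_rows.
split=> //; case=> [t1E|nn]; last by have := nn j jS; rewrite jA.
move=> k kS; apply/negP => kD.
(* The two cases of the cutoff: either [fv j] has been emptied, or [E] has annihilated another
   coordinate of the face. *)
have [x xj Dx] : exists2 x, x \in j.1 & ent (D (t, A)) x = 0.
  case: (s_attained j A) => [sE|[x]].
    exists (fp j, fv j) => //; rewrite DE t1E mul1r sE /dir eqxx xpair_eqE (negbTE vw) andbF sub0r mulrN1.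
    by ring.
  rewrite in_setD1 => /andP[xv xj] Ex; exists x => //.
  rewrite DE t1E mul1r Ex /dir (negbTE xv).
  have -> : x == (fp j, fw j) = false by apply: contraNF jw => /eqP <-.
  by rewrite subrr mulr0 addr0 sub0r subrr.
have kj := Suniq kS jS tauK (fintype.subset_trans kD Dsub) (finset.subsetUr _ _).
by move/fintype.subsetP: kD => /(_ x); rewrite kj => /(_ xj); rewrite in_csupp Dx eqxx.
Qed.

Let D_equiv t A mu : D (t, actD A mu) = actD (D (t, A)) mu.
Proof.
have pA := @px_act V n; have pI := @pi_inj _ _ _ pA.
apply: mxofP => x; rewrite ent_actD !ent_mxof /= !ent_actD; congr (_ + _ * (_ + _)).
have hK a : cancel (pair_act a) (pair_act a^-1%g).
  move=> [k [[p v] w]]; rewrite /pair_act /fp /fv /fw /= (imset_piK pA).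
  by rewrite invgK permKV.
rewrite (reindex_inj (can_inj (hK mu))) /=; apply: eq_big => [j|j jS].
  apply/idP/idP => [|/Sinv//] /(Sinv mu^-1%g); by rewrite hK.
have eqx u : (x == (fp (pair_act mu j), u)) = (px mu^-1%g x == (fp j, u)).
  case: x => p v; rewrite /px /= !xpair_eqE invgK /fp /=; congr (_ && _).
  by rewrite -(inj_eq (@perm_inj _ mu)) permKV.
congr (_ * _); last by rewrite /dir !eqx.
rewrite /s; congr (Num.min _ _).
  by rewrite ent_actD /px /= invgK permKV.
have -> : (pair_act mu j).1 :\ (fp (pair_act mu j), fv (pair_act mu j)) =
    px mu @: (j.1 :\ (fp j, fv j)).
  apply/setP => y; rewrite (mem_pi_imset pA) !in_setD1 (mem_pi_imset pA); congr (~~ _ && _).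
  case: y => p v; rewrite /px /= !xpair_eqE invgK /fp /=; congr (_ && _).
  by rewrite -(inj_eq (@perm_inj _ mu)) permKV.
rewrite bigmin_imset; apply: eq_bigr => k _.
by rewrite ent_actD (piK pA).
Qed.

Theorem ccollapse_ghe : ghe R (@actD R n #|V|) (@actD R n #|V|) (@cub R V n K) (@cub R V n ccollapsed).
Proof.
apply: (@ghe_wdr _ _ _ _ _ _ _ D Dc).
- by move=> A [A0 A1 AK]; split=> //; move: AK; rewrite inE => /andP[].
- by move=> A [A0 A1 AK]; apply: mxofP => x; rewrite ent_mxof /= mul0r addr0.
- move=> A AK; have t1 : (0 : R) <= 1 <= (1 : R) by apply/andP; split; lra.
  have [[z0 z1 zK] zS] := D_cub t1 AK; split=> //; rewrite inE zK /=.
  by apply/forall_inP => j jS; apply: zS => //; left.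
- by move=> t A t01 /(D_cub t01)[].
- move=> t A t01 [A0 A1]; rewrite inE => /andP[AK /forall_inP AS].
  have [[z0 z1 zK] zS] := D_cub t01 (And3 A0 A1 AK); split=> //; rewrite inE zK /=.
  by apply/forall_inP => j jS; apply: zS => //; right.
- by move=> t A mu _ _; apply: D_equiv.
Qed.
End CubicalCollapse.

Import mathcomp.boot.fintype mathcomp.boot.finset.
Local Close Scope classical_set_scope.

(** * Moves on equivariant graphs *)

Section GraphMoves.
Variables (R : realType) (I : finType) (gT : finGroupType) (pi : gT -> I -> I).
Hypothesis piact : is_act pi.
Local Notation cplx := {set {set I}}.
Implicit Types (K S T : cplx) (a b c : I) (k : {set I}).

Definition heq K K' := ghe R (actI pi) (actI pi) (@real R I K) (@real R I K').

Lemma heq_sym K K' : heq K K' -> heq K' K.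
Proof. exact: ghe_sym. Qed.

Lemma heq_trans K1 K2 K3 : inv_cplx pi K1 -> inv_cplx pi K3 ->
  heq K1 K2 -> heq K2 K3 -> heq K1 K3.
Proof.
by move=> i1 i3; apply: ghe_trans => y mu; apply: real_act.
Qed.

Lemma heq_refl K : inv_cplx pi K -> heq K K.
Proof.
move=> iK; apply: (@ghe_homeo _ _ _ _ _ _ _ _ id id) => //.
- by move=> x; apply: cvg_id.
- by move=> x; apply: cvg_id.
- by move=> y mu; apply: real_act.
- by move=> y mu; apply: real_act.
Qed.

Definition orb k : cplx := [set pi mu @: k | mu in [set: gT]].

Lemma orbP k k0 : reflect (exists mu, k = pi mu @: k0) (k \in orb k0).
Proof.
apply: (iffP imsetP) => [[mu _ ->]|[mu ->]]; first by exists mu.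
by exists mu; rewrite ?inE.
Qed.

Lemma orb_refl k : k \in orb k.
Proof. by apply/orbP; exists 1%g; rewrite imset_pi1. Qed.

Lemma inv_orb k : inv_cplx pi (orb k).
Proof.
by move=> mu _ /orbP[nu ->]; apply/orbP; exists (mu * nu)%g; rewrite imset_pi_comp.
Qed.

Lemma inv_setU S T : inv_cplx pi S -> inv_cplx pi T -> inv_cplx pi (S :|: T).
Proof. by move=> iS iT mu k; rewrite !inE => /orP[/iS->|/iT->]; rewrite ?orbT. Qed.

Lemma inv_memE S mu k : inv_cplx pi S -> (pi mu @: k \in S) = (k \in S).
Proof.
move=> iS; apply/idP/idP; last exact: iS.
by move/(iS mu^-1%g); rewrite imset_piK.
Qed.

Lemma pi_set1 mu a : pi mu @: [set a] = [set pi mu a].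
Proof. exact: imset_set1. Qed.

Lemma pi_set2 mu a b : pi mu @: [set a; b] = [set pi mu a; pi mu b].
Proof. by rewrite imsetU1 imset_set1. Qed.

Lemma pi_set3 mu a b c : pi mu @: [set a; b; c] = [set pi mu a; pi mu b; pi mu c].
Proof. by rewrite imsetU imsetU1 !imset_set1. Qed.

(** The pairs are all translates of [(s, w)]. Since only the identity maps [s] into [w |: s], no
    simplex contains two different translates of [s], and the whole orbit collapses at once. *)
Lemma collapse_orb K K' (s : {set I}) w :
  inv_cplx pi K -> w \notin s -> s != set0 ->
  (forall k, k \subset w |: s -> k != set0 -> k \in K) ->
  (forall k, k \in K -> s \subset k -> k \subset w |: s) ->
  (forall mu, pi mu @: s \subset w |: s -> mu = 1%g) ->
  (forall k, k \in K' <-> k \in K /\ forall mu, ~~ (pi mu @: s \subset k)) ->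
  heq K K'.
Proof.
move=> iK ws s0 sub free fixed K'E.
pose S := [set (pi mu @: s, pi mu w) | mu in [set: gT]].
have SP j : reflect (exists mu, j = (pi mu @: s, pi mu w)) (j \in S).
  apply: (iffP imsetP) => [[mu _ ->]|[mu ->]]; first by exists mu.
  by exists mu; rewrite ?inE.
have pi_sub mu k k' : (pi mu @: k \subset k') = (k \subset pi mu^-1%g @: k').
  apply/subsetP/subsetP => h i.
    by move=> ik; rewrite mem_pi_imset // invgK h // imset_f.
  by rewrite mem_pi_imset // => /h; rewrite mem_pi_imset // invgK piVK.
have push mu : pi mu w |: pi mu @: s = pi mu @: (w |: s) by rewrite imsetU1.
rewrite (_ : K' = collapsed K S); last first.
  apply/setP => k; apply/idP/idP.
    move/K'E => [kK ks]; rewrite inE kK /=; apply/forall_inP => j /SP[mu ->]; exact: ks.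
  rewrite inE => /andP[kK /forall_inP h]; apply/K'E; split=> // mu.
  by apply: (h (pi mu @: s, pi mu w)); apply/SP; exists mu.
apply: (@collapse_ghe R I gT pi piact K S) => //.
- move=> mu j /SP[nu ->]; apply/SP; exists (mu * nu)%g.
  by rewrite /= imset_pi_comp // pi_comp.
- move=> j /SP[mu ->] /=; rewrite mem_imset; last exact: (@pi_inj _ _ _ piact).
  split=> //; apply: contra s0; rewrite -!cards_eq0 card_imset //.
  exact: (@pi_inj _ _ _ piact).
- move=> j k /SP[mu ->] /=; rewrite push => ks k0.
  rewrite -(inv_memE mu^-1%g k iK); apply: sub.
    by rewrite pi_sub invgK.
  apply: contra k0; rewrite -!cards_eq0 card_imset //; exact: (@pi_inj _ _ _ piact).
- move=> j k /SP[mu ->] kK /=; rewrite push pi_sub => /(free _ (iK _ _ kK)).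
  by rewrite pi_sub invgK.
- move=> i j k /SP[mu ->] /SP[nu ->] kK /=; rewrite !pi_sub => sm sn.
  have {sm} h := free _ (iK _ _ kK) sm.
  have sn' : pi (mu^-1 * nu)%g @: s \subset pi mu^-1%g @: k.
    rewrite imset_pi_comp //; apply: imsetS.
    by rewrite pi_sub.
  have e := fixed _ (subset_trans sn' h).
  by have -> : nu = mu by rewrite -[nu](mulKVg mu) e mulg1.
Qed.
End GraphMoves.

Section ElementaryMoves.
Variables (R : realType) (I : finType) (gT : finGroupType) (pi : gT -> I -> I).
Hypothesis piact : is_act pi.
Local Notation cplx := {set {set I}}.
Implicit Types (K S T : cplx) (a b c : I) (k : {set I}).
Local Notation heq := (heq R pi).
Local Notation orb := (orb pi).

Definition free_at a := forall mu, pi mu a = a -> mu = 1%g.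
Definition indep a b := forall mu, pi mu a <> b.
Definition fresh S a := forall k, k \in S -> a \notin k.

Lemma indep_sym a b : indep a b -> indep b a.
Proof. by move=> ab mu e; apply: (ab mu^-1%g); rewrite -e piK. Qed.

Lemma indep_pi a b mu nu : indep a b -> pi mu a <> pi nu b.
Proof. by move=> ab e; apply: (ab (nu^-1 * mu)%g); rewrite pi_comp // e piK. Qed.

Lemma fresh_pi S a mu k : inv_cplx pi S -> fresh S a -> k \in S -> pi mu a \notin k.
Proof.
move=> iS fa kS; have := fa _ (iS mu^-1%g _ kS).
by rewrite mem_pi_imset // invgK.
Qed.

Lemma fresh_indep S a b : inv_cplx pi S -> fresh S a -> [set b] \in S -> indep b a.
Proof.
move=> iS fa bS mu e; have := fresh_pi mu^-1%g iS fa bS.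
by rewrite inE -e piK // eqxx.
Qed.

Lemma pi_eq mu nu a : free_at a -> pi mu a = pi nu a -> mu = nu.
Proof.
move=> fa e; have := fa (nu^-1 * mu)%g; rewrite pi_comp // e piK // => /(_ erefl) h.
by rewrite -[mu](mulKVg nu) h mulg1.
Qed.

Lemma subset2 k a b : k \subset [set a; b] -> k != set0 ->
  [\/ k = [set a], k = [set b] | k = [set a; b]].
Proof.
move=> /subsetP ks k0.
have [ak|ak] := boolP (a \in k); have [bk|bk] := boolP (b \in k).
- constructor 3; apply/setP => i; apply/idP/idP => [/ks//|].
  by rewrite !inE => /orP[/eqP->|/eqP->].
- constructor 1; apply/setP => i; rewrite inE; apply/idP/eqP => [ik|->//].
  by have := ks _ ik; rewrite !inE => /orP[/eqP//|/eqP e]; rewrite -e ik in bk.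
- constructor 2; apply/setP => i; rewrite inE; apply/idP/eqP => [ik|->//].
  by have := ks _ ik; rewrite !inE => /orP[/eqP e|/eqP//]; rewrite -e ik in ak.
- case/set0Pn: k0 => i ik; have := ks _ ik.
  by rewrite !inE => /orP[/eqP e|/eqP e]; [rewrite -e ik in ak|rewrite -e ik in bk].
Qed.

(** As [b] has trivial stabilizer, each translate of [b] lies on a single edge and is a free face.
    Read backwards, the lemma grows an orbit of leaves. *)
Lemma leaf_removal S a b : inv_cplx pi S -> [set a] \in S -> fresh S b -> free_at b ->
  heq (S :|: orb [set b] :|: orb [set a; b]) S.
Proof.
move=> iS aS fbS fb; have ab := fresh_indep iS fbS aS.
have iK : inv_cplx pi (S :|: orb [set b] :|: orb [set a; b]).
  by do !apply: inv_setU => //; apply: inv_orb.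
have inb mu k : k \in S :|: orb [set b] :|: orb [set a; b] -> pi mu b \in k ->
    k = [set pi mu b] \/ k = [set pi mu a; pi mu b].
  rewrite !in_setU -orbA => /or3P[kS|/orbP[nu ->]|/orbP[nu ->]].
  - by rewrite (negbTE (fresh_pi mu iS fbS kS)).
  - by rewrite pi_set1 inE => /eqP/(pi_eq fb)->; left.
  - rewrite pi_set2 !inE => /orP[/eqP/esym/(indep_pi ab)//|/eqP/(pi_eq fb)->]; by right.
apply: (@collapse_orb _ _ _ _ piact _ _ [set b] a) => //.
- by rewrite inE; apply/eqP => e; apply: (ab 1%g); rewrite pi_id.
- by apply/set0Pn; exists b; rewrite inE.
- move=> k ks k0; rewrite !inE; case: (subset2 ks k0) => ->; rewrite ?aS ?orb_refl ?orbT //.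
- move=> k kK; rewrite sub1set => bk; have := inb 1%g k kK; rewrite !pi_id // => /(_ bk)[->|->].
    exact: subsetUr.
  exact: subxx.
- move=> mu; rewrite pi_set1 sub1set !inE => /orP[/eqP e|/eqP/fb//].
  by case: (indep_sym ab e).
- move=> k; split=> [kS|[kK kn]].
    split=> [|mu]; first by rewrite !in_setU kS.
    by rewrite pi_set1 sub1set (fresh_pi mu iS fbS kS).
  have bn mu : pi mu b \notin k by have := kn mu; rewrite pi_set1 sub1set.
  move: kK; rewrite !in_setU -orbA => /or3P[//|/orbP[nu e]|/orbP[nu e]].
    by have := bn nu; rewrite e pi_set1 inE eqxx.
  by have := bn nu; rewrite e pi_set2 !inE eqxx orbT.
Qed.

Section Slide.
Variables (S : cplx) (a b c : I).
Hypotheses (iS : inv_cplx pi S) (aS : [set a] \in S) (bS : [set b] \in S)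
  (cS : [set c] \in S) (bcS : [set b; c] \in S).
Hypothesis aSn : forall k, k \in S -> a \in k -> (b \notin k) && (c \notin k).
Hypotheses (fa : free_at a) (ab : indep a b) (ac : indep a c) (bc : b <> c).

Let Z := S :|: orb [set a; b] :|: orb [set a; c] :|: orb [set b; a; c].

Let neqs : ((a == b) = false) * ((a == c) = false) * ((b == c) = false) *
  ((b == a) = false) * ((c == a) = false) * ((c == b) = false).
Proof.
have nab : (a == b) = false by apply/eqP => e; apply: (ab (mu := 1%g)); rewrite pi_id.
have nac : (a == c) = false by apply/eqP => e; apply: (ac (mu := 1%g)); rewrite pi_id.
have nbc : (b == c) = false by apply/eqP.
by rewrite nab nac nbc (eq_sym b a) (eq_sym c a) (eq_sym c b) nab nac nbc.
Qed.

Let iZ : inv_cplx pi Z.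
Proof. by do !apply: inv_setU => //; apply: inv_orb. Qed.

Let subset3 k : k \subset [set b; a; c] -> k != set0 -> k \in Z.
Proof.
move=> ks k0; rewrite !inE.
have [ak|ak] := boolP (a \in k); last first.
  have kbc : k \subset [set b; c].
    apply/subsetP => i ik; have := subsetP ks _ ik; rewrite !inE.
    case: (eqVneq i b) => //= _; case: (eqVneq i a) => //= e.
    by rewrite -e ik in ak.
  by case: (subset2 kbc k0) => ->; rewrite ?bS ?cS ?bcS.
have [bk|bk] := boolP (b \in k); have [ck|ck] := boolP (c \in k).
- have -> : k = [set b; a; c].
    apply/eqP; rewrite eqEsubset ks; apply/subsetP => i.
    by rewrite !inE -orbA => /or3P[/eqP->|/eqP->|/eqP->].
  by rewrite orb_refl ?orbT.
- have -> : k = [set a; b].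
    apply/setP => i; apply/idP/idP; last by rewrite !inE => /orP[/eqP->|/eqP->].
    move=> ik; have := subsetP ks _ ik; rewrite !inE.
    case: (eqVneq i c) => [e|_]; first by rewrite -e ik in ck.
    by rewrite orbF orbC.
  by rewrite orb_refl ?orbT.
- have -> : k = [set a; c].
    apply/setP => i; apply/idP/idP; last by rewrite !inE => /orP[/eqP->|/eqP->].
    move=> ik; have := subsetP ks _ ik; rewrite !inE.
    by case: (eqVneq i b) => [e|_] //; rewrite -e ik in bk.
  by rewrite orb_refl ?orbT.
- have -> : k = [set a].
    apply/setP => i; apply/idP/idP; last by rewrite !inE => /eqP->.
    move=> ik; have := subsetP ks _ ik; rewrite !inE.
    case: (eqVneq i b) => [e|_]; first by rewrite -e ik in bk.
    case: (eqVneq i c) => [e|_]; first by rewrite -e ik in ck.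
    by rewrite orbF.
  by rewrite aS.
Qed.

(** The edge [[set a; c]] is a free face of the triangle: nothing in [S] joins [a] to [c], and a
    translate of the new simplices that contains [a] is the simplex itself, because [a] has trivial
    stabilizer and its orbit avoids [b] and [c]. *)
Lemma slide_half : heq Z (S :|: orb [set a; b]).
Proof.
have a_only mu x y : indep a x -> indep a y -> a \in [set pi mu a; pi mu x; pi mu y] -> mu = 1%g.
  move=> ax ay; rewrite !inE -orbA => /or3P[/eqP/esym/fa//|/eqP/esym e|/eqP/esym e].
    by case: (indep_sym ax e).
  by case: (indep_sym ay e).
have Zac k : k \in Z -> a \in k -> c \in k -> k = [set a; c] \/ k = [set b; a; c].
  rewrite !in_setU -!orbA => /or4P[kS|/orbP[mu ->]|/orbP[mu ->]|/orbP[mu ->]].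
  - by move=> /(aSn kS)/andP[_ /negbTE->].
  - rewrite pi_set2 => ak; have m1 : mu = 1%g.
      by apply: (a_only mu b b) => //; rewrite -setUA setUid.
    by rewrite m1 !pi_id // !inE !neqs.
  - rewrite pi_set2 => ak; have m1 : mu = 1%g.
      by apply: (a_only mu c c) => //; rewrite -setUA setUid.
    by rewrite m1 !pi_id //; left.
  - rewrite pi_set3 => ak; have m1 : mu = 1%g.
      by apply: (a_only mu b c) => //; rewrite [[set pi mu a; _]]setUC.
    by rewrite m1 !pi_id //; right.
apply: (@collapse_orb _ _ _ _ piact _ _ [set a; c] b) => //.
- by rewrite !inE !neqs.
- by apply/set0Pn; exists a; rewrite !inE eqxx.
- by rewrite setUA; apply: subset3.
- move=> k kZ; rewrite subUset !sub1set setUA => /andP[ak ck].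
  by case: (Zac k kZ ak ck) => ->; rewrite ?subxx // -setUA subsetUr.
- move=> mu; rewrite pi_set2 subUset !sub1set => /andP[+ _].
  rewrite !inE => /or3P[/eqP e|/eqP/fa//|/eqP e]; first by case: (ab e).
  by case: (ac e).
- move=> k; split=> [kK|[kZ kn]].
    split; first by move: kK; rewrite !inE => ->.
    move=> mu; apply/negP => sk.
    have {}sk : [set a; c] \subset pi mu^-1%g @: k.
      by have := imsetS (pi mu^-1%g) sk; rewrite imset_piK.
    have kZ : pi mu^-1%g @: k \in S :|: orb [set a; b].
      have iO : inv_cplx pi (S :|: orb [set a; b]).
        by apply: inv_setU => //; apply: inv_orb.
      exact: iO.
    move: sk; rewrite subUset !sub1set => /andP[ak ck].
    move: kZ; rewrite in_setU => /orP[kS|kO].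
      by have := aSn kS ak; rewrite ck andbF.
    have kZ : pi mu^-1%g @: k \in Z by rewrite !inE kO !orbT.
    case/orbP: kO => nu e; case: (Zac _ kZ ak ck) => e'.
      have : b \in pi nu @: [set a; b] -> False by rewrite -e e' !inE !neqs.
      apply; have nu1 : nu = 1%g.
        by apply: (a_only nu b b) => //; rewrite -setUA setUid -pi_set2 -e.
      by rewrite nu1 pi_set2 !pi_id // !inE eqxx orbT.
    have := card_imset (mem [set a; b]) (@pi_inj _ _ _ piact nu).
    by rewrite -e e' cards2 neqs setUC cardsU1 cards2 !inE !neqs.
  have acn mu nu : k = pi nu @: [set a; c] \/ k = pi nu @: [set b; a; c] -> mu = nu -> False.
    move=> e _; have := kn nu; case: e => ->; rewrite ?subxx //.
    by rewrite imsetS // -setUA subsetUr.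
  move: kZ; rewrite !in_setU -!orbA => /or4P[->//|->|/orbP[mu e]|/orbP[mu e]]; rewrite ?orbT //.
    by case: (acn mu mu) => //; left.
  by case: (acn mu mu) => //; right.
Qed.
End Slide.

(** Filling in the orbit of the triangle on [a], [b], [c] gives a common expansion of both graphs;
    which edge survives depends on the free face that is used. *)
Lemma slide S a b c : inv_cplx pi S -> [set a] \in S -> [set b] \in S ->
  [set c] \in S -> [set b; c] \in S ->
  (forall k, k \in S -> a \in k -> (b \notin k) && (c \notin k)) ->
  free_at a -> indep a b -> indep a c -> b <> c ->
  heq (S :|: orb [set a; b]) (S :|: orb [set a; c]).
Proof.
move=> iS aS bS cS bcS aSn fa ab ac bc.
have h1 : heq (S :|: orb [set a; b] :|: orb [set a; c] :|: orb [set b; a; c])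
    (S :|: orb [set a; b]) by exact: slide_half.
have h2 : heq (S :|: orb [set a; c] :|: orb [set a; b] :|: orb [set c; a; b]) (S :|: orb [set a; c]).
  apply: slide_half => //; [by rewrite setUC| |by move/esym].
  by move=> k kS /(aSn k kS); rewrite andbC.
have iO x y : inv_cplx pi (S :|: orb [set x; y]).
  by apply: inv_setU => //; apply: inv_orb.
apply: (heq_trans piact (iO _ _) (iO _ _) (heq_sym h1)).
rewrite (_ : _ :|: orb [set b; a; c] =
  S :|: orb [set a; c] :|: orb [set a; b] :|: orb [set c; a; b]) //.
have -> : [set b; a; c] = [set c; a; b].
  by apply/setP => i; rewrite !inE; case: (i == a); case: (i == b); case: (i == c).
by congr (_ :|: _); apply: setUAC.
Qed.
End ElementaryMoves.

(** * Sliding, lengthening and shortening subdivided edges *)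

Section Arcs.
Variables (R : realType) (I : finType) (gT : finGroupType) (pi : gT -> I -> I).
Hypothesis piact : is_act pi.
Local Notation cplx := {set {set I}}.
Implicit Types (K S T : cplx) (a b c x y : I) (k : {set I}).
Local Notation heq := (heq R pi).
Local Notation orb := (orb pi).
Local Notation indep := (indep pi).
Local Notation free_at := (free_at pi).

Lemma notin_orb1 u i k : indep u i -> k \in orb [set u] -> i \notin k.
Proof.
move=> ui /orbP[mu ->]; rewrite pi_set1 // inE; apply/eqP => e.
exact: (ui mu).
Qed.

Lemma notin_orb2 u v i k : indep u i -> indep v i -> k \in orb [set u; v] -> i \notin k.
Proof.
move=> ui vi /orbP[mu ->]; rewrite pi_set2 // !inE; apply/norP; split; apply/eqP => e.
  exact: (ui mu).
exact: (vi mu).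
Qed.

(* The orbit of a path [x - m0 - m1 - y], with its ends removed. *)
Definition arc (m0 m1 x y : I) : cplx :=
  orb [set m0] :|: orb [set m1] :|: orb [set x; m0] :|: orb [set m0; m1] :|: orb [set m1; y].

Lemma inv_arc m0 m1 x y : inv_cplx pi (arc m0 m1 x y).
Proof. by do !apply: inv_setU; apply: inv_orb. Qed.

Lemma arcC m0 m1 x y : arc m0 m1 x y = arc m1 m0 y x.
Proof.
rewrite /arc (setUC [set m1] [set y]) (setUC [set m1] [set m0]) (setUC [set x]).
apply/setP => k; rewrite !inE.
by case: (k \in orb [set m0]); case: (k \in orb [set m1]); case: (k \in orb [set m0; m1]);
  case: (k \in orb [set m0; x]); case: (k \in orb [set y; m1]).
Qed.

Variables (S : cplx) (m0 m1 : I).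
Hypotheses (iS : inv_cplx pi S) (f0 : fresh S m0) (f1 : fresh S m1)
  (F0 : free_at m0) (F1 : free_at m1) (m01 : indep m0 m1).

Let m10 : indep m1 m0. Proof. exact: indep_sym. Qed.

(** The edge is lengthened by slides: a leaf [m0] is grown at [a] and the edge from [b] slides from
    [a] to [m0]; then a leaf [m1] is grown at [m0] and the edge slides once more. *)
Lemma edge_to_arc a b : [set a] \in S -> [set b] \in S ->
  (forall k, k \in S -> a \in k -> b \notin k) -> free_at b -> indep b a ->
  heq (S :|: orb [set a; b]) (S :|: arc m0 m1 a b).
Proof.
move=> aS bS abS Fb ba.
have a0 := fresh_indep piact iS f0 aS; have a1 := fresh_indep piact iS f1 aS.
have b0 := fresh_indep piact iS f0 bS; have b1 := fresh_indep piact iS f1 bS.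
have a0' := indep_sym piact a0; have a1' := indep_sym piact a1.
have b0' := indep_sym piact b0; have b1' := indep_sym piact b1.
have iO k : inv_cplx pi (orb k) by apply: inv_orb.
pose S1 := S :|: orb [set a; b]; have iS1 : inv_cplx pi S1 by apply: inv_setU.
have f01 : fresh S1 m0.
  by move=> k; rewrite in_setU => /orP[/f0//|]; apply: notin_orb2.
have f11 : fresh S1 m1.
  by move=> k; rewrite in_setU => /orP[/f1//|]; apply: notin_orb2.
have e1 : heq S1 (S1 :|: orb [set m0] :|: orb [set a; m0]).
  by apply/heq_sym/leaf_removal => //; rewrite in_setU aS.
pose S2 := S :|: orb [set m0] :|: orb [set a; m0].
have iS2 : inv_cplx pi S2 by do !apply: inv_setU.
have e2 : heq (S2 :|: orb [set b; a]) (S2 :|: orb [set b; m0]).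
  apply: slide => //; try by rewrite !in_setU ?aS ?bS ?orb_refl ?orbT.
  - move=> k; rewrite !in_setU -orbA => /or3P[kS|kO|kO] bk.
    + by rewrite f0 // andbT; apply: contraL bk; apply: abS.
    + by have := notin_orb1 b0' kO; rewrite bk.
    + by have := notin_orb2 (indep_sym piact ba) b0' kO; rewrite bk.
  - by move=> e; apply: (a0 1%g); rewrite pi_id.
pose S3 := S2 :|: orb [set b; m0]; have iS3 : inv_cplx pi S3 by apply: inv_setU.
have e3 : heq S3 (S3 :|: orb [set m1] :|: orb [set m0; m1]).
  apply/heq_sym/leaf_removal => //; first by rewrite !in_setU orb_refl ?orbT.
  move=> k; rewrite !in_setU -!orbA => /or4P[/f1//|kO|kO|kO].
  - exact: notin_orb1 kO.
  - exact: notin_orb2 kO.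
  - exact: notin_orb2 kO.
pose S4 := S2 :|: orb [set m1] :|: orb [set m0; m1].
have iS4 : inv_cplx pi S4 by do !apply: inv_setU.
have e4 : heq (S4 :|: orb [set b; m0]) (S4 :|: orb [set b; m1]).
  apply: slide => //; try by rewrite !in_setU ?aS ?bS ?orb_refl ?orbT.
  - move=> k; rewrite !in_setU -!orbA => /or4P[kS|kO|kO|/orP[kO|kO]] bk.
    + by rewrite f0 ?f1.
    + by have := notin_orb1 b0' kO; rewrite bk.
    + by have := notin_orb2 (indep_sym piact ba) b0' kO; rewrite bk.
    + by have := notin_orb1 b1' kO; rewrite bk.
    + by have := notin_orb2 b0' b1' kO; rewrite bk.
  - by move=> e; apply: (m01 (mu := 1%g)); rewrite pi_id.
have iA : inv_cplx pi (S :|: arc m0 m1 a b) by apply: inv_setU => //; apply: inv_arc.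
apply: (heq_trans piact iS1 iA e1).
have -> : S1 :|: orb [set m0] :|: orb [set a; m0] = S2 :|: orb [set b; a].
  by rewrite /S1 /S2 (setUC [set b]) -!setUA; congr (_ :|: _); rewrite setUC -!setUA.
apply: (heq_trans piact _ iA e2); first by apply: inv_setU.
apply: (heq_trans piact iS3 iA e3).
have -> : S3 :|: orb [set m1] :|: orb [set m0; m1] = S4 :|: orb [set b; m0].
  by rewrite /S3 /S4 -!setUA; do 3!congr (_ :|: _); rewrite setUC -!setUA.
suff -> : S :|: arc m0 m1 a b = S4 :|: orb [set b; m1] by [].
rewrite /S4 /S2 /arc (setUC [set m1]) -!setUA; do 2!congr (_ :|: _).
by rewrite setUCA.
Qed.

Let S5 x := S :|: orb [set m0] :|: orb [set m1] :|: orb [set x; m0] :|: orb [set m0; m1].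

Let S5E x y : S :|: arc m0 m1 x y = S5 x :|: orb [set m1; y].
Proof. by rewrite /arc /S5 !setUA. Qed.

Let iS5 x : inv_cplx pi (S5 x).
Proof. by do !apply: inv_setU => //; apply: inv_orb. Qed.

Let SS5 x k : k \in S -> k \in S5 x. Proof. by move=> kS; rewrite !in_setU kS. Qed.

(** The inner edge keeps [m1] away from [x]. Therefore the slide is legitimate even if [y] or [z]
    equals [x], whereas a single midpoint would already be adjacent to that vertex. This is why an
    arc has two midpoints. *)
Lemma arc_slide1 x y z : [set x] \in S -> [set y] \in S -> [set z] \in S ->
  [set y; z] \in S -> y <> z ->
  heq (S :|: arc m0 m1 x y) (S :|: arc m0 m1 x z).
Proof.
move=> xS yS zS yzS yz; rewrite !S5E.
have i0 u : [set u] \in S -> indep m0 u by move=> /(fresh_indep piact iS f0)/indep_sym; apply.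
have i1 u : [set u] \in S -> indep m1 u by move=> /(fresh_indep piact iS f1)/indep_sym; apply.
have i0' u : [set u] \in S -> indep u m0 by apply: fresh_indep.
have i1' u : [set u] \in S -> indep u m1 by apply: fresh_indep.
apply: slide => //; try exact: SS5; try exact: i1.
  by rewrite !in_setU orb_refl ?orbT.
move=> k; rewrite !in_setU -!orbA => /or4P[kS|kO|kO|/orP[kO|kO]] bk.
- by have := f1 kS; rewrite bk.
- by have := notin_orb1 m01 kO; rewrite bk.
- by rewrite !(notin_orb1 _ kO) //; apply: i1.
- by have := notin_orb2 (i1' _ xS) m01 kO; rewrite bk.
- by rewrite !(notin_orb2 _ _ kO) //; auto.
Qed.

Definition adj (K : cplx) u v := [&& [set u] \in K, [set v] \in K, [set u; v] \in K & u != v].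

Lemma arc_slide x y z : [set x] \in S -> [set y] \in S -> connect (adj S) y z ->
  heq (S :|: arc m0 m1 x y) (S :|: arc m0 m1 x z).
Proof.
move=> xS yS /connectP[p]; elim: p y yS => [|w p IH] y yS /=.
  by move=> _ ->; apply: heq_refl => //; apply: inv_setU => //; apply: inv_arc.
case/andP=> /and4P[_ wS ywS /eqP yw] pp zl.
have iA u v : inv_cplx pi (S :|: arc m0 m1 u v) by apply: inv_setU => //; apply: inv_arc.
exact: (heq_trans piact (iA _ _) (iA _ _) (arc_slide1 xS yS wS ywS yw) (IH w wS pp zl)).
Qed.

(** The edge at [y] slides its other end from [m1] to [m0], and [m1] becomes a leaf. For this [y]
    must not be adjacent to [m0] yet, which is where [y <> x] enters. *)
Lemma arc_shorten x y : [set x] \in S -> [set y] \in S -> free_at y -> y <> x ->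
  heq (S :|: arc m0 m1 x y) (S :|: (orb [set m0] :|: orb [set x; m0] :|: orb [set m0; y])).
Proof.
move=> xS yS Fy yx; rewrite S5E.
have i0 u : [set u] \in S -> indep m0 u by move=> /(fresh_indep piact iS f0)/indep_sym; apply.
have i1 u : [set u] \in S -> indep m1 u by move=> /(fresh_indep piact iS f1)/indep_sym; apply.
have i0' u : [set u] \in S -> indep u m0 by apply: fresh_indep.
have i1' u : [set u] \in S -> indep u m1 by apply: fresh_indep.
have iO k : inv_cplx pi (orb k) by apply: inv_orb.
pose S6 := S :|: (orb [set m0] :|: orb [set x; m0] :|: orb [set m0; y]).
have iS6 : inv_cplx pi S6 by do !apply: inv_setU.
have e1 : heq (S5 x :|: orb [set y; m1]) (S5 x :|: orb [set y; m0]).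
  apply: slide => //; try exact: SS5; try (by auto); try by rewrite !in_setU orb_refl ?orbT.
  - by rewrite (setUC [set m1]) !in_setU orb_refl ?orbT.
  - move=> k; rewrite !in_setU -!orbA => /or4P[kS|kO|kO|/orP[kO|kO]] yk.
    + by rewrite f0 ?f1.
    + by have := notin_orb1 (i0 _ yS) kO; rewrite yk.
    + by have := notin_orb1 (i1 _ yS) kO; rewrite yk.
    + rewrite (notin_orb2 (i1' _ xS) m01 kO) /=.
      apply/negP => m0k; case/orbP: kO => mu e; move: yk m0k; rewrite e pi_set2 // !inE.
      move=> /orP[/eqP yx'|/eqP/esym/(i0 _ yS)//] /orP[/eqP/esym/(i0' _ xS)//|/eqP/esym/F0 m1E].
      by rewrite m1E pi_id // in yx'.
    + by have := notin_orb2 (i0 _ yS) (i1 _ yS) kO; rewrite yk.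
  - by move=> e; apply: (m10 (mu := 1%g)); rewrite pi_id.
have e2 : heq (S6 :|: orb [set m1] :|: orb [set m0; m1]) S6.
  apply: leaf_removal => //; first by rewrite !in_setU orb_refl ?orbT.
  move=> k; rewrite !in_setU -!orbA => /or4P[/f1//|kO|kO|kO].
  - exact: notin_orb1 kO.
  - by apply: notin_orb2 kO => //; apply: i1'.
  - by apply: notin_orb2 kO => //; apply: i1'.
rewrite (setUC [set m1]); apply: (heq_trans piact _ _ e1) => //; first by apply: inv_setU.
suff -> : S5 x :|: orb [set y; m0] = S6 :|: orb [set m1] :|: orb [set m0; m1] by [].
rewrite /S5 /S6 (setUC [set y]); apply/setP => k; rewrite !in_setU.
by case: (k \in S); case: (k \in orb [set m0]); case: (k \in orb [set m1]);
  case: (k \in orb [set m0; m1]); case: (k \in orb [set x; m0]); case: (k \in orb [set m0; y]).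
Qed.
End Arcs.

Section Mixture.
Variables (R : realType) (I : finType) (gT : finGroupType) (pi : gT -> I -> I).
Hypothesis piact : is_act pi.
Variables (E : finType) (T : {set {set I}}) (P Q : E -> {set {set I}}).
Hypotheses (iT : inv_cplx pi T) (iP : forall e, inv_cplx pi (P e)) (iQ : forall e, inv_cplx pi (Q e)).

Definition rest (D : {set E}) (e : E) : {set {set I}} :=
  T :|: \bigcup_(e' | e' != e) (if e' \in D then Q e' else P e').

Lemma inv_bigcup (A : pred E) (F : E -> {set {set I}}) :
  (forall e, inv_cplx pi (F e)) -> inv_cplx pi (\bigcup_(e | A e) F e).
Proof.
move=> iF mu k /bigcupP[e Ae ke]; apply/bigcupP; exists e => //; exact: iF.
Qed.

Lemma inv_mix (D : {set E}) (A : pred E) :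
  inv_cplx pi (T :|: \bigcup_(e | A e) (if e \in D then Q e else P e)).
Proof. by apply: inv_setU => //; apply: inv_bigcup => e; case: ifP. Qed.

(** The families are exchanged one by one; hence the single step is required among any mixture of
    old and new families, recorded by [D]. *)
Lemma mixture : (forall D e, heq R pi (rest D e :|: P e) (rest D e :|: Q e)) ->
  heq R pi (T :|: \bigcup_e P e) (T :|: \bigcup_e Q e).
Proof.
move=> step; pose mix (D : {set E}) := T :|: \bigcup_e (if e \in D then Q e else P e).
have -> : T :|: \bigcup_e P e = mix set0.
  by congr (_ :|: _); apply: eq_bigr => e _; rewrite inE.
have -> : T :|: \bigcup_e Q e = mix setT.
  by congr (_ :|: _); apply: eq_bigr => e _; rewrite inE.
have H m (D : {set E}) : #|D| = m -> heq R pi (mix set0) (mix D).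
  elim: m D => [|m IH] D.
    by move/cards0_eq->; apply: heq_refl => //; apply: inv_mix.
  move=> Dm; have [e eD] : exists e, e \in D by apply/set0Pn; rewrite -card_gt0 Dm.
  apply: (heq_trans piact (@inv_mix _ _) (@inv_mix _ _) (IH (D :\ e) _)).
    by apply/eqP; move: Dm; rewrite (cardsD1 e) eD add1n => -[->].
  have r1 : mix (D :\ e) = rest D e :|: P e.
    rewrite /mix /rest (bigD1 e) //= !inE eqxx /= [X in T :|: X]setUC setUA; congr (_ :|: _ :|: _).
    by apply: eq_bigr => e' ne; rewrite !inE ne.
  have r2 : mix D = rest D e :|: Q e.
    rewrite /mix /rest [in LHS](bigD1 e) //= [X in T :|: X = _]setUC setUA; congr (_ :|: _).
    by rewrite eD.
  by have := step D e; rewrite -r1 -r2.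
exact: (H #|[set: E]|).
Qed.
End Mixture.

Record rooted (V : finType) (e : rel V) (r : V) (par : V -> V) (dep : V -> nat) : Prop := Rooted {
  par_root : par r = r;
  dep_root : dep r = 0%N;
  dep_par : forall v, v != r -> dep v = (dep (par v)).+1;
  edge_par : forall u v, e u v = (u != r) && (par u == v) || (v != r) && (par v == u) }.

(** * Rooted trees *)

Section RootedTree.
Variables (V : finType) (e : rel V).
Hypothesis tree : is_tree e.

Let esym : symmetric e. Proof. by case: tree. Qed.
Let eirr : irreflexive e. Proof. by case: tree. Qed.
Let econ u v : connect e u v. Proof. by case: tree. Qed.

(** A detour, made simple, closes up with the edge itself to a cycle of length at least 3. *)
Lemma tree_no_detour u v : e u v ->
  ~~ connect [rel x y | e x y && ([set x; y] != [set u; v])] u v.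
Proof.
move=> euv; apply/negP => /connectP[p pp vl]; case/shortenP: pp vl => q qp uq _ vl.
have [_ _ _ acyc] := tree.
have epath x s : path.path [rel x y | e x y && ([set x; y] != [set u; v])] x s -> path.path e x s.
  by apply: sub_path => y z /andP[].
case: q qp uq vl => [|w q] qp uq vl; first by rewrite /= in vl; rewrite vl eirr in euv.
case: q qp uq vl => [|z q] qp uq vl.
  by move: qp; rewrite /= in vl *; rewrite -vl eqxx andbF.
have /negP := acyc (u :: w :: z :: q) uq isT; apply.
by rewrite /path.cycle rcons_path epath //= -[last _ _]/(last u (w :: z :: q)) -vl esym.
Qed.

Section Root.
Variable r : V.

Let reach v n := [exists p : n.-tuple V, path.path e v p && (last v p == r)].

Let ex_reach v : exists n, reach v n.
Proof.
have /connectP[p pp rl] := econ v r; exists (size p).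
by apply/existsP; exists (in_tuple p); rewrite pp /= -rl.
Qed.

Let dep v := ex_minn (ex_reach v).

Let depP v : exists p, [/\ path.path e v p, last v p = r & size p = dep v].
Proof.
rewrite /dep; case: ex_minnP => n /existsP[p /andP[pp /eqP pl]] _.
by exists p; rewrite size_tuple.
Qed.

Let dep_le v p : path.path e v p -> last v p = r -> (dep v <= size p)%N.
Proof.
move=> pp pl; rewrite /dep; case: ex_minnP => n _; apply.
by apply/existsP; exists (in_tuple p); rewrite pp pl /=.
Qed.

Let step v : v != r -> exists u, e v u && (dep v == (dep u).+1).
Proof.
move=> vr; have [[|u p] [pp pl ps]] := depP v; first by rewrite -pl eqxx in vr.
move: pp => /= /andP[evu pp]; exists u; rewrite evu /= eqn_leq -{2}ps /= ltnS dep_le // andbT.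
have [q [qp ql <-]] := depP u.
by apply: (@dep_le v (u :: q)); rewrite /= ?evu.
Qed.

Let par v := if v == r then r else odflt r [pick u | e v u && (dep v == (dep u).+1)].

Let parP v : v != r -> e v (par v) /\ dep v = (dep (par v)).+1.
Proof.
move=> vr; rewrite /par (negbTE vr); case: pickP => [u /andP[? /eqP//]|none].
by have [u] := step vr; rewrite none.
Qed.

Let e'  u v := [rel x y | e x y && ([set x; y] != [set u; v])].

Let to_root u v x : par u != v -> par v != u -> connect (e' u v) x r.
Proof.
move=> puv pvu; have [n] := ubnP (dep x); elim: n x => // n IH x xn.
have [->|xr] := eqVneq x r; first exact: connect0.
have [exp dx] := parP xr; apply: (connect_trans _ (IH (par x) _)); last by move: xn; rewrite dx ltnS.
apply: connect1; rewrite /= exp /=; apply/eqP => E.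
have xp : x != par x by apply: contraTN exp => /eqP <-; rewrite eirr.
have : x \in [set u; v] by rewrite -E !inE eqxx.
have : par x \in [set u; v] by rewrite -E !inE eqxx orbT.
rewrite !inE => /orP[] /eqP h /orP[] /eqP h'.
- by rewrite h h' eqxx in xp.
- by rewrite -h' h eqxx in pvu.
- by rewrite -h' h eqxx in puv.
- by rewrite h h' eqxx in xp.
Qed.

(** [dep] is the distance to the root, [par] a chosen neighbour that is closer by one. If an edge
    did not join a vertex to its parent, both ends would reach the root along parents without using
    it, against [tree_no_detour]. *)
Lemma rooted_tree : exists par dep, rooted e r par dep.
Proof.
exists par, dep; split.
- by rewrite /par eqxx.
- by apply/eqP; rewrite -leqn0; apply: (@dep_le r [::]).
- by move=> v /parP[].
- move=> u v; apply/idP/idP; last first.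
    by case/orP=> /andP[/parP[h _] /eqP <-] //; rewrite esym.
  move=> euv; have r1 x : par x != r -> x != r by apply: contraNN => /eqP->; rewrite /par eqxx.
  apply: contraT; rewrite negb_or !negb_and !negbK => nuv.
  have uv : u != v by apply: contraTN euv => /eqP->; rewrite eirr.
  have puv : par u != v.
    apply/eqP => h; move: nuv; rewrite h eqxx orbF => /andP[/eqP ur _].
    by case/negP: uv; rewrite -h ur /par eqxx.
  have pvu : par v != u.
    apply/eqP => h; move: nuv; rewrite h eqxx orbF => /andP[_ /eqP vr].
    by case/negP: uv; rewrite -h vr /par eqxx.
  have /negP := tree_no_detour euv; case.
  have cs : connect_sym (e' u v).
    by apply: sym_connect_sym => x y /=; rewrite esym [[set x; y]]setUC.
  apply: connect_trans (to_root u puv pvu) _; rewrite cs; exact: to_root.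
Qed.
End Root.
End RootedTree.

Section RootedFacts.
Variables (V : finType) (e : rel V) (r : V) (par : V -> V) (dep : V -> nat).
Hypothesis rt : rooted e r par dep.

Definition children p := [set v | (v != r) && (par v == p)].

Lemma par_neq v : v != r -> par v != v.
Proof. by move=> /(dep_par rt) h; apply/eqP => e'; rewrite e' in h; move: h; lia. Qed.

Lemma deg_children p : deg e p = (#|children p| + (p != r))%N.
Proof.
rewrite /deg; have -> : [set u | e p u] = children p :|: (if p == r then set0 else [set par p]).
  apply/setP => u; rewrite !inE (edge_par rt) orbC; congr (_ || _).
  by case: eqVneq => _ /=; rewrite inE // eq_sym.
rewrite cardsU; case: eqVneq => pr /=; first by rewrite setI0 !cards0; lia.
rewrite cards1 (_ : _ :&: _ = set0) ?cards0 ?subn0 //.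
apply/setP => u; rewrite !inE; apply/negbTE/negP => /andP[/andP[ur /eqP up] /eqP pu].
by have := dep_par rt ur; have := dep_par rt pr; rewrite up pu; lia.
Qed.
End RootedFacts.

(** A vertex farthest from an essential vertex is a leaf. The tree is then rooted anew at this
    leaf. *)
Lemma leaf_rooted (V : finType) (e : rel V) : is_tree e -> (exists v, essential e v) ->
  exists r par dep, rooted e r par dep /\ deg e r = 1%N.
Proof.
move=> tree [v0 v0e]; have [par [dep rt]] := rooted_tree tree v0.
case: (@arg_maxnP V v0 predT dep isT) => l _ lmax.
have l0 : l != v0.
  apply/eqP => lv0; move: v0e; rewrite /essential (deg_children rt) eqxx /= addn0 => h.
  have /card_gt0P[u] : (0 < #|children v0 par v0|)%N by lia.
  rewrite inE => /andP[uv /eqP pu]; have := lmax u isT; rewrite lv0 /= (dep_root rt) (dep_par rt uv); lia.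
have dl : deg e l = 1%N.
  rewrite (deg_children rt) l0 (_ : children _ _ _ = set0) ?cards0 //.
  apply/setP => u; rewrite !inE; apply/negbTE/negP => /andP[ur /eqP ul].
  by have := lmax u isT; rewrite /= (dep_par rt ur) ul; lia.
by have [p [d h]] := rooted_tree tree l; exists l, p, d.
Qed.

(** * The discrete flow on the configuration space *)

Section Matching.
Variables (V : finType) (e : rel V) (r : V) (par : V -> V) (dep : V -> nat).
Hypothesis rt : rooted e r par dep.
Variable n : nat.

(* [(v, false)] is the vertex [v], [(v, true)] the edge from [v] to its parent. *)
Local Notation tok := (V * bool)%type.
Local Notation cell := {ffun 'I_n -> V * bool}.
Implicit Types (c s t : cell) (p q : 'I_n) (x y : tok).

(** An arbitrary numbering. It decides between siblings and selects one candidate; the labels that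
    it influences are normalized in the end. *)
Definition ord (v : V) : nat := enum_rank v.
Definition verts x : {set V} := if x.2 then [set x.1; par x.1] else [set x.1].

Definition valid c :=
  [forall p, (c p).2 ==> ((c p).1 != r)] &&
  [forall p, forall q, (p != q) ==> [disjoint verts (c p) & verts (c q)]].

Definition upd c p x : cell := [ffun q => if q == p then x else c q].
Definition tog c p := upd c p ((c p).1, ~~ (c p).2).

(* The gradient field of Farley and Sabalka: an unblocked point may move to its parent, and
   an edge respects the order if no smaller sibling waits at its end. The least candidate
   is toggled; the cells without candidates are critical. *)
Definition unbl c p :=
  [&& ~~ (c p).2, (c p).1 != r & [forall q, (q != p) ==> (par (c p).1 \notin verts (c q))]].
Definition smaller_sib c p q :=
  [&& ~~ (c q).2, (c q).1 != r, par (c q).1 == par (c p).1 & (ord (c q).1 < ord (c p).1)%N].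
Definition resp c p := (c p).2 && [forall q, ~~ smaller_sib c p q].
Definition cand c p := unbl c p || resp c p.
Definition active c p := cand c p && [forall q, cand c q ==> (ord (c p).1 <= ord (c q).1)%N].
Definition redundant c p := active c p && ~~ (c p).2.
Definition collapsible c p := active c p && (c p).2.

Lemma ord_inj : injective ord.
Proof. by move=> u v /ord_inj/enum_rank_inj. Qed.

Lemma cl_self x : x.1 \in verts x.
Proof. by rewrite /verts; case: ifP => _; rewrite !inE eqxx. Qed.

Lemma valid_root c p : valid c -> (c p).2 -> (c p).1 != r.
Proof. by move=> /andP[/forallP/(_ p)/implyP]. Qed.

Lemma valid_disj c p q v : valid c -> p != q -> v \in verts (c p) -> v \notin verts (c q).
Proof.
move=> /andP[_ /forallP/(_ p)/forallP/(_ q)/implyP h] pq vp.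
by rewrite (disjointFr (h pq) vp).
Qed.

Lemma validI c : (forall p, (c p).2 -> (c p).1 != r) ->
  (forall p q v, p != q -> v \in verts (c p) -> v \notin verts (c q)) -> valid c.
Proof.
move=> h1 h2; apply/andP; split; first by apply/forallP => p; apply/implyP/h1.
apply/forallP => p; apply/forallP => q; apply/implyP => pq.
by rewrite disjoint_subset; apply/subsetP => v vp; rewrite inE (h2 p q).
Qed.

Lemma valid_inj c p q : valid c -> (c p).1 = (c q).1 -> p = q.
Proof.
move=> vc pq; apply/eqP; apply: contraT => npq.
by have := valid_disj vc npq (cl_self _); rewrite pq cl_self.
Qed.

Lemma upd_eq c p x : upd c p x p = x. Proof. by rewrite ffunE eqxx. Qed.
Lemma upd_neq c p x q : q != p -> upd c p x q = c q.
Proof. by rewrite ffunE => /negbTE->. Qed.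

Lemma togK c p : tog (tog c p) p = c.
Proof.
apply/ffunP => q; rewrite /tog !ffunE eqxx /= negbK.
by case: eqVneq => // ->; case: (c p).
Qed.

Lemma mc_uniq c p q : valid c -> active c p -> active c q -> p = q.
Proof.
move=> vc /andP[cp /forallP mp] /andP[cq /forallP mq]; apply: (valid_inj vc).
apply: ord_inj; apply/eqP; rewrite eqn_leq.
by rewrite (implyP (mp q)) ?(implyP (mq p)).
Qed.

Lemma unblP c p : reflect [/\ (c p).2 = false, (c p).1 != r &
  forall q, q != p -> par (c p).1 \notin verts (c q)] (unbl c p).
Proof.
apply: (iffP and3P) => [[/negbTE h1 h2 /forallP h3]|[h1 h2 h3]]; split=> //.
- by move=> q; apply: implyP.
- by rewrite h1.
- by apply/forallP => q; apply/implyP/h3.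
Qed.

Lemma respP c p : reflect ((c p).2 /\ forall q, ~~ smaller_sib c p q) (resp c p).
Proof. by apply: (iffP andP) => [[h /forallP]|[h /forallP]]. Qed.

Lemma mcI c p : cand c p -> (forall q, cand c q -> (ord (c p).1 <= ord (c q).1)%N) -> active c p.
Proof. by move=> cp h; rewrite /active cp; apply/forallP => q; apply/implyP/h. Qed.

Lemma mc_min c p q : active c p -> cand c q -> (ord (c p).1 <= ord (c q).1)%N.
Proof. by move=> /andP[_ /forallP/(_ q)/implyP]. Qed.

Lemma mc_ex c p : cand c p -> exists q, active c q.
Proof.
move=> cp; case: (@arg_minnP _ p (cand c) (fun q => ord (c q).1) cp) => q cq qm.
by exists q; apply: mcI.
Qed.

Lemma red_unbl c p : redundant c p -> unbl c p.
Proof. by move=> /andP[/andP[/orP[//|/andP[->]]]]. Qed.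

Lemma col_resp c p : collapsible c p -> resp c p.
Proof. by move=> /andP[/andP[/orP[/andP[/negbTE->]|]]]. Qed.

(** Letting the active point move creates no new candidates. A smaller sibling waiting for the same
    vertex would have been unblocked already, and would have been preferred. *)
Lemma red_up c p : valid c -> redundant c p -> valid (tog c p) /\ collapsible (tog c p) p.
Proof.
move=> vc rp; have /andP[mp _] := rp; have /unblP[cp2 vr unb] := red_unbl rp.
have tp : tog c p p = ((c p).1, true) by rewrite /tog upd_eq cp2.
have tq q : q != p -> tog c p q = c q by apply: upd_neq.
have clp : verts (tog c p p) = [set (c p).1; par (c p).1] by rewrite tp.
have pn : par (c p).1 != (c p).1 by apply: par_neq rt _ _.
have sep q v : q != p -> v \in verts (tog c p p) -> v \notin verts (c q).
  move=> qp; rewrite clp !inE => /orP[/eqP->|/eqP->]; last exact: unb.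
  by apply: (valid_disj vc (p := p)); rewrite ?cl_self // eq_sym.
split.
  apply: validI => [q|q q' v].
    by have [->|qp] := eqVneq q p; [rewrite tp|rewrite tq //; apply: valid_root].
  have [->|qp] := eqVneq q p; have [->|qp'] := eqVneq q' p; rewrite ?eqxx // => qq' vq.
  - by rewrite tq //; apply: sep.
  - by rewrite tq // in vq; apply: contraL vq; apply: sep.
  - by rewrite !tq // in vq *; apply: valid_disj vq.
have cq_up q : q != p -> cand (tog c p) q -> cand c q.
  move=> qp; case/orP=> [/unblP[]|/respP[]]; rewrite tq // => q2.
    move=> qr h; apply/orP; left; apply/unblP; split=> // s sq.
    have [->|sp] := eqVneq s p; last by rewrite -(tq s) // h.
    have : par (c q).1 \notin verts (tog c p p) by apply: h; rewrite eq_sym.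
    by rewrite clp /verts cp2 !inE negb_or => /andP[].
  move=> h; apply/orP; right; apply/respP; split=> // s.
  have [->|sp] := eqVneq s p; last by have := h s; rewrite /smaller_sib !tq.
  apply/negP => /and4P[_ _ /eqP pp _]; have := unb _ qp.
  by rewrite /verts q2 !inE pp eqxx orbT.
rewrite /collapsible tp andbT; apply: mcI => [|q cq]; last first.
  rewrite tp /=; have [->|qp] := eqVneq q p; first by rewrite tp.
  by rewrite tq //; apply: (mc_min mp); apply: cq_up.
apply/orP; right; apply/respP; rewrite tp; split=> // q.
apply/negP => /and4P[]; rewrite tp /=.
have [->|qp] := eqVneq q p; first by rewrite tp.
rewrite tq // => q2 qr /eqP pp lt; suff /(mc_min mp) : cand c q by rewrite leqNgt lt.
apply/orP; left; apply/unblP; split=> //; first exact/negbTE.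
move=> s sq; rewrite pp; have [->|sp] := eqVneq s p; last exact: unb.
by rewrite /verts cp2 inE.
Qed.

(** Moving back frees only the parent of [p]. A point unblocked by that is a sibling of [p], and not
    a smaller one because [p] respected the order. *)
Lemma col_down c p : valid c -> collapsible c p -> valid (tog c p) /\ redundant (tog c p) p.
Proof.
move=> vc rp; have /andP[mp cp2] := rp; have /respP[_ nosib] := col_resp rp.
have vr := valid_root vc cp2.
have tp : tog c p p = ((c p).1, false) by rewrite /tog upd_eq cp2.
have tq q : q != p -> tog c p q = c q by apply: upd_neq.
have clp : verts (tog c p p) = [set (c p).1] by rewrite tp.
have clc : verts (c p) = [set (c p).1; par (c p).1] by rewrite /verts cp2.
have sub q : verts (tog c p q) \subset verts (c q).
  have [->|qp] := eqVneq q p; last by rewrite tq.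
  by rewrite clp sub1set cl_self.
split.
  apply: validI => [q|q q' v qq' vq].
    by have [->|qp] := eqVneq q p; [rewrite tp|rewrite tq //; apply: valid_root].
  apply: contra (valid_disj vc qq' (subsetP (sub q) _ vq)).
  exact: (subsetP (sub q')).
rewrite /redundant tp andbT; apply: mcI => [|q].
  apply/orP; left; apply/unblP; rewrite tp; split=> // q qp.
  by rewrite tq //; apply: (valid_disj vc (p := p)); rewrite ?clc ?inE ?eqxx ?orbT // eq_sym.
rewrite tp /=; have [->|qp] := eqVneq q p; first by rewrite tp.
rewrite tq // => /orP[/unblP[]|/respP[]]; rewrite tq // => q2.
  move=> qr h; have [uq|nuq] := boolP (unbl c q); first by apply: (mc_min mp); rewrite /cand uq.
  have pp : par (c q).1 = par (c p).1.
    apply/eqP; apply: contraNT nuq => npp; apply/unblP; split=> // s sq.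
    have := h s sq; have [->|sp] := eqVneq s p; last by rewrite tq.
    by rewrite clp clc !inE (negbTE npp) orbF.
  rewrite leqNgt; apply/negP => lt; have := nosib q.
  by rewrite /smaller_sib q2 qr pp eqxx lt.
move=> h; apply: (mc_min mp); apply/orP; right; apply/respP; split=> // s.
have [->|sp] := eqVneq s p; last by have := h s; rewrite /smaller_sib !tq.
by rewrite /smaller_sib cp2.
Qed.

Definition dimc c := (\sum_q (c q).2)%N.
Definition height c := (\sum_q dep (c q).1)%N.
Definition esum c := (\sum_q (c q).2 * ord (c q).1)%N.
(** The lexicographic order of dimension, height and [esum], written as one number by means of
    [height_le] and [esum_le]. *)
Definition mrank c :=
  ((dimc c * (n * \max_v dep v).+1 + height c) * (n * #|V|).+1 + esum c)%N.

Lemma sum_upd (f : tok -> nat) c p x :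
  (\sum_q f (upd c p x q) + f (c p) = \sum_q f (c q) + f x)%N.
Proof.
rewrite (bigD1 p) //= upd_eq [in RHS](bigD1 p) //=.
rewrite (eq_bigr (fun q => f (c q))); last by move=> q qp; rewrite upd_neq.
by move: (\sum_(i | i != p) f (c i))%N => S; lia.
Qed.

Lemma height_le c : (height c <= n * \max_v dep v)%N.
Proof.
rewrite /height -[X in (_ <= X * _)%N]card_ord -sum_nat_const.
by apply: leq_sum => q _; apply: leq_bigmax.
Qed.

Lemma esum_le c : (esum c <= n * #|V|)%N.
Proof.
rewrite /esum -[X in (_ <= X * _)%N]card_ord -sum_nat_const.
apply: leq_sum => q _; case: (c q).2; rewrite ?mul0n // mul1n; exact/ltnW/ltn_ord.
Qed.

Lemma rank_lt_dim s t : (dimc s < dimc t)%N -> (mrank s < mrank t)%N.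
Proof. move=> h; rewrite /mrank; have := height_le s; have := esum_le s; nia. Qed.

Lemma rank_lt_height s t : dimc s = dimc t -> (height s < height t)%N -> (mrank s < mrank t)%N.
Proof. move=> h h'; rewrite /mrank h; have := esum_le s; nia. Qed.

Lemma rank_lt_esum s t : dimc s = dimc t -> height s = height t ->
  (esum s < esum t)%N -> (mrank s < mrank t)%N.
Proof. move=> h h' h''; rewrite /mrank h h'; nia. Qed.

Lemma dimc_upd c p x : (dimc (upd c p x) + (c p).2 = dimc c + x.2)%N.
Proof. exact: (sum_upd (fun x => nat_of_bool x.2)). Qed.

Lemma height_upd c p x : (height (upd c p x) + dep (c p).1 = height c + dep x.1)%N.
Proof. exact: (sum_upd (fun x => dep x.1)). Qed.

Lemma esum_upd c p x :
  (esum (upd c p x) + (c p).2 * ord (c p).1 = esum c + x.2 * ord x.1)%N.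
Proof. exact: (sum_upd (fun x => x.2 * ord x.1)%N). Qed.

Lemma dimc_tog c p : ~~ (c p).2 -> dimc (tog c p) = (dimc c).+1.
Proof.
move=> /negbTE cp; have := dimc_upd c p ((c p).1, ~~ (c p).2).
by rewrite -/(tog c p) cp /= addn0 addn1.
Qed.

Lemma height_tog c p : height (tog c p) = height c.
Proof. by apply/eqP; rewrite -(eqn_add2r (dep (c p).1)) height_upd. Qed.

(* Descending from a collapsible cell [t] to a facet that is matched upwards strictly
   decreases [mrank]: this is the acyclicity of the matching. *)
Lemma matching_acyclic t q (y : V) p p' : valid t -> collapsible t p' -> (t q).2 ->
  y = (t q).1 \/ y = par (t q).1 -> redundant (upd t q (y, false)) p ->
  tog (upd t q (y, false)) p != t -> (mrank (tog (upd t q (y, false)) p) < mrank t)%N.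
Proof.
set s := upd t q (y, false) => vt ct tq2 yE rs nst.
have tqr := valid_root vt tq2.
have /andP[_ sp2] := rs.
have dims : dimc (tog s p) = dimc t.
  rewrite dimc_tog //; have := dimc_upd t q (y, false).
  by rewrite -/s tq2 /= addn0 addn1.
(* At the upper end of its edge the point is closer to the root, so the height drops. *)
case: yE => yE; last first.
  apply: rank_lt_height => //; rewrite height_tog.
  have := height_upd t q (y, false); have := dep_par rt tqr.
  by rewrite -/s /= yE; lia.
have sE : s = tog t q by rewrite /s /tog tq2 yE.
have [qp'|qp'] := eqVneq q p'.
  have [vs rs'] : valid s /\ redundant s p' by rewrite sE qp'; apply: col_down.
  have pp' : p = p' by move: rs rs' => /andP[m _] /andP[m' _]; apply: (mc_uniq vs).
  by move: nst; rewrite pp' sE qp' togK eqxx.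
have sp' : s p' = t p' by rewrite /s upd_neq // eq_sym.
have /andP[mt tp2] := ct; have /respP[_ nosib] := col_resp ct.
have pp' : p != p' by apply: contraNneq sp2 => ->; rewrite sp'.
have subc k : verts (s k) \subset verts (t k).
  have [->|kq] := eqVneq k q; last by rewrite /s upd_neq.
  by rewrite /s upd_eq /verts /= sub1set yE cl_self.
have vs : valid s.
  apply: validI => [k|k k' v kk' vk].
    have [->|kq] := eqVneq k q; first by rewrite /s upd_eq.
    by rewrite /s upd_neq //; apply: valid_root.
  apply: contra (valid_disj vt kk' (subsetP (subc k) _ vk)); exact: (subsetP (subc k')).
have [pq|pq] := eqVneq p q.
  have [_ ct'] : valid (tog s p) /\ collapsible (tog s p) p by apply: red_up.
  move: ct'; rewrite pq sE togK => /andP[mt' _].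
  by rewrite (mc_uniq vt mt mt') eqxx in qp'.
have spt : s p = t p by rewrite /s upd_neq.
have sqE : s q = ((t q).1, false) by rewrite /s upd_eq yE.
have /unblP[_ upr unb] := red_unbl rs; rewrite spt in upr unb sp2.
have disj_par : par (t q).1 = par (t p').1 -> False.
  move=> pp; have : par (t q).1 \in verts (t q) by rewrite /verts tq2 !inE eqxx orbT.
  by move/(valid_disj vt qp')/negP; apply; rewrite /verts tp2 !inE pp eqxx orbT.
(* It was the retreat of [q] that unblocked [p]. Otherwise [p] and [p'] would be candidates both in
   [t] and in [s], the one least in [s] and the other least in [t]. *)
have parE : par (t p).1 = par (t q).1.
  apply/eqP; apply: contraT => npp.
  have ut : unbl t p.
    apply/unblP; split=> //; first exact/negbTE.
    move=> k kp; have := unb k kp; have [->|kq] := eqVneq k q; last by rewrite /s upd_neq.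
    rewrite sqE /verts tq2 /= !inE negb_or => -> /=; exact: npp.
  have l1 : (ord (t p').1 <= ord (t p).1)%N by apply: (mc_min mt); rewrite /cand ut.
  have rsp' : resp s p'.
    apply/respP; rewrite sp'; split=> // k; have [->|kq] := eqVneq k q.
      by apply/negP => /and4P[_ _ /eqP]; rewrite sqE sp' /= => /disj_par.
    by have := nosib k; rewrite /smaller_sib sp' /s upd_neq.
  have l2 : (ord (s p).1 <= ord (s p').1)%N.
    by move: rs => /andP[ms _]; apply: (mc_min ms); rewrite /cand rsp' orbT.
  move: l2; rewrite spt sp' => l2.
  have /ord_inj/(valid_inj vt) e1 : ord (t p).1 = ord (t p').1 by apply/eqP; rewrite eqn_leq l2 l1.
  by rewrite e1 eqxx in pp'.
have usq : unbl s q.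
  apply/unblP; rewrite sqE; split=> // k kq; rewrite -parE.
  have [->|kp] := eqVneq k p; last exact: unb.
  by rewrite spt /verts (negbTE sp2) inE; apply: (par_neq rt).
have l : (ord (t p).1 <= ord (t q).1)%N.
  move: rs => /andP[ms _]; have : cand s q by rewrite /cand usq.
  by move/(mc_min ms); rewrite spt sqE.
have {}l : (ord (t p).1 < ord (t q).1)%N.
  rewrite ltn_neqAle l andbT; apply/eqP => /ord_inj/(valid_inj vt) e1.
  by rewrite e1 eqxx in pq.
(* Dimension and height are unchanged, but the moving point is now the smaller of the two
   siblings. *)
apply: rank_lt_esum => //.
  rewrite height_tog; have := height_upd t q (y, false).
  by rewrite -/s /= yE => /eqP; rewrite eqn_add2r => /eqP.
have e1 := esum_upd t q (y, false); have e2 := esum_upd s p ((s p).1, ~~ (s p).2).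
rewrite -/s tq2 /= mul0n mul1n addn0 in e1.
rewrite -/(tog s p) spt (negbTE sp2) /= mul0n mul1n addn0 in e2.
by rewrite e2 -e1 ltn_add2l.
Qed.
End Matching.

(** * Collapsing the matched pairs in order of decreasing rank *)

Section Filtration.
Variables (V : finType) (e : rel V) (r : V) (par : V -> V) (dep : V -> nat).
Hypothesis rt : rooted e r par dep.
Variable n : nat.
Local Notation cell := {ffun 'I_n -> V * bool}.
Local Notation cl := (verts par).
Local Notation valid := (valid r par).
Local Notation red := (redundant r par).
Local Notation col := (collapsible r par).
Local Notation mc := (active r par).
Local Notation cand := (cand r par).
Local Notation rank := (mrank dep).
Implicit Types (c s t : cell) (p q : 'I_n).

Hypothesis no_critical : forall c, valid c -> (1 < dimc c)%N -> exists p, mc c p.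

Lemma cl_subP (x y : V * bool) : (x.2 -> x.1 != r) -> (y.2 -> y.1 != r) ->
  cl x \subset cl y -> x = y \/ [/\ y.2, x.2 = false & x.1 = y.1 \/ x.1 = par y.1].
Proof.
case: x y => [u [|]] [w [|]] /= hx hy; rewrite /verts /=.
- have ur := hx isT; have wr := hy isT.
  rewrite subUset !sub1set !inE => /andP[/orP[/eqP->|/eqP uE] h2]; first by left.
  have du := dep_par rt ur; have dw := dep_par rt wr.
  case/orP: h2 => /eqP h2; first by move: du dw; rewrite h2 uE; lia.
  by move: du; rewrite h2 -uE; lia.
- have ur := hx isT; rewrite subUset !sub1set !inE => /andP[/eqP uw /eqP pw].
  by have := par_neq rt ur; rewrite pw uw eqxx.
- by rewrite sub1set !inE => /orP[/eqP->|/eqP->]; right; split=> //; [left|right].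
- by rewrite sub1set inE => /eqP->; left.
Qed.

Definition face s c := [forall p, cl (s p) \subset cl (c p)].

Lemma faceP s c : reflect (forall p, cl (s p) \subset cl (c p)) (face s c).
Proof. exact: forallP. Qed.

Lemma face_refl s : face s s. Proof. by apply/faceP. Qed.

Lemma face_trans s t c : face s t -> face t c -> face s c.
Proof. by move=> /faceP h /faceP h'; apply/faceP => p; apply: subset_trans (h p) (h' p). Qed.

Lemma face_valid s c : (forall p, (s p).2 -> (s p).1 != r) -> face s c -> valid c -> valid s.
Proof.
move=> h0 /faceP h vc; apply: validI => // p q v pq vp.
apply: contra (valid_disj vc pq (subsetP (h p) _ vp)); exact: (subsetP (h q)).
Qed.

Lemma face_at s c p : valid s -> valid c -> face s c ->
  s p = c p \/ [/\ (c p).2, (s p).2 = false & (s p).1 = (c p).1 \/ (s p).1 = par (c p).1].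
Proof. by move=> vs vc /faceP h; apply: cl_subP => //; [exact: valid_root vs|exact: valid_root vc]. Qed.

Lemma face_dim s c : valid s -> valid c -> face s c -> s = c \/ (dimc s < dimc c)%N.
Proof.
move=> vs vc sc; have lec p : ((s p).2 <= (c p).2)%N.
  by case: (face_at p vs vc sc) => [->//|[-> ->]].
have [/eqP|] := boolP (s == c); first by left.
move=> nsc; right; have [p sp] : exists p, s p != c p.
  by apply/existsP; apply: contraNT nsc => /existsPn h; apply/eqP/ffunP => p; apply/eqP; have := h p; rewrite negbK.
rewrite /dimc (bigD1 p) //= [X in (_ < X)%N](bigD1 p) //=.
have [cp2 sp2] : (c p).2 = true /\ (s p).2 = false.
  by case: (face_at p vs vc sc) => [sp'|[]//]; rewrite sp' eqxx in sp.
rewrite cp2 sp2.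
by rewrite add0n add1n ltnS; apply: leq_sum => q _.
Qed.

Lemma tog_le c p : (c p).2 -> face (tog c p) c.
Proof.
move=> cp; apply/faceP => q; rewrite /tog; have [->|qp] := eqVneq q p; last by rewrite upd_neq.
by rewrite upd_eq /verts /= cp sub1set !inE eqxx.
Qed.

(** Cells of dimension 0 are exempt: redundant vertices and the edges matched with them stay behind
    and form the flow lines. *)
Definition removed m s :=
  [&& valid s, (0 < dimc s)%N & [exists p, red s p && (m <= rank (tog s p))%N]].
Definition inK m c := valid c && [forall s, removed m s ==> ~~ face s c].

Lemma inKP m c : reflect (valid c /\ forall s, removed m s -> ~~ face s c) (inK m c).
Proof.
apply: (iffP andP) => [[vc /forallP h]|[vc h]]; split=> //.
  by move=> s; apply/implyP.
by apply/forallP => s; apply/implyP/h.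
Qed.

Lemma removedI m s p : valid s -> (0 < dimc s)%N -> red s p -> (m <= rank (tog s p))%N -> removed m s.
Proof. by move=> vs ds rs ms; rewrite /removed vs ds; apply/existsP; exists p; rewrite rs. Qed.

Lemma facet_of s c : valid s -> valid c -> face s c -> s != c ->
  exists q, [/\ (c q).2, (s q).2 = false & (s q).1 = (c q).1 \/ (s q).1 = par (c q).1].
Proof.
move=> vs vc sc nsc; have [q sq] : exists q, s q != c q.
  by apply/existsP; apply: contraNT nsc => /existsPn h; apply/eqP/ffunP => q; apply/eqP; have := h q; rewrite negbK.
by exists q; case: (face_at q vs vc sc) => // sq'; rewrite sq' eqxx in sq.
Qed.

(** Any other coface [c] yields a cofacet [t] of [s] inside [c] that is not the partner of [s]. Its
    dimension is at least two, so it is matched. If [t] is redundant, its partner has larger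
    dimension; if it is collapsible, acyclicity puts its rank above [m]. Either way [c] contains a
    cell that has been removed. *)
Lemma free_face m c s p : inK m.+1 c -> valid s -> red s p -> (0 < dimc s)%N ->
  rank (tog s p) = m -> face s c -> c = s \/ c = tog s p.
Proof.
move=> /inKP[vc cK] vs rs ds rm sc; have /andP[_ sp2] := rs.
have [/eqP|nc] := boolP (c == s); first by left.
have [/eqP|nct] := boolP (c == tog s p); first by right.
have [q [cq sq sE qt]] : exists q, [/\ (c q).2, (s q).2 = false,
    (s q).1 = (c q).1 \/ (s q).1 = par (c q).1 & upd s q (c q) != tog s p].
  apply: contrapT => nex.
  have all q : s q != c q -> upd s q (c q) = tog s p.
    move=> sq; apply/eqP; apply: contraT => nq; case: nex; exists q.
    by case: (face_at q vs vc sc) => [sq'|[]//]; rewrite sq' eqxx in sq.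
  have [q [cq sq sE]] : exists q, [/\ (c q).2, (s q).2 = false & (s q).1 = (c q).1 \/ (s q).1 = par (c q).1].
    by apply: facet_of => //; rewrite eq_sym.
  have only k : s k != c k -> k = p.
    move=> sk; apply/eqP; apply: contraT => kp; have := all k sk => /ffunP/(_ k).
    by rewrite upd_eq /tog upd_neq // => ck; rewrite ck eqxx in sk.
  have sqc : s q != c q by apply: contraTneq cq => <-; rewrite sq.
  have qp := only q sqc; case/negP: nct; apply/eqP; rewrite -(all q sqc).
  apply/ffunP => k; have [->|kq] := eqVneq k q; first by rewrite upd_eq.
  rewrite upd_neq //; apply/eqP; apply: contraT; rewrite eq_sym => /only kp.
  by rewrite kp qp eqxx in kq.
set t := upd s q (c q) in qt *.
have st : s = upd t q ((s q).1, false).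
  apply/ffunP => k; have [->|kq] := eqVneq k q; last by rewrite !upd_neq.
  by rewrite upd_eq -sq; case: (s q).
have tq : t q = c q by rewrite /t upd_eq.
have tc : face t c.
  apply/faceP => k; have [->|kq] := eqVneq k q; first by rewrite tq.
  by rewrite /t upd_neq //; apply/faceP.
have vt : valid t.
  apply: (face_valid _ tc vc) => k; have [->|kq] := eqVneq k q.
    by rewrite tq; apply: (valid_root vc).
  by rewrite /t upd_neq //; apply: (valid_root vs).
have dt : dimc t = (dimc s).+1.
  by have := dimc_upd s q (c q); rewrite -/t sq cq addn0 addn1.
have [p' mt] : exists p', mc t p' by apply: no_critical => //; rewrite dt ltnS.
have [tp|tp] := boolP (t p').2; last first.
  have rt' : red t p' by rewrite /redundant mt.
  have /cK/negP := @removedI m.+1 t p' vt (ltac:(by rewrite dt)) rt'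
    (ltac:(by rewrite -rm; apply: rank_lt_dim; rewrite !dimc_tog // dt ltnSn)).
  by case.
have ct : col t p' by rewrite /collapsible mt.
have [vs' rs'] := col_down vt ct.
have acy : (rank (tog s p) < rank t)%N.
  rewrite st; apply: (matching_acyclic rt vt ct); rewrite ?tq -?st // eq_sym; exact: qt.
have ds' : dimc (tog t p') = dimc s.
  have := @dimc_tog _ _ (tog t p') p'; rewrite togK dt => h; apply/esym/eq_add_S/h.
  by move: rs' => /andP[].
have /cK/negP := @removedI m.+1 (tog t p') p' vs' (ltac:(by rewrite ds')) rs' (ltac:(by rewrite togK -rm)).
by case; apply: face_trans (tog_le tp) tc.
Qed.

(** A removed proper face would have a partner of rank above [m]. Acyclicity for facets, and the
    dimension for smaller faces, exclude this. *)
Lemma inK_top m s p : valid s -> red s p -> (0 < dimc s)%N -> rank (tog s p) = m ->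
  inK m.+1 (tog s p).
Proof.
move=> vs rs ds rm; have [vt ct] := red_up rt vs rs; apply/inKP; split=> // s'.
move=> /and3P[vs' ds' /existsP[p' /andP[rs' mr]]]; apply/negP => s't.
have /andP[_ sp2'] := rs'; have /andP[_ tp2] := ct.
have [es'|ns'] := eqVneq s' (tog s p).
  have /andP[m1 /negP] := rs'; have /andP[m2 h2] := ct; rewrite es' in m1 *.
  by rewrite (mc_uniq vt m1 m2) h2.
have [q [tq sq sE]] := facet_of vs' vt s't ns'.
pose s1 := upd (tog s p) q ((s' q).1, false).
have s's1 : face s' s1.
  apply/faceP => k; have [->|kq] := eqVneq k q; last by rewrite /s1 upd_neq //; apply/faceP.
  by rewrite /s1 upd_eq -sq; case: (s' q).
have d1 : (dimc s1).+1 = dimc (tog s p).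
  by have := dimc_upd (tog s p) q ((s' q).1, false); rewrite -/s1 tq /= addn0 addn1.
have vs1 : valid s1.
  apply: (face_valid _ _ vt).
    move=> k; have [->|kq] := eqVneq k q; first by rewrite /s1 upd_eq.
    by rewrite /s1 upd_neq //; apply: (valid_root vt).
  apply/faceP => k; have [->|kq] := eqVneq k q; last by rewrite /s1 upd_neq.
  rewrite /s1 upd_eq /verts /= tq sub1set !inE; by case: sE => ->; rewrite eqxx ?orbT.
move: mr; apply/negP; rewrite -leqNgt.
case: (face_dim vs' vs1 s's1) => [e1|lt].
  have [->|ntog] := eqVneq (tog s' p') (tog s p); first by rewrite rm.
  rewrite -rm; apply: ltnW; move: rs' ntog; rewrite e1 => rs' ntog.
  exact: (matching_acyclic rt vt ct).
by rewrite -rm; apply/ltnW/rank_lt_dim; rewrite dimc_tog // -d1 ltnS.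
Qed.

Lemma face_uniq m c s s' p p' : inK m.+1 c ->
  valid s -> red s p -> (0 < dimc s)%N -> rank (tog s p) = m -> face s c ->
  valid s' -> red s' p' -> (0 < dimc s')%N -> rank (tog s' p') = m -> face s' c ->
  s = s' /\ p = p'.
Proof.
move=> cK vs rs ds rm sc vs' rs' ds' rm' sc'.
have fin : s = s' -> s = s' /\ p = p'.
  move=> ss'; split=> //; move: rs rs'; rewrite -ss' => /andP[m1 _] /andP[m2 _].
  exact: (mc_uniq vs m1 m2).
have contra t q q' : valid t -> red t q -> col t q' -> False.
  by move=> vt /andP[m1 h1] /andP[m2 h2]; rewrite (mc_uniq vt m1 m2) h2 in h1.
have [vt ct] := red_up rt vs rs; have [vt' ct'] := red_up rt vs' rs'.
case: (free_face cK vs rs ds rm sc) => e1; case: (free_face cK vs' rs' ds' rm' sc') => e2.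
- by apply: fin; rewrite -e1 -e2.
- by case: (contra s p p') => //; rewrite -e1 e2.
- by case: (contra s' p' p) => //; rewrite -e2 e1.
- have e3 : tog s p = tog s' p' by rewrite -e1 -e2.
  have pp : p = p'.
    by move: ct ct'; rewrite -e3 => /andP[m1 _] /andP[m2 _]; apply: (mc_uniq vt m1 m2).
  by apply: fin; rewrite -(togK s p) e3 pp togK.
Qed.

Definition cset c : {set 'I_n * V} := [set x | x.2 \in cl (c x.1)].

Lemma cset_sub s c : (cset s \subset cset c) = face s c.
Proof.
apply/subsetP/faceP => h.
  by move=> p; apply/subsetP => v vp; have := h (p, v); rewrite !inE; apply.
by move=> [p v]; rewrite !inE; apply: (subsetP (h p)).
Qed.

Definition cact (mu : 'S_n) c : cell := [ffun p => c (mu p)].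

Lemma cset_act (mu : 'S_n) c : cset (cact mu c) = px mu @: cset c.
Proof.
apply/setP => -[p v]; rewrite (mem_pi_imset (@px_act V n)) !inE /px /= ffunE invgK //.
Qed.

Lemma cactK (mu : 'S_n) c : cact mu^-1%g (cact mu c) = c.
Proof. by apply/ffunP => p; rewrite !ffunE permKV. Qed.

Lemma valid_act (mu : 'S_n) c : valid c -> valid (cact mu c).
Proof.
move=> vc; apply: validI => [p|p q v pq]; rewrite !ffunE; first exact: (valid_root vc).
by apply: (valid_disj vc (p := mu p)); rewrite (inj_eq perm_inj).
Qed.

Lemma unbl_act (mu : 'S_n) c p : unbl r par c (mu p) -> unbl r par (cact mu c) p.
Proof.
move=> /unblP[h1 h2 h3]; apply/unblP; rewrite ffunE; split=> // q qp.
by rewrite ffunE; apply: h3; rewrite (inj_eq perm_inj).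
Qed.

Lemma resp_act (mu : 'S_n) c p : resp r par c (mu p) -> resp r par (cact mu c) p.
Proof.
move=> /respP[h1 h2]; apply/respP; rewrite ffunE; split=> // q.
by have := h2 (mu q); rewrite /smaller_sib !ffunE.
Qed.

Lemma cand_act (mu : 'S_n) c p : cand (cact mu c) p = cand c (mu p).
Proof.
have H (nu : 'S_n) s q : cand s (nu q) -> cand (cact nu s) q.
  by case/orP=> [/unbl_act h|/resp_act h]; apply/orP; [left|right].
apply/idP/idP; last exact: H.
by move=> h; rewrite -(cactK mu c); apply: H; rewrite permK.
Qed.

Lemma mc_act (mu : 'S_n) c p : mc (cact mu c) p = mc c (mu p).
Proof.
rewrite /active cand_act ffunE; congr (_ && _).
apply/forallP/forallP => h q.
  by have := h (mu^-1%g q); rewrite cand_act ffunE permKV.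
by rewrite cand_act ffunE; apply: h.
Qed.

Lemma red_act (mu : 'S_n) c p : red (cact mu c) p = red c (mu p).
Proof. by rewrite /redundant mc_act ffunE. Qed.

Lemma dimc_act (mu : 'S_n) c : dimc (cact mu c) = dimc c.
Proof.
by rewrite /dimc [RHS](reindex_inj (@perm_inj _ mu)); apply: eq_bigr => p _; rewrite ffunE.
Qed.

Lemma rank_act (mu : 'S_n) c : rank (cact mu c) = rank c.
Proof.
rewrite /mrank dimc_act; congr (_ * _ + _)%N; first congr (_ + _)%N.
  by rewrite /height [RHS](reindex_inj (@perm_inj _ mu)); apply: eq_bigr => p _; rewrite ffunE.
by rewrite /esum [RHS](reindex_inj (@perm_inj _ mu)); apply: eq_bigr => p _; rewrite ffunE.
Qed.

Lemma tog_act (mu : 'S_n) c p : tog (cact mu c) p = cact mu (tog c (mu p)).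
Proof.
apply/ffunP => q; rewrite /tog !ffunE (inj_eq perm_inj).
by case: eqP.
Qed.

Lemma le_act (mu : 'S_n) s c : face s c -> face (cact mu s) (cact mu c).
Proof. by move=> /faceP h; apply/faceP => p; rewrite !ffunE. Qed.

Lemma inK_act m (mu : 'S_n) c : inK m c -> inK m (cact mu c).
Proof.
move=> /inKP[vc h]; apply/inKP; split; first exact: valid_act.
move=> s /and3P[vs ds /existsP[p /andP[rp mr]]]; apply/negP => sc.
have : removed m (cact mu^-1%g s).
  apply: (@removedI m _ (mu p)); rewrite ?valid_act ?dimc_act ?red_act ?tog_act ?rank_act ?permK //.
by move=> /h/negP; apply; rewrite -(cactK mu c); apply: le_act.
Qed.

Definition Kc m : {set {set 'I_n * V}} := [set cset c | c in [pred c | inK m c]].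

Lemma KcP m (k : {set 'I_n * V}) : reflect (exists2 c, inK m c & k = cset c) (k \in Kc m).
Proof. by apply: (iffP imsetP) => -[c h ->]; exists c. Qed.

Lemma Kc_inv m : inv_cplx (@px V n) (Kc m).
Proof.
move=> mu _ /KcP[c cK ->]; apply/KcP; exists (cact mu c); first exact: inK_act.
by rewrite cset_act.
Qed.

Lemma sub_cset c (k : {set 'I_n * V}) : valid c -> k \subset cset c ->
  (forall p, exists v, (p, v) \in k) -> exists2 s, valid s /\ face s c & k = cset s.
Proof.
move=> vc kc rows; pose row p := [set v | (p, v) \in k].
have rowc p : row p \subset cl (c p).
  by apply/subsetP => v; rewrite inE => /(subsetP kc); rewrite inE.
(* A row that is not the full closed token is a single vertex. Rows are nonempty, so the default [r]
   is never taken. *)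
pose s : cell := [ffun p => if row p == cl (c p) then c p else (odflt r [pick v in row p], false)].
have sE p : cl (s p) = row p.
  rewrite /s ffunE; case: eqP => [->//|nr].
  case: pickP => [v vr /=|none]; last first.
    by have [v vk] := rows p; have := none v; rewrite inE vk.
  rewrite /verts /=; apply/eqP; rewrite eqEsubset sub1set vr /=.
  apply/subsetP => w wr; rewrite inE; apply/eqP; apply: contrapT => wv; apply: nr.
  apply/eqP; rewrite eqEsubset rowc /=; have := subsetP (rowc p) _ wr; have := subsetP (rowc p) _ vr.
  rewrite /verts; case: ifP => _; rewrite ?inE.
    move=> /orP[/eqP h1|/eqP h1] /orP[/eqP h2|/eqP h2]; try (by case: wv; rewrite h1 h2).
      by rewrite subUset !sub1set; apply/andP; split; [rewrite -h1|rewrite -h2].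
    by rewrite subUset !sub1set; apply/andP; split; [rewrite -h2|rewrite -h1].
  by move=> /eqP h1 /eqP h2; case: wv; rewrite h1 h2.
have sc : face s c by apply/faceP => p; rewrite sE.
exists s.
  split=> //; apply: (face_valid _ sc vc) => p; rewrite /s ffunE; case: ifP => // _.
  exact: (valid_root vc).
apply/setP => -[p v]; by rewrite inE /= sE inE.
Qed.

Definition pairs m : {set {set 'I_n * V} * ('I_n * V * V)} :=
  [set (cset x.1, (x.2, (x.1 x.2).1, par (x.1 x.2).1)) |
    x in [pred x : cell * 'I_n | [&& valid x.1, red x.1 x.2, (0 < dimc x.1)%N &
      rank (tog x.1 x.2) == m]]].

Lemma pairsP m j : reflect (exists s p, [/\ valid s, red s p, (0 < dimc s)%N,
  rank (tog s p) = m & j = (cset s, (p, (s p).1, par (s p).1))]) (j \in pairs m).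
Proof.
apply: (iffP imsetP) => [[[s p] /and4P[h1 h2 h3 /eqP h4] ->]|[s [p [h1 h2 h3 h4 ->]]]].
  by exists s, p.
by exists (s, p) => //; apply/and4P; split=> //=; rewrite h4.
Qed.

Lemma cset_tog s p : red s p -> cset (tog s p) = (p, par (s p).1) |: cset s.
Proof.
move=> /andP[_ /negbTE sp2]; apply/setP => -[q v]; rewrite in_setU1 !inE /tog /= xpair_eqE.
have [->|qp] := eqVneq q p; last by rewrite upd_neq.
by rewrite upd_eq /verts /= sp2 /= !inE orbC.
Qed.

(** All pairs of the same rank are collapsed together. The rank is invariant under permutations, so
    each step is equivariant. *)
Theorem filtration_step (R : realType) m :
  ghe R (@actD R n #|V|) (@actD R n #|V|) (@cub R V n (Kc m.+1)) (@cub R V n (Kc m)).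
Proof.
have -> : Kc m = ccollapsed (Kc m.+1) (pairs m).
  apply/setP => k; apply/idP/idP => [/KcP[c /inKP[vc cK] ->]|].
    rewrite inE; apply/andP; split.
      apply/KcP; exists c => //; apply/inKP; split=> // s /and3P[vs ds /existsP[p /andP[rs mr]]].
      by apply: cK; apply: (@removedI m s p vs ds rs (ltnW mr)).
    apply/forall_inP => j /pairsP[s [p [vs rs ds rm ->]]] /=; rewrite cset_sub; apply: cK.
    by apply: (@removedI m s p vs ds rs); rewrite rm.
  rewrite inE => /andP[/KcP[c /inKP[vc cK] ->] /forall_inP h]; apply/KcP; exists c => //.
  apply/inKP; split=> // s /and3P[vs ds /existsP[p /andP[rs]]].
  rewrite leq_eqVlt => /orP[/eqP rm|mr]; last first.
    by apply: cK; apply: (@removedI _ s p).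
  rewrite -cset_sub; apply: (h (cset s, (p, (s p).1, par (s p).1))).
  by apply/pairsP; exists s, p.
apply: ccollapse_ghe.
- move=> _ p /KcP[c _ ->]; rewrite (_ : [set v | _] = cl (c p)).
    by rewrite /verts; case: ifP => _; rewrite ?cards2 ?cards1 //; case: (_ != _).
  by apply/setP => v; rewrite !inE.
- move=> _ k /KcP[c /inKP[vc cK] ->] kc rows.
  have [s [vs sc] ->] := sub_cset vc kc rows.
  apply/KcP; exists s => //; apply/inKP; split=> // t /cK; apply: contra => ts.
  exact: face_trans ts sc.
- move=> mu j /pairsP[s [p [vs rs ds rm ->]]]; apply/pairsP.
  exists (cact mu s), (mu^-1%g p); rewrite valid_act ?red_act ?dimc_act ?tog_act ?rank_act ?permKV //.
  split=> //; rewrite /pair_act /fp /fv /fw /= cset_act ffunE permKV //.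
- move=> j /pairsP[s [p [vs rs ds rm ->]]]; rewrite /fp /fv /fw /=; split.
  + by rewrite inE cl_self.
  + move: (rs) => /andP[_ /negbTE sp2]; rewrite inE /= /verts sp2 inE.
    by apply: (par_neq rt); case/unblP: (red_unbl rs).
  + rewrite -cset_tog //; apply/KcP; exists (tog s p) => //; exact: inK_top.
- move=> j k /pairsP[s [p [vs rs ds rm ->]]] /KcP[c cK ->]; rewrite /fp /fv /fw /= cset_sub => sc.
  by rewrite -cset_tog // cset_sub; case: (free_face cK vs rs ds rm sc) => ->; rewrite ?face_refl // -cset_sub cset_tog // subsetUr.
- move=> i j k /pairsP[s [p [vs rs ds rm ->]]] /pairsP[s' [p' [vs' rs' ds' rm' ->]]] /KcP[c cK ->] /=.
  rewrite !cset_sub => sc sc'.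
  by have [-> ->] := face_uniq cK vs rs ds rm sc vs' rs' ds' rm' sc'.
Qed.

Theorem filtration (R : realType) :
  exists M, (forall c, inK M c = valid c) /\
  ghe R (@actD R n #|V|) (@actD R n #|V|) (@cub R V n (Kc M)) (@cub R V n (Kc 0)).
Proof.
have inv m A (s : 'S_n) : @cub R V n (Kc m) A -> @cub R V n (Kc m) (actD A s).
  by apply: cub_act; apply: Kc_inv.
have H m : ghe R (@actD R n #|V|) (@actD R n #|V|) (@cub R V n (Kc m)) (@cub R V n (Kc 0)).
  elim: m => [|m IH]; last by apply: ghe_trans (filtration_step R m) IH; apply: inv.
  by apply: (@ghe_homeo _ _ _ _ _ _ _ _ id id) => //; try exact: inv; move=> x; apply: cvg_id.
(* No cell has this rank, hence nothing has been removed yet. *)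
exists (\max_(c : cell) rank c).+1; split=> // c.
apply/idP/idP => [/inKP[]//|vc]; apply/inKP; split=> // s /and3P[_ _ /existsP[p /andP[_]]].
by rewrite ltnNge; case/negP; apply: leq_bigmax.
Qed.

(** A cell of dimension at least two is itself redundant or has a redundant facet of positive
    dimension. What remains are all vertices and the 1-cells that are collapsible or critical. *)
Lemma inK0P c : reflect
  (valid c /\ ((dimc c = 0)%N \/ (dimc c = 1)%N /\ forall p, ~~ red c p)) (inK 0 c).
Proof.
apply: (iffP (inKP 0 c)) => -[vc h]; split=> //.
  have [d0|d0] := posnP (dimc c); [by left|right].
  have nred p : ~~ red c p.
    apply/negP => rp; have /h/negP := @removedI 0 c p vc d0 rp (leq0n _).
    by rewrite face_refl.
  split=> //; apply/eqP; rewrite eqn_leq d0 andbT leqNgt; apply/negP => d2.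
  have [p mp] := no_critical vc d2; have [cp|cp] := boolP (c p).2; last first.
    by case/negP: (nred p); rewrite /redundant mp cp.
  have cc : col c p by rewrite /collapsible mp cp.
  have [vt rt'] := col_down vc cc.
  have dt : (dimc (tog c p)).+1 = dimc c.
    by rewrite -{2}(togK c p) [RHS]dimc_tog //; case/andP: rt'.
  have /h/negP := @removedI 0 (tog c p) p vt (ltac:(by rewrite -ltnS dt)) rt' (leq0n _).
  by rewrite tog_le.
move=> s /and3P[vs ds /existsP[p /andP[rs _]]]; apply/negP => sc.
case: (face_dim vs vc sc) => [sE|lt]; last by by move: lt ds; case: h => [->|[-> _]] //; case: (dimc s).
case: h => [|[_ /(_ p)]]; first by rewrite -sE => s0; rewrite s0 in ds.
by rewrite -sE rs.
Qed.
End Filtration.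

Lemma ord3_third (p1 p2 q q' : 'I_3) : p1 != p2 -> q != p1 -> q != p2 -> q' != p1 -> q' != p2 -> q = q'.
Proof.
have := ltn_ord p1; have := ltn_ord p2; have := ltn_ord q; have := ltn_ord q'.
rewrite -!(inj_eq val_inj) /= => h1 h2 h3 h4 h5 h6 h7 h8 h9; apply: val_inj => /=; lia.
Qed.

(** * Three points *)

Section ThreePoints.
Variables (V : finType) (e : rel V) (r : V) (par : V -> V) (dep : V -> nat).
Hypothesis rt : rooted e r par dep.
Local Notation cell := {ffun 'I_3 -> V * bool}.
Local Notation cl := (verts par).
Local Notation valid := (valid r par).
Local Notation mc := (active r par).

Lemma no_critical3 (c : cell) : valid c -> (1 < dimc c)%N -> exists p, mc c p.
Proof.
move=> vc; have -> : dimc c = #|[set q | (c q).2]|.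
  rewrite /dimc -sum1_card [RHS]big_mkcond; apply: eq_bigr => q _.
  by rewrite inE; case: (c q).2.
move=> /card_gt1P[p1 [p2]]; rewrite !inE => -[c1 c2 p12].
apply: contrapT => nmc; have ncand q : ~~ cand r par c q.
  by apply/negP => /mc_ex.
have sib q : (c q).2 -> exists2 q', (c q').2 = false & par (c q').1 = par (c q).1.
  move=> cq; have : ~~ resp r par c q by apply: contra (ncand q); rewrite /cand => ->; rewrite orbT.
  rewrite /resp cq /= => /forallPn[q']; rewrite negbK => /and4P[/negbTE h _ /eqP h' _].
  by exists q'.
have [q1 f1 e1] := sib _ c1; have [q2 f2 e2] := sib _ c2.
have nq q p : (c q).2 = false -> (c p).2 -> q != p by move=> h h'; apply: contraTneq h' => <-; rewrite h.
have q12 : q1 = q2 by apply: (@ord3_third p1 p2) => //; apply: nq.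
have : par (c p1).1 \in cl (c p1) by rewrite /verts c1 !inE eqxx orbT.
by move/(valid_disj vc p12)/negP; apply; rewrite /verts c2 !inE -e1 q12 e2 eqxx orbT.
Qed.

Lemma cell_tok (k : {set V}) : is_cell e k -> exists x : V * bool, (x.2 -> x.1 != r) /\ cl x = k.
Proof.
case/orP => [/cards1P[v ->]|/existsP[u /existsP[v /andP[euv /eqP->]]]].
  by exists (v, false); split.
move: euv; rewrite (edge_par rt) => /orP[] /andP[h /eqP <-].
  by exists (u, true); split.
by exists (v, true); split=> //; rewrite /verts /= setUC.
Qed.

Lemma Dconf_cub (R : realType) M : (forall c : cell, inK r par dep M c = valid c) ->
  @Dconf V e R 3 = @cub R V 3 (Kc r par dep 3 M).
Proof.
move=> inM; apply/funext => A; apply/propext; split.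
  case=> c [cc cd cA].
  have vA p v : vcoord (row p A) v = ent A (p, v) by rewrite /vcoord /ent mxE.
  have A1 p : \sum_v ent A (p, v) = 1.
    by have [_ _ <-] := cA p; apply: eq_bigr => v _; rewrite vA.
  have [x xP] := boolp.choice (fun p => cell_tok (cc p)).
  pose t : cell := [ffun p => x p].
  have vt : valid t.
    apply: validI => [p|p q v pq]; rewrite !ffunE; first by case: (xP p).
    rewrite (xP p).2 (xP q).2 => vp; apply/negP => vq.
    by have /eqP/setP/(_ v) := cd p q pq; rewrite !inE vp vq.
  split=> //.
    by move=> [p v]; rewrite -vA; have [_ h _] := cA p.
  have [||s [vs _] ->] := @sub_cset V r par 3 t (csupp A) vt.
  - apply/subsetP => -[p v]; rewrite in_csupp inE /= ffunE (xP p).2; apply: contraR => vc.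
    by have [h _ _] := cA p; rewrite -vA h.
  - move=> p; apply: contrapT => nv; have := oner_neq0 R; rewrite -(A1 p) big1 ?eqxx // => v _.
    by apply/eqP/negPn/negP => v0; apply: nv; exists v; rewrite in_csupp.
  by apply/KcP; exists s; rewrite ?inM.
move=> [A0 A1 /KcP[c]]; rewrite inM => vc cA; exists (fun p => cl (c p)).
have vA p v : vcoord (row p A) v = ent A (p, v) by rewrite /vcoord /ent mxE.
split.
- move=> p; rewrite /is_cell /verts; case: ifP => c2; last by rewrite cards1.
  apply/orP; right; apply/existsP; exists (c p).1; apply/existsP; exists (par (c p).1).
  by rewrite eqxx andbT (edge_par rt) (valid_root vc c2) eqxx.
- move=> p q pq; apply/eqP/setP => v; rewrite !inE; apply/negbTE/negP => /andP[vp].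
  by apply/negP; apply: (valid_disj vc pq).
- move=> p; split.
  + move=> v vc'; rewrite vA; apply/eqP; apply: contraNT vc'.
    by rewrite -in_csupp cA inE.
  + by move=> v; rewrite vA.
  + by rewrite -(A1 p); apply: eq_bigr => v _; rewrite vA.
Qed.

Local Notation W := {ffun 'I_3 -> V}.

Definition wact (mu : 'S_3) (w : W) : W := [ffun p => w (mu p)].

Lemma wact_act : is_act wact.
Proof.
split=> [w|a b w]; apply/ffunP => p; rewrite !ffunE ?perm1 //.
by rewrite permM.
Qed.

Definition ends (c : cell) : {set W} := [set w : W | [forall p, w p \in cl (c p)]].
Definition Kg : {set {set W}} := [set ends c | c in [pred c | inK r par dep 0 c]].

Lemma in_ends (c : cell) (w : W) : reflect (forall p, w p \in cl (c p)) (w \in ends c).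
Proof. by rewrite inE; apply: forallP. Qed.

Lemma ends_act (mu : 'S_3) (c : cell) : ends (cact mu c) = wact mu @: ends c.
Proof.
apply/setP => w; rewrite (mem_pi_imset wact_act); apply/in_ends/in_ends => h p.
  by have := h (mu^-1%g p); rewrite !ffunE permKV.
by have := h (mu p); rewrite !ffunE permK.
Qed.

Lemma KgP k : reflect (exists2 c, inK r par dep 0 c & k = ends c) (k \in Kg).
Proof. by apply: (iffP imsetP) => -[c h ->]; exists c. Qed.

Lemma Kg_inv : inv_cplx wact Kg.
Proof.
move=> mu _ /KgP[c h ->]; apply/KgP; exists (cact mu c); last by rewrite ends_act.
exact: inK_act.
Qed.

Lemma dimc_le1 (c : cell) : (dimc c <= 1)%N -> exists p0, forall p, p != p0 -> (c p).2 = false.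
Proof.
move=> d1; have [/existsP[p0 c0]|/existsPn none] := boolP [exists p, (c p).2]; last first.
  by exists ord0 => p _; apply/negbTE.
exists p0 => p pp0; apply/negbTE/negP => cp; move: d1; rewrite /dimc.
by rewrite (bigD1 p0) //= c0 (bigD1 p) //= cp.
Qed.

(** In a cell of dimension at most one all rows but one are concentrated in a vertex. The products
    of row coordinates are then barycentric coordinates on the set of configurations, and the rows
    are recovered as marginals. *)
Theorem cub_graph (R : realType) :
  ghe R (@actD R 3 #|V|) (actI wact) (@cub R V 3 (Kc r par dep 3 0)) (@real R _ Kg).
Proof.
pose f (A : 'M[R]_(3, #|V|)) : 'rV[R]_#|W| := vec (fun w : W => \prod_p ent A (p, w p)).
pose g (y : 'rV[R]_#|W|) : 'M[R]_(3, #|V|) :=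
  mxof (fun x : 'I_3 * V => \sum_(w : W | w x.1 == x.2) co y w).
have sum_prod (A : 'M[R]_(3, #|V|)) (P : 'I_3 -> pred V) :
    \sum_(w : W | [forall p, P p (w p)]) \prod_p ent A (p, w p) = \prod_p \sum_(v | P p v) ent A (p, v).
  rewrite (bigA_distr_big_dep P (fun p v => ent A (p, v))); apply: eq_bigl => w.
  by apply/forallP/familyP.
have one_sum (A : 'M[R]_(3, #|V|)) : (forall p, \sum_v ent A (p, v) = 1) ->
    forall p v, \sum_(w : W | w p == v) \prod_q ent A (q, w q) = ent A (p, v).
  move=> A1 p v; pose P q u := (q == p) ==> (u == v).
  rewrite (eq_bigl (fun w : W => [forall q, P q (w q)])); last first.
    move=> w; apply/idP/forallP => [/eqP wv q|/(_ p)]; last by rewrite /P eqxx.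
    by apply/implyP => /eqP->; rewrite wv.
  rewrite sum_prod (bigD1 p) //= (big_pred1 v); last by move=> u; rewrite /P eqxx.
  rewrite big1 ?mulr1 // => q qp; rewrite -(A1 q); apply: eq_bigl => u.
  by rewrite /P (negbTE qp).
have fsupp (A : 'M[R]_(3, #|V|)) c : csupp A = cset par c -> supp (f A) = ends c.
  move=> cA; apply/setP => w; rewrite in_supp co_vec; apply/idP/in_ends.
    move=> /prodf_neq0 h p; have := h p isT; by rewrite -in_csupp cA inE.
  by move=> h; apply/prodf_neq0 => p _; rewrite -in_csupp cA inE h.
have fX A : cub (Kc r par dep 3 0) A -> real Kg (f A).
  move=> [A0 A1 /KcP[c cK cA]]; split.
  - by move=> w; rewrite co_vec; apply: prodr_ge0.
  - have := sum_prod A (fun _ _ => true); rewrite [X in _ = X -> _]big1 => [<-|p _]; last exact: A1.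
    by apply: eq_big => [w|w _]; [apply/esym/forallP|rewrite co_vec].
  - by rewrite (fsupp _ _ cA); apply/KgP; exists c.
have gf A : cub (Kc r par dep 3 0) A -> g (f A) = A.
  move=> [A0 A1 _]; apply: mxofP => -[p v]; rewrite ent_mxof /=.
  by rewrite -[RHS](one_sum A A1); apply: eq_bigr => w _; rewrite co_vec.
have gent y p v : ent (g y) (p, v) = \sum_(w : W | w p == v) co y w by rewrite ent_mxof.
have out (y : 'rV[R]_#|W|) c w : supp y = ends c -> w \notin ends c -> co y w = 0.
  by move=> <-; rewrite in_supp negbK => /eqP.
have dim1 (c : cell) : inK r par dep 0 c -> valid c /\ (dimc c <= 1)%N.
  by move=> cK; have [vc [->|[-> _]]] := elimT (inK0P rt no_critical3 c) cK.
have gY y : real Kg y -> cub (Kc r par dep 3 0) (g y).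
  move=> [y0 y1 /KgP[c cK yc]]; split.
  - by move=> [p v]; rewrite gent sumr_ge0.
  - move=> p; under eq_bigr do rewrite gent.
    by rewrite -y1 (partition_big (fun w : W => w p) predT).
  - apply/KcP; exists c => //; apply/setP => -[p v]; rewrite in_csupp gent inE /=.
    apply/idP/idP => [|vp].
      apply: contraR => vp; rewrite big1 // => w /eqP wv; apply: (out _ c) => //.
      by apply/negP => /in_ends/(_ p); rewrite wv (negbTE vp).
    rewrite psumr_neq0 //; pose w : W := [ffun q => if q == p then v else (c q).1].
    apply/hasP; exists w; first exact: mem_index_enum.
    rewrite ffunE !eqxx /= lt_def y0 andbT -in_supp yc; apply/in_ends => q.
    by rewrite ffunE; case: eqVneq => [->//|_]; rewrite cl_self.
have fg y : real Kg y -> f (g y) = y.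
  move=> [y0 y1 /KgP[c cK yc]]; have [vc d1] := dim1 c cK.
  have [p0 cp0] := dimc_le1 d1; apply: vecP => w; rewrite co_vec.
  have [wc|wc] := boolP (w \in ends c); last first.
    rewrite (out _ _ _ yc wc); move: wc; rewrite inE => /forallPn[p wp].
    apply/eqP/prodf_eq0; exists p => //; rewrite gent big1 // => w' /eqP w'p.
    by apply: (out _ c) => //; apply/negP => /in_ends/(_ p); rewrite w'p (negbTE wp).
  have eqp w1 w2 p : w1 \in ends c -> w2 \in ends c -> p != p0 -> w1 p = w2 p.
    move=> /in_ends/(_ p) h1 /in_ends/(_ p) h2 pp0; move: h1 h2.
    by rewrite /verts cp0 // !inE => /eqP-> /eqP->.
  rewrite (bigD1 p0) //= big1 ?mulr1 => [|p pp0].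
    rewrite gent (bigD1 w) //= big1 ?addr0 // => w' /andP[/eqP w'0 w'w]; apply: (out _ c) => //.
    apply: contra w'w => w'c; apply/eqP/ffunP => p.
    by have [->//|pp0] := eqVneq p p0; apply: eqp.
  rewrite gent -y1 big_mkcond; apply: eq_bigr => w' _; case: eqP => // nw.
  by apply/esym/(out _ c) => //; apply/negP => w'c; apply: nw; apply: eqp.
apply: (@ghe_homeo _ _ _ _ _ _ _ _ f g) => //.
- apply: continuous_vec => w; apply: continuous_bigprod => p _.
  by apply: continuous_ent => A; apply: cvg_id.
- apply: continuous_mxof => x; apply: continuous_bigsum => w _.
  by apply: continuous_co => y; apply: cvg_id.
- move=> A mu _; apply: vecP => w; rewrite (co_act wact) !co_vec.
  rewrite (reindex_inj (@perm_inj _ mu^-1%g)); apply: eq_bigr => p _.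
  by rewrite ent_actD /px /= !ffunE invgK permKV.
- by move=> y mu; apply: (real_act wact_act); apply: Kg_inv.
- by move=> A mu; apply: cub_act; apply: Kc_inv.
Qed.
End ThreePoints.

(** * From a graph with a free action to a rose *)

Section Rose.
Variables (R : realType) (gT : finGroupType) (W E : finType) (wact : gT -> W -> W).
Hypothesis actW : is_act wact.

(* Vertices [inl w] of the given graph, base vertices [inr (inl x)] of the rose, and two
   subdivision points [inr (inr (x, e, b))] on each petal of the rose. *)
Local Notation I := (W + (gT + gT * E * bool))%type.
Definition vt (w : W) : I := inl w.
Definition base (x : gT) : I := inr (inl x).
Definition mid (x : gT) (e : E) (b : bool) : I := inr (inr (x, e, b)).

Definition piI (mu : gT) (i : I) : I :=
  match i with
  | inl w => vt (wact mu w)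
  | inr (inl x) => base (mu * x)%g
  | inr (inr (x, e, b)) => mid (mu * x)%g e b
  end.

Lemma piI_act : is_act piI.
Proof.
split=> [[w|[x|[[x e] b]]]|mu nu [w|[x|[[x e] b]]]] /=; rewrite ?mul1g ?mulgA //.
  by rewrite (pi_id actW).
by rewrite (pi_comp actW).
Qed.

(** The forest is given by parents and a rank that decreases towards the roots. [rt] names the
    component of a vertex by a group element, and the group permutes the components simply
    transitively. The edges [a e], [b e] represent the remaining orbits, translated so that [a e]
    lies in the component 1. *)
Variables (A0 : {set W}) (par0 : W -> W) (root : pred W) (rk : W -> nat) (rt : W -> gT).
Variables (w1 : W) (a b : E -> W).
Hypotheses
  (hA : forall mu w, w \in A0 -> wact mu w \in A0)
  (hfree : forall mu w, w \in A0 -> wact mu w = w -> mu = 1%g)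
  (hroot : forall mu w, w \in A0 -> root (wact mu w) = root w)
  (hpar : forall w, w \in A0 -> ~~ root w ->
     [/\ par0 w \in A0, (rk (par0 w) < rk w)%N & rt (par0 w) = rt w])
  (hparE : forall mu w, w \in A0 -> ~~ root w -> par0 (wact mu w) = wact mu (par0 w))
  (hrk : forall mu w, w \in A0 -> rk (wact mu w) = rk w)
  (hrt : forall mu w, w \in A0 -> rt (wact mu w) = (mu * rt w)%g)
  (hru : forall w w', w \in A0 -> w' \in A0 -> root w -> root w' -> rt w = rt w' -> w = w')
  (hw1 : [/\ w1 \in A0, root w1 & rt w1 = 1%g])
  (ha : forall e, a e \in A0) (hb : forall e, b e \in A0)
  (hrta : forall e, rt (a e) = 1%g)
  (hab : forall e mu, wact mu (b e) <> a e)
  (hba_par : forall e, ~~ root (b e) -> par0 (b e) <> a e)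
  (hab_par : forall e, ~~ root (a e) -> par0 (a e) <> b e)
  (hdist : forall e e' mu, e' != e -> wact mu @: [set a e'; b e'] <> [set a e; b e]).

Definition tree_graph : {set {set W}} :=
  [set [set w] | w in A0] :|: [set [set w; par0 w] | w in [pred w in A0 | ~~ root w]]
  :|: \bigcup_e orb wact [set a e; b e].

(** The forest is prolonged by one edge below each root, ending in a base vertex. *)
Definition parI (w : W) : I := if root w then base (rt w) else vt (par0 w).

Definition Bs : {set {set I}} := [set [set base x] | x in [set: gT]].
Definition Tm (m : nat) : {set {set I}} :=
  [set [set vt w] | w in [pred w in A0 | (rk w < m)%N]] :|:
  [set [set vt w; parI w] | w in [pred w in A0 | (rk w < m)%N]] :|: Bs.

Lemma TmP m (k : {set I}) : k \in Tm m <->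
  (exists w, [/\ w \in A0, (rk w < m)%N & k = [set vt w] \/ k = [set vt w; parI w]])
  \/ exists x, k = [set base x].
Proof.
rewrite !in_setU; split.
  case/orP=> [/orP[]|] /imsetP[w]; last by move=> _ ->; right; exists w.
    by case/andP=> wA wm ->; left; exists w; split=> //; left.
  by case/andP=> wA wm ->; left; exists w; split=> //; right.
case=> [[w [wA wm [->|->]]]|[x ->]]; apply/orP; [left; apply/orP; left|left; apply/orP; right|right].
- by apply/imsetP; exists w => //; apply/andP.
- by apply/imsetP; exists w => //; apply/andP.
- by apply/imsetP; exists x; rewrite ?inE.
Qed.

Lemma parI_act mu w : w \in A0 -> parI (wact mu w) = piI mu (parI w).
Proof.
move=> wA; rewrite /parI hroot //; have [rw|nrw] := boolP (root w); first by rewrite hrt.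
by rewrite hparE.
Qed.

Lemma inv_Tm m : inv_cplx piI (Tm m).
Proof.
move=> mu k /TmP[[w [wA wm kE]]|[x ->]]; apply/TmP; last first.
  by right; exists (mu * x)%g; rewrite pi_set1.
left; exists (wact mu w); rewrite hA // hrk //; split=> //.
case: kE => ->; [left; rewrite pi_set1 //|right; rewrite pi_set2 // parI_act //].
Qed.

Definition petal (lab : E -> gT) (e : E) : {set {set I}} :=
  arc piI (mid 1%g e false) (mid 1%g e true) (base 1%g) (base (lab e)).
Definition chord (e : E) : {set {set I}} := orb piI [set vt (a e); vt (b e)].

Lemma inv_petal lab e : inv_cplx piI (petal lab e).
Proof. exact: (inv_arc piI_act). Qed.

Lemma inv_chord e : inv_cplx piI (chord e).
Proof. exact: (inv_orb piI_act). Qed.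

Lemma petal_novt lab e (k : {set I}) w : k \in petal lab e -> vt w \notin k.
Proof.
rewrite !in_setU -!orbA => /or4P[kO|kO|kO|/orP[kO|kO]];
  by [apply: (notin_orb1 _ kO)|apply: (notin_orb2 _ _ kO)].
Qed.

Lemma petal_nomid lab e e' (k : {set I}) x c : e != e' -> k \in petal lab e -> mid x e' c \notin k.
Proof.
move=> ee'; have ne y z d d' : indep piI (mid y e d) (mid z e' d').
  by move=> mu [_ e_eq _]; rewrite e_eq eqxx in ee'.
rewrite !in_setU -!orbA => /or4P[kO|kO|kO|/orP[kO|kO]];
  by [apply: (notin_orb1 _ kO)|apply: (notin_orb2 _ _ kO)].
Qed.

Lemma chord_nomid e (k : {set I}) x e' c : k \in chord e -> mid x e' c \notin k.
Proof. by move=> kO; apply: (notin_orb2 _ _ kO). Qed.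

Lemma Tm_nomid m (k : {set I}) x e c : k \in Tm m -> mid x e c \notin k.
Proof.
case/TmP=> [[w [_ _ [->|->]]]|[y ->]]; rewrite !inE //.
by rewrite /parI; case: ifP.
Qed.

Lemma free_mid x e c : free_at piI (mid x e c).
Proof. by move=> mu [] /eqP; rewrite eq_mulgV1 mulgK => /eqP. Qed.

Lemma free_base x : free_at piI (base x).
Proof. by move=> mu [] /eqP; rewrite eq_mulgV1 mulgK => /eqP. Qed.

Lemma free_vt w : w \in A0 -> free_at piI (vt w).
Proof. by move=> wA mu [] /hfree; apply. Qed.

Lemma indep_mid e : indep piI (mid 1%g e false) (mid 1%g e true).
Proof. by move=> mu []. Qed.

Lemma Tm_base m x : [set base x] \in Tm m.
Proof. by apply/TmP; right; exists x. Qed.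

Lemma connect_base (S : {set {set I}}) m w : Tm m \subset S -> w \in A0 -> (rk w < m)%N ->
  connect (adj S) (vt w) (base (rt w)).
Proof.
move=> /subsetP TS; have [n] := ubnP (rk w); elim: n w => // n IH w wn wA wm.
have wS : [set vt w] \in S by apply/TS/TmP; left; exists w; split=> //; left.
have eS : [set vt w; parI w] \in S by apply/TS/TmP; left; exists w; split=> //; right.
have [rw|nrw] := boolP (root w).
  apply: connect1; rewrite /adj wS TS ?Tm_base //=.
  by move: eS; rewrite /parI rw => ->.
have [pA prk prt] := hpar wA nrw; rewrite -prt.
apply: (connect_trans _ (IH (par0 w) _ pA _)).
- apply: connect1; rewrite /adj wS /=; move: eS; rewrite /parI (negbTE nrw) => ->.
  rewrite /= (_ : vt w != _) ?andbT; last first.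
    by apply/eqP => -[] h; rewrite -h ltnn in prk.
  by apply/TS/TmP; left; exists (par0 w); split=> //; [apply: ltn_trans prk wm|left].
- by apply: leq_trans prk _; rewrite -ltnS.
- exact: ltn_trans prk wm.
Qed.

Let M := (\max_w rk w).+1.
Let rkM w : (rk w < M)%N. Proof. by rewrite ltnS; apply: leq_bigmax. Qed.

(** The chord becomes an arc, whose ends slide down the forest to the bases of their components; so
    the petal inherits the component of [b e] as its label. *)
Lemma chord_to_petal (S : {set {set I}}) e : inv_cplx piI S -> Tm M \subset S ->
  fresh S (mid 1%g e false) -> fresh S (mid 1%g e true) ->
  (forall k, k \in S -> vt (a e) \in k -> vt (b e) \notin k) ->
  heq R piI (S :|: chord e) (S :|: petal (fun e => rt (b e)) e).
Proof.
move=> iS TS f0 f1 nab.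
have vS w : w \in A0 -> [set vt w] \in S.
  by move=> wA; apply: (subsetP TS); apply/TmP; left; exists w; split=> //; left.
have bS x : [set base x] \in S by apply: (subsetP TS); apply: Tm_base.
have m01 := @indep_mid e; have m10 := indep_sym piI_act m01.
have iA m0 m1 x y : inv_cplx piI (S :|: arc piI m0 m1 x y).
  by apply: inv_setU => //; apply: inv_arc; apply: piI_act.
have iC : inv_cplx piI (S :|: chord e) by apply: inv_setU => //; apply: inv_chord.
have e1 := edge_to_arc R piI_act iS f0 f1 (@free_mid _ _ _) (@free_mid _ _ _) m01
  (vS _ (ha e)) (vS _ (hb e)) nab (free_vt (hb e)).
have {}e1 := e1 (ltac:(by move=> mu [] /hab) : indep piI (vt (b e)) (vt (a e))).
have e2 := arc_slide R piI_act iS f0 f1 (@free_mid _ _ _) m01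
  (vS _ (ha e)) (vS _ (hb e)) (connect_base TS (hb e) (rkM _)).
have e3 := arc_slide R piI_act iS f1 f0 (@free_mid _ _ _) m10
  (bS (rt (b e))) (vS _ (ha e)) (connect_base TS (ha e) (rkM _)).
rewrite hrta in e3; apply: (heq_trans piI_act iC _ e1); first exact: iA.
apply: (heq_trans piI_act (iA _ _ _ _) _ e2); first exact: iA.
by rewrite /petal [X in heq _ _ _ (_ :|: X)]arcC // [X in heq _ _ (_ :|: X)]arcC.
Qed.

Lemma chords_to_petals :
  heq R piI (Tm M :|: \bigcup_e chord e) (Tm M :|: \bigcup_e petal (fun e => rt (b e)) e).
Proof.
apply: (mixture piI_act (@inv_Tm M) (@inv_chord) (@inv_petal _)) => D e.
set S := rest _ _ _ _ _.
have restP k : k \in S -> k \in Tm M \/ exists2 e', e' != e & k \in petal (fun e => rt (b e)) e' \/ k \in chord e'.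
  rewrite in_setU => /orP[->|/bigcupP[e' ne]]; first by left.
  by case: ifP => _ h; right; exists e' => //; [left|right].
have fr c : fresh S (mid 1%g e c).
  move=> k /restP[/Tm_nomid//|[e' ne [h|h]]]; first exact: petal_nomid h.
  exact: chord_nomid h.
apply: chord_to_petal; rewrite ?subsetUl //; first exact: (inv_mix (@inv_Tm M) (@inv_chord) (@inv_petal _)).
(* [a e] and [b e] are not joined by anything else: not by a forest edge, by [hab_par] and
   [hba_par], and not by another chord, by [hdist]. *)
move=> k /restP[/TmP[[w [wA _ [->|->]]]|[x ->]]|[e' ne [h|/orbP[mu ->]]]].
- rewrite !inE => /eqP[aw]; apply/eqP => -[bw]; apply: (@hab e 1%g).
  by rewrite (pi_id actW) aw bw.
- have anb : a e <> b e by move=> ab; apply: (@hab e 1%g); rewrite (pi_id actW).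
  rewrite /parI !inE; case: ifP => rw.
    rewrite orbF => /eqP[aw]; rewrite orbF; apply/eqP => -[bw]; apply: anb; by rewrite aw.
  move=> /orP[/eqP[aw]|/eqP[aw]]; apply/negP => /orP[/eqP[bw]|/eqP[bw]].
  + by apply: anb; rewrite aw.
  + by apply: (@hab_par e); rewrite ?aw ?rw.
  + by apply: (@hba_par e); rewrite ?bw ?rw.
  + by apply: anb; rewrite aw.
- by rewrite inE => /eqP.
- by move=> h'; have := petal_novt (a e) h; rewrite h'.
- rewrite pi_set2 //= => ak; apply/negP => bk; apply: (@hdist e e' mu ne).
  have anb : a e <> b e by move=> ab; apply: (@hab e 1%g); rewrite (pi_id actW).
  rewrite pi_set2; apply/eqP; rewrite eq_sym eqEcard subUset !sub1set.
  have inw w : vt w \in [set vt (wact mu (a e')); vt (wact mu (b e'))] ->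
    w \in [set wact mu (a e'); wact mu (b e')].
    by rewrite !inE => /orP[/eqP[->]|/eqP[->]]; rewrite eqxx ?orbT.
  rewrite !inw //= !cards2; move/eqP: anb => ->; by case: (_ != _).
Qed.

(** Petals do not touch the forest any more, so its vertices of greatest rank are leaves hanging on
    [parI]. *)
Lemma remove_level lab m :
  heq R piI (Tm m.+1 :|: \bigcup_e petal lab e) (Tm m :|: \bigcup_e petal lab e).
Proof.
set Q := \bigcup_e petal lab e.
have Qnovt k w : k \in Q -> vt w \notin k by case/bigcupP => e _; apply: petal_novt.
pose K := Tm m.+1 :|: Q.
pose S : {set {set I} * I} := [set ([set vt w], parI w) | w in [pred w in A0 | rk w == m]].
have SP j : reflect (exists w, [/\ w \in A0, rk w = m & j = ([set vt w], parI w)]) (j \in S).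
  apply: (iffP imsetP) => [[w /andP[wA /eqP wm] ->]|[w [wA wm ->]]]; exists w => //.
  by apply/andP; rewrite wm eqxx.
have parm w : w \in A0 -> rk w = m -> (exists2 w', w' \in A0 & (rk w' < m)%N /\ parI w = vt w') \/ exists x, parI w = base x.
  move=> wA wm; rewrite /parI; have [rw|nrw] := boolP (root w); first by right; exists (rt w).
  by have [pA prk _] := hpar wA nrw; left; exists (par0 w); rewrite -?wm.
have Kvt w k : rk w = m -> k \in K -> vt w \in k -> k = [set vt w] \/ k = [set vt w; parI w].
  move=> wm; rewrite in_setU => /orP[|/(Qnovt _ w)/negbTE->//].
  case/TmP=> [[w' [wA' wm' kE]]|[x ->]]; last by rewrite inE => /eqP.
  case: kE => ->; first by rewrite inE => /eqP[->]; left.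
  rewrite !inE => /orP[/eqP[->]|/eqP]; first by right.
  rewrite /parI; have [//|nrw] := boolP (root w') => -[wE].
  by have [_ + _] := hpar wA' nrw; rewrite -wE wm => h; move: wm'; rewrite ltnS leqNgt h.
have -> : Tm m :|: Q = collapsed K S.
  apply/setP => k; apply/idP/idP.
    move=> kT; rewrite inE; apply/andP; split.
      move: kT; rewrite !in_setU -!in_setU => /setUP[|kQ]; last by rewrite in_setU kQ orbT.
      case/TmP=> [[w [wA wm kE]]|[x ->]]; rewrite in_setU; apply/orP; left; last exact: Tm_base.
      by apply/TmP; left; exists w; split=> //; apply: ltnW.
    apply/forall_inP => j /SP[w [wA wm ->]] /=; rewrite sub1set.
    case/setUP: kT => [|/Qnovt//]; case/TmP=> [[w' [wA' wm' kE]]|[x ->]]; last by rewrite inE.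
    have ww' : w <> w' by move=> h; rewrite -h wm ltnn in wm'.
    case: kE => ->; first by rewrite inE; apply/eqP => -[].
    rewrite !inE negb_or; apply/andP; split; first by apply/eqP => -[].
    rewrite /parI; have [//|nrw] := boolP (root w'); apply/eqP => -[wE].
    have [_ + _] := hpar wA' nrw; rewrite -wE wm => h.
    by have := ltn_trans h wm'; rewrite ltnn.
  rewrite inE => /andP[kK /forall_inP kS]; rewrite in_setU.
  move: kK; rewrite in_setU => /orP[|->]; last by rewrite orbT.
  case/TmP=> [[w [wA wm kE]]|[x ->]]; last by rewrite Tm_base.
  apply/orP; left; apply/TmP; left; exists w; split=> //.
  rewrite ltn_neqAle -ltnS wm andbT; apply/eqP => wm'.
  have := kS ([set vt w], parI w) (ltac:(by apply/SP; exists w)).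
  by rewrite /= sub1set; case: kE => ->; rewrite !inE eqxx.
apply: (@collapse_ghe R _ gT piI piI_act K S).
- move=> mu j /SP[w [wA wm ->]]; apply/SP; exists (wact mu w).
  by rewrite hA // hrk // pi_set1 // parI_act.
- move=> j /SP[w [wA wm ->]] /=; split; last by apply/set0Pn; exists (vt w); rewrite inE.
  rewrite inE; case: (parm w wA wm) => [[w' _ [h ->]]|[x ->]] //.
  by apply/eqP => -[e]; rewrite e wm ltnn in h.
- move=> j k /SP[w [wA wm ->]] /= ks k0; rewrite in_setU; apply/orP; left.
  have [->|->|->] := subset2 ks k0.
  + case: (parm w wA wm) => [[w' wA' [h ->]]|[x ->]]; last exact: Tm_base.
    by apply/TmP; left; exists w'; split=> //; [apply: ltnW|left].
  + by apply/TmP; left; exists w; rewrite wm; split=> //; left.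
  + by rewrite setUC; apply/TmP; left; exists w; rewrite wm; split=> //; right.
- move=> j k /SP[w [wA wm ->]] kK /=; rewrite sub1set => /(Kvt w k wm kK)[->|->].
    exact: subsetUr.
  by rewrite setUC.
- move=> i j k /SP[w [wA wm ->]] /SP[w' [wA' wm' ->]] kK /=; rewrite !sub1set.
  move=> /(Kvt w k wm kK) kE; suff kw : vt w' \in k -> w' = w by move=> /kw->.
  case: kE => ->; rewrite !inE; first by move=> /eqP[].
  move=> /orP[/eqP[]//|/eqP]; case: (parm w wA wm) => [[w'' _ [h ->]]|[x ->]] // -[e].
  by rewrite -e wm' ltnn in h.
Qed.

Lemma remove_tree lab :
  heq R piI (Tm M :|: \bigcup_e petal lab e) (Bs :|: \bigcup_e petal lab e).
Proof.
have iQ m : inv_cplx piI (Tm m :|: \bigcup_e petal lab e).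
  by apply: inv_setU; [apply: inv_Tm|apply: inv_bigcup => e; apply: inv_petal].
have T0 : Bs = Tm 0.
  apply/setP => k; apply/idP/idP => [/imsetP[x _ ->]|/TmP[[w [_ wm _]]|[x ->]]].
  - exact: Tm_base.
  - by rewrite ltn0 in wm.
  - by apply: imset_f; rewrite inE.
rewrite T0; elim: M => [|m IH]; first exact: (heq_refl R piI_act (iQ _)).
exact: (heq_trans piI_act (iQ _) (iQ _) (remove_level lab m) IH).
Qed.

Lemma inv_Bs : inv_cplx piI Bs.
Proof.
move=> mu _ /imsetP[x _ ->]; apply/imsetP; exists (mu * x)%g; rewrite ?inE //.
by rewrite pi_set1.
Qed.

(** The Cayley graph of the labels in [D], without orientation. *)
Definition petal_rel (lab : E -> gT) (D : {set E}) : rel gT :=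
  [rel x y | [exists e in D, (y == x * lab e) || (x == y * lab e)]]%g.

(** The far end of a petal outside [D] slides from [lab e] to [lab' e] along petals of [D]. These
    keep their labels, so the path is present whatever has happened to the other petals. *)
Lemma relabel lab lab' (D : {set E}) :
  (forall e, e \in D -> lab e = lab' e) ->
  (forall x y, connect (petal_rel lab D) x y) ->
  heq R piI (Bs :|: \bigcup_e petal lab e) (Bs :|: \bigcup_e petal lab' e).
Proof.
move=> labD conD; apply: (mixture piI_act inv_Bs (@inv_petal _) (@inv_petal _)) => D' e.
set S := rest _ _ _ _ _; have iS : inv_cplx piI S by apply: inv_mix; [exact: inv_Bs|exact: inv_petal|exact: inv_petal].
have [eD|eD] := boolP (e \in D).
  rewrite (_ : petal lab e = petal lab' e); last by rewrite /petal labD.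
  by apply: (heq_refl R piI_act); apply: inv_setU => //; apply: inv_petal.
have bS x : [set base x] \in S.
  by rewrite in_setU; apply/orP; left; apply/imsetP; exists x; rewrite ?inE.
have fr c : fresh S (mid 1%g e c).
  move=> k; rewrite in_setU => /orP[/imsetP[x _ ->]|/bigcupP[e' ne]]; first by rewrite inE.
  by case: ifP => _; apply: petal_nomid.
apply: (arc_slide R piI_act iS (fr _) (fr _) (@free_mid _ _ _) (@indep_mid e) (bS _) (bS _)).
have adjS : symmetric (adj S).
  by move=> u v; rewrite /adj [[set v; u]]setUC eq_sym; case: (_ \in S); case: (_ \in S).
have cstep x e' : e' \in D -> connect (adj S) (base x) (base (x * lab e')%g).
  move=> e'D; have sub k : k \in petal lab e' -> k \in S.
    move=> kp; rewrite in_setU; apply/orP; right; apply/bigcupP; exists e'.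
      by apply: contraNneq eD => <-.
    by case: ifP => // _; move: kp; rewrite /petal labD.
  have st (u v : I) : [set u] \in S -> [set v] \in S -> [set u; v] \in S -> u != v ->
    connect (adj S) u v by move=> *; apply: connect1; apply/and4P.
  have or1 (u : I) : [set piI x u] \in orb piI [set u] by apply/orbP; exists x; rewrite pi_set1.
  have or2 (u v : I) : [set piI x u; piI x v] \in orb piI [set u; v].
    by apply/orbP; exists x; rewrite pi_set2.
  have piB y : piI x (base y) = base (x * y)%g by [].
  have piM c : piI x (mid 1%g e' c) = mid x e' c by rewrite /= mulg1.
  have mS c : [set mid x e' c] \in S.
    by apply: sub; rewrite -piM !in_setU; case: c; rewrite or1 ?orbT.
  have p1 : connect (adj S) (base x) (mid x e' false).
    apply: st => //; apply: sub; rewrite -piM -{1}(mulg1 x) -piB !in_setU.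
    by rewrite or2 ?orbT.
  have p2 : connect (adj S) (mid x e' false) (mid x e' true).
    apply: st => //; first by apply: sub; rewrite -!piM !in_setU or2 ?orbT.
    by apply/eqP => -[].
  have p3 : connect (adj S) (mid x e' true) (base (x * lab e')%g).
    by apply: st => //; apply: sub; rewrite -piM -piB !in_setU or2 ?orbT.
  exact: connect_trans p1 (connect_trans p2 p3).
have /connectP[p pp ->] := conD (lab e) (lab' e).
elim: p (lab e) pp => [|y p IH] x /=; first by move=> _; apply: connect0.
case/andP=> /existsP[e' /andP[e'D h]] /IH; apply: connect_trans.
case/orP: h => /eqP->; first exact: cstep.
by rewrite (sym_connect_sym adjS); apply: cstep.
Qed.

Definition short (lab : E -> gT) (e : E) : {set {set I}} :=
  orb piI [set mid 1%g e false] :|: orb piI [set base 1%g; mid 1%g e false]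
  :|: orb piI [set mid 1%g e false; base (lab e)].

Lemma inv_short lab e : inv_cplx piI (short lab e).
Proof. by do !apply: inv_setU; apply: inv_orb; apply: piI_act. Qed.

Lemma short_nomid lab e e' (k : {set I}) x c : e != e' -> k \in short lab e -> mid x e' c \notin k.
Proof.
move=> ee'; have ne y z d d' : indep piI (mid y e d) (mid z e' d').
  by move=> mu [_ e_eq _]; rewrite e_eq eqxx in ee'.
rewrite !in_setU -!orbA => /or3P[kO|kO|kO];
  by [apply: (notin_orb1 _ kO)|apply: (notin_orb2 _ _ kO)].
Qed.

(** One midpoint is what [Greal] has on each edge. It requires the two ends of the petal to
    differ. *)
Lemma shorten_petals lab : (forall e, lab e <> 1%g) ->
  heq R piI (Bs :|: \bigcup_e petal lab e) (Bs :|: \bigcup_e short lab e).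
Proof.
move=> lab1; apply: (mixture piI_act inv_Bs (@inv_petal _) (@inv_short _)) => D' e.
set S := rest _ _ _ _ _; have iS : inv_cplx piI S by apply: inv_mix; [exact: inv_Bs|exact: inv_petal|exact: inv_short].
have bS x : [set base x] \in S.
  by rewrite in_setU; apply/orP; left; apply/imsetP; exists x; rewrite ?inE.
have fr c : fresh S (mid 1%g e c).
  move=> k; rewrite in_setU => /orP[/imsetP[x _ ->]|/bigcupP[e' ne]]; first by rewrite inE.
  by case: ifP => _; [apply: short_nomid|apply: petal_nomid].
apply: (arc_shorten R piI_act iS (fr _) (fr _) (@free_mid _ _ _) (@free_mid _ _ _) (@indep_mid e) (bS _) (bS _)).
  exact: free_base.
by move=> -[]; apply: lab1.
Qed.

Local Notation J := (gT + gT * E)%type.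
Definition piJ (mu : gT) (j : J) : J :=
  match j with inl x => inl (mu * x)%g | inr (x, e) => inr ((mu * x)%g, e) end.

Lemma piJ_act : is_act piJ.
Proof.
by split=> [[x|[x e]]|mu nu [x|[x e]]] /=; rewrite ?mul1g ?mulgA.
Qed.

Definition rose (lab : E -> gT) : {set {set J}} :=
  [set [set inl x] | x in [set: gT]] :|: [set [set inr p] | p in [set: gT * E]]
  :|: [set [set inl p.1; inr p] | p in [set: gT * E]]
  :|: [set [set inr p; inl (p.1 * lab p.2)%g] | p in [set: gT * E]].

Lemma roseP lab (k : {set J}) : k \in rose lab <->
  (exists x, k = [set inl x]) \/ exists p : gT * E,
    [\/ k = [set inr p], k = [set inl p.1; inr p] | k = [set inr p; inl (p.1 * lab p.2)%g]].
Proof.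
rewrite !in_setU -!orbA; split.
  case/or4P => /imsetP[x _ ->]; [by left; exists x|right; exists x..].
  - by constructor 1.
  - by constructor 2.
  - by constructor 3.
case=> [[x ->]|[p [->|->|->]]].
- by rewrite imset_f ?inE.
- by rewrite (imset_f (fun p => [set inr p])) ?inE ?orbT.
- by rewrite (imset_f (fun p => [set inl p.1; inr p])) ?inE ?orbT.
- by rewrite (imset_f (fun p => [set inr p; inl (p.1 * lab p.2)%g])) ?inE ?orbT.
Qed.

Lemma inv_rose lab : inv_cplx piJ (rose lab).
Proof.
move=> mu k /roseP[[x ->]|[[x e] h]]; apply/roseP.
  by left; exists (mu * x)%g; rewrite pi_set1.
right; exists ((mu * x)%g, e); case: h => ->; rewrite ?pi_set1 ?pi_set2 /=.
- by constructor 1.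
- by constructor 2.
- by constructor 3; rewrite mulgA.
Qed.

Definition iotaJ (j : J) : I := match j with inl x => base x | inr (x, e) => mid x e false end.

Lemma rose_reindexed lab : reindexed iotaJ (rose lab) = Bs :|: \bigcup_e short lab e.
Proof.
apply/setP => k; apply/imsetP/idP => [[k' /roseP kE ->]|].
  rewrite in_setU; case: kE => [[x ->]|[[x e] kE]]; apply/orP.
    by left; rewrite imset_set1; apply: imset_f; rewrite inE.
  right; apply/bigcupP; exists e => //.
  case: kE => ->; rewrite ?imsetU1 imset_set1 /= !in_setU -!orbA; apply/or3P.
  - by constructor 1; apply/orbP; exists x; rewrite pi_set1 /= mulg1.
  - by constructor 2; apply/orbP; exists x; rewrite pi_set2 /= !mulg1.
  - by constructor 3; apply/orbP; exists x; rewrite pi_set2 /= !mulg1.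
rewrite in_setU => /orP[/imsetP[x _ ->]|/bigcupP[e _]].
  exists [set inl x]; last by rewrite imset_set1.
  by apply/roseP; left; exists x.
rewrite !in_setU -!orbA => /or3P[] /orbP[x ->].
- exists [set inr (x, e)]; last by rewrite !imset_set1 /= mulg1.
  by apply/roseP; right; exists (x, e); constructor 1.
- exists [set inl x; inr (x, e)]; last by rewrite !imsetU1 !imset_set1 /= !mulg1.
  by apply/roseP; right; exists (x, e); constructor 2.
- exists [set inr (x, e); inl (x * lab e)%g]; last by rewrite !imsetU1 !imset_set1 /= !mulg1.
  by apply/roseP; right; exists (x, e); constructor 3.
Qed.

Lemma inv_tree_graph : inv_cplx wact tree_graph.
Proof.
move=> mu k; rewrite !in_setU -!orbA => /or3P[/imsetP[w wA ->]|/imsetP[w /andP[wA nrw] ->]|].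
- by rewrite pi_set1 imset_f ?hA.
- rewrite pi_set2 -hparE // (imset_f (fun w => [set w; par0 w])) ?orbT //.
  by apply/andP; rewrite hA // hroot.
- case/bigcupP=> e _ kO; apply/orP; right; apply/orP; right; apply/bigcupP; exists e => //.
  by apply: (inv_orb actW).
Qed.

(** A single orbit of leaves grown at [w1] puts a base vertex below every root, since the roots form
    one orbit. *)
Lemma tree_reindexed :
  reindexed vt tree_graph :|: orb piI [set base 1%g] :|: orb piI [set vt w1; base 1%g]
  = Tm M :|: \bigcup_e chord e.
Proof.
have [w1A rw1 rtw1] := hw1.
have TM k : k \in Tm M -> k \in Tm M :|: \bigcup_e chord e by rewrite in_setU => ->.
have OB x : [set base x] \in orb piI [set base 1%g] by apply/orbP; exists x; rewrite pi_set1 /= mulg1.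
have RE (k : {set W}) : k \in tree_graph -> vt @: k \in reindexed vt tree_graph by apply: imset_f.
apply/setP => k; apply/idP/idP.
  rewrite in_setU in_setU -!orbA => /or3P[/imsetP[k0 k0G ->]|/orbP[x ->]|/orbP[x ->]].
  - case/setUP: k0G => [/setUP[/imsetP[w wA ->]|/imsetP[w /andP[wA nrw] ->]]|/bigcupP[e _ /orbP[mu ->]]].
    + by apply/TM/TmP; left; exists w; split=> //; left; rewrite imset_set1.
    + apply/TM/TmP; left; exists w; split=> //; right.
      by rewrite imsetU1 imset_set1 /parI (negbTE nrw).
    + apply/setUP; right; apply/bigcupP; exists e => //; apply/orbP; exists mu.
      by rewrite !pi_set2 imsetU1 imset_set1.
  - by apply: TM; rewrite pi_set1 /= mulg1 Tm_base.
  - apply: TM; apply/TmP; left; exists (wact x w1); split=> //; first exact: hA.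
    by right; rewrite pi_set2 /parI hroot // rw1 hrt // rtw1.
case/setUP => [/TmP[[w [wA _ [->|->]]]|[x ->]]|/bigcupP[e _ /orbP[mu ->]]]; rewrite in_setU in_setU.
- by rewrite -imset_set1 RE // !in_setU imset_f.
- rewrite /parI; have [rw|nrw] := boolP (root w); last first.
    rewrite (_ : [set vt w; _] = vt @: [set w; par0 w]); last by rewrite imsetU1 imset_set1.
    by rewrite RE // !in_setU (imset_f (fun w => [set w; par0 w])) ?orbT //; apply/andP.
  apply/orP; right; apply/orbP; exists (rt w); rewrite pi_set2 /= mulg1.
  congr [set vt _; _]; apply: hru; rewrite ?hA ?hroot // hrt // rtw1 mulg1 //.
- by rewrite OB orbT.
- rewrite pi_set2 /= (_ : [set vt _; _] = vt @: (wact mu @: [set a e; b e])); last first.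
    by rewrite pi_set2 imsetU1 imset_set1.
  rewrite RE // !in_setU; apply/orP; right; apply/bigcupP; exists e => //.
  by apply/orbP; exists mu.
Qed.

Theorem graph_to_petals :
  ghe R (actI wact) (actI piI) (@real R W tree_graph)
    (@real R I (Bs :|: \bigcup_e petal (fun e => rt (b e)) e)).
Proof.
have [w1A rw1 rtw1] := hw1.
have vt_inj : injective vt by move=> w w' [].
have h0 := reindex_ghe R piI_act actW vt_inj (fun mu w => erefl _) inv_tree_graph.
have iG : inv_cplx piI (reindexed vt tree_graph).
  move=> mu _ /imsetP[k kG ->]; rewrite -imset_comp; apply/imsetP; exists (wact mu @: k).
    exact: inv_tree_graph.
  by rewrite -imset_comp; apply: eq_imset.
have iC : inv_cplx piI (Tm M :|: \bigcup_e chord e).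
  by apply: inv_setU; [apply: inv_Tm|apply: inv_bigcup => e; apply: inv_chord].
have iP lab T : inv_cplx piI T -> inv_cplx piI (T :|: \bigcup_e petal lab e).
  by move=> iT; apply: inv_setU => //; apply: inv_bigcup => e; apply: inv_petal.
have h1 : heq R piI (reindexed vt tree_graph) (Tm M :|: \bigcup_e chord e).
  apply/heq_sym; rewrite -tree_reindexed; apply: leaf_removal => //.
  - exact: piI_act.
  - by rewrite -imset_set1; apply: imset_f; rewrite !in_setU imset_f.
  - by move=> _ /imsetP[k _ ->]; apply/imsetP => -[].
  - exact: free_base.
have h2 := heq_trans piI_act iG (iP _ _ (@inv_Tm M)) h1 chords_to_petals.
have h3 := heq_trans piI_act iG (iP _ _ inv_Bs) h2 (remove_tree _).
apply: ghe_trans h0 h3 => y mu; apply: real_act => //.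
- exact: inv_tree_graph.
- exact: piI_act.
- exact: (iP _ _ inv_Bs).
Qed.
End Rose.

(** * The graph G(3, T) as a rose *)

Section Target.
Variables (R : realType) (m2 m3 : nat).
Local Notation N := (m2 + m3)%N.
Hypothesis m2_gt0 : (0 < m2)%N.

Definition petal_index : finType := {ki : 'I_3 * 'I_N | (ki.2 < mult m2 m3 ki.1)%N}.
Local Notation E := petal_index.

Definition target_label (e : E) : 'S_3 := gen (val e).1.
Definition kappa (j : 'S_3 + 'S_3 * E) : GI N :=
  match j with inl x => inl x | inr (x, e) => inr (x, (val e).1, (val e).2) end.

Lemma kappa_inj : injective kappa.
Proof.
move=> [x|[x [[k i] h]]] [y|[y [[l j] h']]] //= [] => [->//|-> kl ij].
by congr (inr (_, _)); apply: val_inj; rewrite /= kl ij.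
Qed.

Lemma kappa_act mu j : kappa (piJ mu j) = piG mu (kappa j).
Proof. by case: j => [x|[x e]]. Qed.

Lemma piG_act : is_act (@piG N).
Proof.
by split=> [[x|[[x k] i]]|mu nu [x|[[x k] i]]] /=; rewrite ?mul1g ?mulgA.
Qed.

Lemma co_gdelta (i j : GI N) : co (gdelta R j) i = (i == j)%:R.
Proof. by rewrite /co /gdelta mxE (inj_eq enum_rank_inj). Qed.

Lemma segment_real (K : {set {set GI N}}) (u v : GI N) (t : R) : u != v -> 0 <= t <= 1 ->
  [set u] \in K -> [set v] \in K -> [set u; v] \in K ->
  real K ((1 - t) *: gdelta R u + t *: gdelta R v).
Proof.
move=> uv /andP[t0 t1] uK vK uvK; set y := _ + _.
have yE i : co y i = (1 - t) * (i == u)%:R + t * (i == v)%:R.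
  by rewrite -!co_gdelta /co /y !mxE.
have sum1 j : \sum_i (i == j)%:R = 1 :> R.
  by rewrite (bigD1 j) //= eqxx big1 ?addr0 // => i /negbTE->.
split.
- by move=> i; rewrite yE addr_ge0 // mulr_ge0 // subr_ge0.
- under eq_bigr do rewrite yE.
  by rewrite big_split /= -!mulr_sumr !sum1 !mulr1 subrK.
- have -> : supp y = if t == 0 then [set u] else if t == 1 then [set v] else [set u; v].
    apply/setP => i; rewrite in_supp yE.
    have [->|nt0] := eqVneq t 0; first by rewrite inE subr0 mul1r mul0r addr0 pnatr_eq0 eqb0 negbK.
    have [->|nt1] := eqVneq t 1; first by rewrite inE subrr mul1r mul0r add0r pnatr_eq0 eqb0 negbK.
    rewrite !inE; have [->|iu] := eqVneq i u.
      by rewrite (negbTE uv) mulr1 mulr0 addr0 subr_eq0 eq_sym.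
    by case: (i == v); rewrite /= ?mulr0n ?mulr1n mulr0 add0r ?mulr1 ?mulr0 ?nt0 ?eqxx.
  by case: ifP => // _; case: ifP.
Qed.

Lemma real_segment (K : {set {set GI N}}) (y : 'rV[R]_#|GI N|) (u v : GI N) : u != v ->
  real K y -> supp y \subset [set u; v] ->
  exists2 t : R, 0 <= t <= 1 & y = (1 - t) *: gdelta R u + t *: gdelta R v.
Proof.
move=> uv [y0 y1 _] /subsetP ys.
have out i : i != u -> i != v -> co y i = 0.
  move=> iu iv; apply/eqP; apply: contraT; rewrite -in_supp => /ys.
  by rewrite !inE (negbTE iu) (negbTE iv).
have yuv : co y u + co y v = 1.
  rewrite -y1 (bigD1 u) //= (bigD1 v) /=; last by rewrite eq_sym.
  by rewrite big1 ?addr0 // => i /andP[iu iv]; apply: out.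
exists (co y v); first by rewrite y0 -yuv lerDr y0.
apply: vecP => i; rewrite -[RHS]/(co _ _).
have -> : co ((1 - co y v) *: gdelta R u + co y v *: gdelta R v) i =
  (1 - co y v) * (i == u)%:R + co y v * (i == v)%:R by rewrite -!co_gdelta /co !mxE.
have [->|iu] := eqVneq i u; first by rewrite (negbTE uv) mulr1 mulr0 addr0 -yuv addrK.
have [->|iv] := eqVneq i v; first by rewrite mulr0 mulr1 add0r.
by rewrite !mulr0 addr0 out.
Qed.

Lemma Greal_real : @Greal R m2 m3 = @real R _ (reindexed kappa (rose target_label)).
Proof.
pose K := reindexed kappa (rose target_label).
have K1 (x : 'S_3) : [set inl x] \in K.
  by apply/imsetP; exists [set inl x]; [apply/roseP; left; exists x|rewrite imset_set1].
have K2 x (e : E) : [set kappa (inr (x, e))] \in K.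
  apply/imsetP; exists [set inr (x, e)]; last by rewrite imset_set1.
  by apply/roseP; right; exists (x, e); constructor 1.
have K3 x (e : E) : [set inl x; kappa (inr (x, e))] \in K.
  apply/imsetP; exists [set inl x; inr (x, e)]; last by rewrite imsetU1 imset_set1.
  by apply/roseP; right; exists (x, e); constructor 2.
have K4 x (e : E) : [set kappa (inr (x, e)); inl (x * gen (val e).1)%g] \in K.
  apply/imsetP; exists [set inr (x, e); inl (x * gen (val e).1)%g]; last by rewrite imsetU1 imset_set1.
  by apply/roseP; right; exists (x, e); constructor 3.
apply/funext => y; apply/propext; split.
  move=> [x [k [i [ki [t [t01 yE]]]]]]; pose e : E := exist _ (k, i) ki.
  case: yE => ->; apply: segment_real => //; try exact: (K2 x e).
    exact: (K3 x e).
  exact: (K4 x e).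
move=> yK; have [_ _ /imsetP[k /roseP kE ys]] := yK.
(* [Greal] is a union of edges, so a point that is a vertex has to be placed on some edge. Family 0
   offers one because [m2] is positive. *)
have N0 : (0 < N)%N by rewrite addn_gt0 m2_gt0.
have e0P : (Ordinal N0 < mult m2 m3 ord0)%N by [].
have seg1 x (e : E) : supp y \subset [set inl x; kappa (inr (x, e))] -> @Greal R m2 m3 y.
  move=> /(real_segment (isT : inl x != kappa (inr (x, e))) yK)[t t01 yE].
  exists x, (val e).1, (val e).2; split; first exact: (valP e).
  by exists t; split=> //; left.
case: kE => [[x kE]|[[x e] [kE|kE|kE]]].
- by apply: (seg1 x (exist _ (ord0, Ordinal N0) e0P)); rewrite ys kE imset_set1 /= subsetUl.
- by apply: (seg1 x e); rewrite ys kE imset_set1 subsetUr.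
- by apply: (seg1 x e); rewrite ys kE imsetU1 imset_set1.
- have [t t01 yE] : exists2 t : R, 0 <= t <= 1 & y = (1 - t) *: gdelta R (kappa (inr (x, e))) +
      t *: gdelta R (inl (x * gen (val e).1)%g).
    by apply: real_segment yK _ => //; rewrite ys kE imsetU1 imset_set1.
  exists x, (val e).1, (val e).2; split; first exact: (valP e).
  by exists t; split=> //; right.
Qed.

Lemma rose_Greal : ghe R (actI (@piJ _ E)) (@actG R N)
  (@real R _ (rose target_label)) (@Greal R m2 m3).
Proof.
rewrite Greal_real; apply: (reindex_ghe R piG_act (@piJ_act _ _) kappa_inj kappa_act).
exact: inv_rose.
Qed.

Lemma card_petal_index : #|petal_index| = (3 * m2 + 2 * m3)%N.
Proof.
rewrite card_sig -sum1_card (eq_bigl (fun ki : 'I_3 * 'I_N => (ki.2 < mult m2 m3 ki.1)%N)) //.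
rewrite -(pair_big_dep predT (fun k (i : 'I_N) => (i < mult m2 m3 k)%N) (fun _ _ => 1%N)) /=.
have cnt n : (n <= N)%N -> (\sum_(i < N | i < n) 1 = n)%N.
  by move=> nN; rewrite (big_ord_narrow nN) /= sum1_card card_ord.
rewrite (eq_bigr (mult m2 m3)); last first.
  by move=> k _; rewrite cnt // /mult; case: ifP => _ //; rewrite leq_addr.
by rewrite !big_ord_recl big_ord0 /mult /=; lia.
Qed.

Lemma target_label_neq1 e : target_label e <> 1%g.
Proof.
have t12 (a b : 'I_3) : a != b -> tperm a b <> 1%g.
  by move=> ab /permP/(_ a); rewrite tpermL perm1 => /esym/eqP; apply/negP.
have io (a b : nat) : (a < 3)%N -> (b < 3)%N -> a != b -> (inord a : 'I_3) != inord b.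
  by move=> ha hb; rewrite -(inj_eq val_inj) /= !inordK.
rewrite /target_label /gen; case: ifP => _.
  move=> /permP/(_ (inord 0)); rewrite permM tpermL perm1 tpermD; try exact: io.
  by move/eqP; apply/negP; apply: io.
by case: ifP => _; apply: t12; apply: io.
Qed.
End Target.

(** * The flow on configurations *)

Section Configurations.
Variables (V : finType) (e : rel V) (r : V) (par : V -> V) (dep : V -> nat).
Hypothesis rtd : rooted e r par dep.
Local Notation cell := {ffun 'I_3 -> V * bool}.
Local Notation W := {ffun 'I_3 -> V}.
Local Notation valid := (valid r par).
Local Notation red := (redundant r par).
Local Notation mc := (active r par).
Implicit Types (w : W) (c : cell) (p q : 'I_3).

Definition inj_conf : {set W} := [set w : W | injectiveb w].
Definition tok0 w : cell := [ffun p => (w p, false)].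
Definition par0 w : W :=
  if [pick p | red (tok0 w) p] is Some p then [ffun q => if q == p then par (w q) else w q] else w.
Definition root w := [forall p, ~~ red (tok0 w) p].
Definition depth_sum w : nat := (\sum_p dep (w p))%N.

Lemma inj_confP w : reflect (injective w) (w \in inj_conf).
Proof. by rewrite inE; apply: injectiveP. Qed.

Lemma valid_tok0 w : valid (tok0 w) = (w \in inj_conf).
Proof.
apply/idP/inj_confP => [vw p q pq|wi].
  by apply: (valid_inj vw); rewrite !ffunE.
apply: validI => [p|p q v pq]; rewrite !ffunE //= /verts /= !inE => /eqP->.
by rewrite (inj_eq wi).
Qed.

Lemma tok0_act mu w : tok0 (wact mu w) = cact mu (tok0 w).
Proof. by apply/ffunP => p; rewrite !ffunE. Qed.

Lemma inj_conf_act mu w : w \in inj_conf -> wact mu w \in inj_conf.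
Proof. by rewrite -!valid_tok0 tok0_act; apply: valid_act. Qed.

Lemma wact_free mu w : w \in inj_conf -> wact mu w = w -> mu = 1%g.
Proof.
move=> /inj_confP wi /ffunP h; apply/permP => p; rewrite perm1; apply: wi.
by have := h p; rewrite ffunE.
Qed.

Lemma root_act mu w : root (wact mu w) = root w.
Proof.
rewrite /root tok0_act; apply/forallP/forallP => h p.
  by have := h (mu^-1%g p); rewrite red_act permKV.
by rewrite red_act; apply: h.
Qed.

Lemma red_uniq c p q : valid c -> red c p -> red c q -> p = q.
Proof. by move=> vc /andP[m1 _] /andP[m2 _]; apply: (mc_uniq vc m1 m2). Qed.

Lemma par0_red w p : w \in inj_conf -> red (tok0 w) p ->
  par0 w = [ffun q => if q == p then par (w q) else w q].
Proof.
rewrite -valid_tok0 => vw rp; rewrite /par0; case: pickP => [q rq|/(_ p)]; last by rewrite rp.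
by rewrite (red_uniq vw rq rp).
Qed.

Lemma par0_root w : root w -> par0 w = w.
Proof.
by move=> /forallP h; rewrite /par0; case: pickP => // p rp; have := h p; rewrite rp.
Qed.

Lemma nroot_ex w : ~~ root w -> exists p, red (tok0 w) p.
Proof. by rewrite negb_forall => /existsP[p]; rewrite negbK; exists p. Qed.

Lemma red_tok0 w p : red (tok0 w) p -> w p != r /\ forall q, q != p -> par (w p) != w q.
Proof.
move=> /red_unbl/unblP[_]; rewrite ffunE /= => wr h; split=> // q qp.
by have := h q qp; rewrite ffunE /verts /= inE.
Qed.

Lemma par0_act mu w : w \in inj_conf -> par0 (wact mu w) = wact mu (par0 w).
Proof.
move=> wA; have [rw|nrw] := boolP (root w); first by rewrite !par0_root ?root_act.
have [p rp] := nroot_ex nrw.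
rewrite (par0_red wA rp) (@par0_red _ (mu^-1%g p)); last 2 first.
- exact: inj_conf_act.
- by rewrite tok0_act red_act permKV.
apply/ffunP => q; rewrite !ffunE.
by rewrite -(inj_eq (@perm_inj _ mu)) permKV.
Qed.

Lemma rk_act mu w : depth_sum (wact mu w) = depth_sum w.
Proof.
by rewrite /depth_sum [RHS](reindex_inj (@perm_inj _ mu)); apply: eq_bigr => p _; rewrite ffunE.
Qed.

Lemma par0_inj_conf w : w \in inj_conf -> par0 w \in inj_conf.
Proof.
move=> wA; have [rw|nrw] := boolP (root w); first by rewrite par0_root.
have [p rp] := nroot_ex nrw; have [wr hp] := red_tok0 rp; rewrite (par0_red wA rp).
have wi := elimT (inj_confP w) wA.
apply/inj_confP => q q'; rewrite !ffunE.
have [->|qp] := eqVneq q p; have [->|q'p] := eqVneq q' p => //.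
- by move/eqP; rewrite (negbTE (hp _ q'p)).
- by move/esym/eqP; rewrite (negbTE (hp _ qp)).
- exact: wi.
Qed.

Lemma rk_par0 w : w \in inj_conf -> ~~ root w -> (depth_sum (par0 w) < depth_sum w)%N.
Proof.
move=> wA nrw; have [p rp] := nroot_ex nrw; have [wr _] := red_tok0 rp.
rewrite (par0_red wA rp) /depth_sum (bigD1 p) //= [X in (_ < X)%N](bigD1 p) //= ffunE eqxx.
rewrite (dep_par rtd wr) (eq_bigr (fun q => dep (w q))); last first.
  by move=> q /negbTE qp; rewrite ffunE qp.
by rewrite addSn ltnS.
Qed.

(** Each step that is not a fixed point lowers [depth_sum], so this number of steps always
    suffices. *)
Definition sink w : W := iter (\max_w depth_sum w) par0 w.

Lemma iter_inj_conf m w : w \in inj_conf -> iter m par0 w \in inj_conf.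
Proof. by move=> wA; elim: m => //= m; apply: par0_inj_conf. Qed.

Lemma root_sink w : w \in inj_conf -> root (sink w).
Proof.
move=> wA; have H m : root (iter m par0 w) || (depth_sum (iter m par0 w) + m <= depth_sum w)%N.
  elim: m => [|m /orP[h|h]]; rewrite ?addn0 ?leqnn ?orbT //=; first by rewrite par0_root // h.
  have [rm|nrm] := boolP (root (iter m par0 w)); first by rewrite par0_root // rm.
  apply/orP; right; rewrite addnS -addSn; apply: leq_trans h; rewrite leq_add2r.
  by apply: rk_par0 => //; apply: iter_inj_conf.
have /orP[//|h] := H (\max_w depth_sum w).
have le : (depth_sum w <= \max_w depth_sum w)%N by apply: leq_bigmax.
have : depth_sum (sink w) = 0%N by rewrite /sink; move: h le; lia.
move=> h0; apply: contraT => nr; have := rk_par0 (iter_inj_conf _ wA) nr.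
by rewrite [depth_sum (iter _ _ _)]h0.
Qed.

Lemma sink_par0 w : w \in inj_conf -> sink (par0 w) = sink w.
Proof.
by move=> wA; rewrite /sink -iterSr iterS -/(sink w) par0_root // root_sink.
Qed.

Lemma sink_root w : root w -> sink w = w.
Proof. by move=> rw; rewrite /sink; elim: (\max_w _) => //= m ->; apply: par0_root. Qed.

Lemma sink_act mu w : w \in inj_conf -> sink (wact mu w) = wact mu (sink w).
Proof.
move=> wA; rewrite /sink; elim: (\max_w _) => //= m ->.
by rewrite par0_act // iter_inj_conf.
Qed.

Variables (v1 v2 : V).
Hypotheses (ch0 : children r par r = [set v1]) (ch1 : children r par v1 = [set v2]).

Definition base3 (i : 'I_3) : V := tnth [tuple r; v1; v2] i.

Lemma child0 v : v != r -> par v = r -> v = v1.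
Proof. by move=> vr pv; apply/set1P; rewrite -ch0 inE vr pv eqxx. Qed.

Lemma child1 v : v != r -> par v = v1 -> v = v2.
Proof. by move=> vr pv; apply/set1P; rewrite -ch1 inE vr pv eqxx. Qed.

Lemma v1P : v1 != r /\ par v1 = r.
Proof. by have := set11 v1; rewrite -ch0 inE => /andP[? /eqP]. Qed.

Lemma v2P : v2 != r /\ par v2 = v1.
Proof. by have := set11 v2; rewrite -ch1 inE => /andP[? /eqP]. Qed.

Lemma dep_base3 i : dep (base3 i) = i.
Proof.
have [h1 p1] := v1P; have [h2 p2] := v2P.
have d1 : dep v1 = 1%N by rewrite (dep_par rtd h1) p1 (dep_root rtd).
have d2 : dep v2 = 2%N by rewrite (dep_par rtd h2) p2 d1.
by rewrite /base3; case: i => [[|[|[|]]]] //= h; rewrite (tnth_nth r) //= (dep_root rtd).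
Qed.

Lemma base3_inj : injective base3.
Proof. by move=> i j h; apply: val_inj; rewrite /= -dep_base3 h dep_base3. Qed.

Lemma root_blocked w p : root w -> w p = r \/ exists2 q, q != p & par (w p) = w q.
Proof.
move=> /forallP nred; have [->|wr] := eqVneq (w p) r; [by left|right].
apply: contrapT => nex; have up : unbl r par (tok0 w) p.
  apply/unblP; rewrite ffunE; split=> // q qp; rewrite ffunE /verts inE /=.
  by apply/eqP => h; apply: nex; exists q.
have [q mq] : exists q, mc (tok0 w) q by apply: (@mc_ex _ _ _ _ _ p); rewrite /cand up.
by have := nred q; rewrite /redundant mq ffunE.
Qed.

(** In a stuck configuration a point off the root stands on a child of another point. With three
    points the chain of blocking points reaches the root after at most two steps, and the only
    children [v1] and [v2] leave no choice of position. *)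
Lemma root_base3 w p : w \in inj_conf -> root w -> exists i, w p = base3 i.
Proof.
move=> /inj_confP wi rw.
have [w0|[q qp pq]] := root_blocked p rw; first by exists ord0.
have [->|wpr] := eqVneq (w p) r; first by exists ord0.
have dp := dep_par rtd wpr; rewrite pq in dp.
have [q0|[q' q'q pq']] := root_blocked q rw.
  by exists (inord 1); rewrite /base3 (tnth_nth r) inordK //=; apply: child0; rewrite ?pq.
have [q0|wqr] := eqVneq (w q) r.
  by exists (inord 1); rewrite /base3 (tnth_nth r) inordK //=; apply: child0; rewrite ?pq.
have dq := dep_par rtd wqr; rewrite pq' in dq.
have q'p : q' != p by apply/eqP => h; move: dp dq; rewrite h; lia.
have q'0 : w q' = r.
  have [//|[s sq' ps]] := root_blocked q' rw.
  apply: contrapT => /eqP wq'r; have ds := dep_par rtd wq'r; rewrite ps in ds.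
  have sp : s != p by apply/eqP => h; move: dp dq ds; rewrite h; lia.
  have sq : s != q by apply/eqP => h; move: dp dq ds; rewrite h; lia.
  have q'q2 : q' = s by apply: (@ord3_third p q); rewrite // eq_sym.
  by rewrite q'q2 eqxx in sq'.
exists (inord 2); rewrite /base3 (tnth_nth r) inordK //=; apply: child1 => //.
by rewrite pq; apply: child0; rewrite // pq'.
Qed.

Definition conf (x : 'S_3) : W := [ffun p => base3 (x p)].

Lemma conf_inj : injective conf.
Proof.
move=> x y /ffunP h; apply/permP => p; apply: base3_inj.
by have := h p; rewrite !ffunE.
Qed.

Lemma root_conf_ex w : w \in inj_conf -> root w -> exists x, w = conf x.
Proof.
move=> wA rw; have [f fP] := boolp.choice (fun p => root_base3 p wA rw).
have fi : injective f.
  by move=> p q h; apply: (elimT (inj_confP w) wA); rewrite !fP h.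
by exists (perm fi); apply/ffunP => p; rewrite ffunE permE.
Qed.

Lemma conf_root x : conf x \in inj_conf /\ root (conf x).
Proof.
have cA : conf x \in inj_conf.
  by apply/inj_confP => p q; rewrite !ffunE => /base3_inj/perm_inj.
split=> //; apply/forallP => p; apply/negP => /red_tok0[]; rewrite !ffunE => nr h.
have xp0 : x p != ord0 by apply: contraNneq nr => ->.
have [q qE] : exists q, par (base3 (x p)) = base3 (x q).
  have [h1 p1] := v1P; have [h2 p2] := v2P.
  have : (x p == 1%N :> nat) || (x p == 2%N :> nat).
    by move: xp0 (ltn_ord (x p)); rewrite -(inj_eq val_inj) /=; lia.
  case/orP => /eqP e1; [exists (x^-1%g ord0)|exists (x^-1%g (inord 1))];
    rewrite permKV /base3 !(tnth_nth r) e1 /= ?inordK //.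
have qp : q != p.
  by apply: contraNneq nr => qp; rewrite qp in qE; apply: contraT => /(par_neq rtd)/eqP.
by have := h q qp; rewrite !ffunE qE eqxx.
Qed.

(** The order in which the points arrive on the segment at the root. On injective configurations the
    default is never taken. *)
Definition lbl w : 'S_3 := odflt 1%g [pick x | sink w == conf x].

Lemma lblP w : w \in inj_conf -> sink w = conf (lbl w).
Proof.
move=> wA; have [x xE] := root_conf_ex (iter_inj_conf _ wA) (root_sink wA).
rewrite /lbl; case: pickP => [y /eqP//|/(_ x)]; by rewrite [sink w]xE eqxx.
Qed.

Lemma lbl_eq w x : w \in inj_conf -> sink w = conf x -> lbl w = x.
Proof. by move=> wA h; apply: conf_inj; rewrite -lblP. Qed.

Lemma lbl_conf x : lbl (conf x) = x.
Proof. by have [cA cr] := conf_root x; apply: lbl_eq => //; apply: sink_root. Qed.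

Lemma lbl_par0 w : w \in inj_conf -> lbl (par0 w) = lbl w.
Proof. by move=> wA; apply: lbl_eq; rewrite ?par0_inj_conf // sink_par0 // lblP. Qed.

Lemma lbl_act mu w : w \in inj_conf -> lbl (wact mu w) = (mu * lbl w)%g.
Proof.
move=> wA; apply: lbl_eq; rewrite ?inj_conf_act // sink_act // lblP //.
by apply/ffunP => p; rewrite !ffunE permM.
Qed.

Lemma root_lbl_inj w w' : w \in inj_conf -> w' \in inj_conf -> root w -> root w' ->
  lbl w = lbl w' -> w = w'.
Proof.
by move=> wA wA' rw rw' h; rewrite -(sink_root rw) -(sink_root rw') !lblP // h.
Qed.

Definition anc (x y : V) := exists k, iter k par y = x.

Lemma anc_dep x y : anc x y -> x != y -> (dep x < dep y)%N.
Proof.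
case=> k <- {x}; elim: k y => [|k IH] y; first by rewrite /= eqxx.
rewrite iterSr; have [->|yr] := eqVneq y r.
  by rewrite (par_root rtd) => h; apply: IH.
rewrite (dep_par rtd yr) ltnS => _.
have [->//|h] := eqVneq (iter k par (par y)) (par y).
exact/ltnW/IH.
Qed.

(* The flow never lets a point overtake one of its ancestors. *)
Lemma anc_par0 w p q : w \in inj_conf -> p != q -> anc (w p) (w q) -> anc (par0 w p) (par0 w q).
Proof.
move=> wA pq [k wk]; have [rw|nrw] := boolP (root w); first by rewrite par0_root //; exists k.
have [s rs] := nroot_ex nrw; rewrite (par0_red wA rs) !ffunE.
have [ps|ps] := eqVneq p s; have [qs|qs] := eqVneq q s.
- by rewrite ps qs eqxx in pq.
- by exists k.+1; rewrite iterS wk.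
- case: k wk => [|k] wk; last by exists k; rewrite -iterSr.
  by have := elimT (inj_confP w) wA q p wk => qp; rewrite qp eqxx in pq.
- by exists k.
Qed.

(** The tool for finding labels: the final order of two points is read off from their positions
    without following the flow. *)
Lemma anc_lbl w p q : w \in inj_conf -> p != q -> anc (w p) (w q) -> (lbl w p < lbl w q)%N.
Proof.
move=> wA pq h; have {h} : anc (sink w p) (sink w q).
  rewrite /sink; elim: (\max_w _) => //= m; apply: anc_par0 => //.
  exact: iter_inj_conf.
rewrite lblP // !ffunE => /anc_dep; rewrite !dep_base3; apply.
by rewrite (inj_eq base3_inj) (inj_eq perm_inj).
Qed.
End Configurations.

(** * Critical 1-cells as the edges outside the forest of flow lines *)

Section CriticalCells.
Variables (V : finType) (e : rel V) (r : V) (par : V -> V) (dep : V -> nat).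
Hypothesis rtd : rooted e r par dep.
Variables (v1 v2 : V).
Hypotheses (ch0 : children r par r = [set v1]) (ch1 : children r par v1 = [set v2]).
Local Notation cell := {ffun 'I_3 -> V * bool}.
Local Notation W := {ffun 'I_3 -> V}.
Local Notation cl := (verts par).
Local Notation valid := (valid r par).
Local Notation red := (redundant r par).
Local Notation col := (collapsible r par).
Local Notation mc := (active r par).
Local Notation cand := (cand r par).
Local Notation par0 := (par0 r par).
Local Notation root := (root r par).
Local Notation rk := (depth_sum dep).
Local Notation lbl := (lbl r par dep v1 v2).
Local Notation A0 := (inj_conf V).
Implicit Types (w : W) (c : cell) (p q : 'I_3).

Definition lo c : W := [ffun p => (c p).1].
Definition hi c : W := [ffun p => if (c p).2 then par (c p).1 else (c p).1].
Definition crit : {set cell} :=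
  [set c : cell | [&& valid c, dimc c == 1%N & [forall p, ~~ cand c p]]].
(** One cell from each orbit: translation multiplies the label of [lo c] by the permutation, so
    exactly one translate has label 1. *)
Definition crit1 : {set cell} := [set c in crit | lbl (lo c) == 1%g].

Lemma critP c : reflect [/\ valid c, dimc c = 1%N & forall p, ~~ cand c p] (c \in crit).
Proof.
rewrite inE; apply: (iffP and3P) => [[h /eqP h' /forallP h'']|[h h' h'']]; split=> //.
  exact/eqP.
exact/forallP.
Qed.

Lemma dim1_ex c : dimc c = 1%N -> exists p, (c p).2 /\ forall q, q != p -> (c q).2 = false.
Proof.
move=> d1; have [p0 h] : exists p0, forall p, p != p0 -> (c p).2 = false.
  by apply: dimc_le1; rewrite d1.
exists p0; split=> //; move: d1; rewrite /dimc (bigD1 p0) //= big1 ?addn0.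
  by case: (c p0).2.
by move=> q /h->.
Qed.

Lemma lo_inj_conf c : valid c -> lo c \in A0.
Proof. by move=> vc; apply/inj_confP => p q; rewrite !ffunE => /(valid_inj vc). Qed.

Lemma hi_inj_conf c : valid c -> hi c \in A0.
Proof.
move=> vc; have hcl p : hi c p \in cl (c p).
  by rewrite ffunE /verts; case: (c p).2; rewrite !inE eqxx ?orbT.
apply/inj_confP => p q h; apply/eqP; apply: contraT => pq.
by have := valid_disj vc pq (hcl p); rewrite h hcl.
Qed.

Lemma lo_act mu c : lo (cact mu c) = wact mu (lo c).
Proof. by apply/ffunP => p; rewrite !ffunE. Qed.

Lemma hi_act mu c : hi (cact mu c) = wact mu (hi c).
Proof. by apply/ffunP => p; rewrite !ffunE. Qed.

Lemma cell_lo_hi c c' : valid c -> valid c' -> lo c = lo c' -> hi c = hi c' -> c = c'.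
Proof.
move=> vc vc' /ffunP hl /ffunP hh; apply/ffunP => p.
have := hl p; have := hh p; rewrite !ffunE => h1 h2.
have ne b : valid b -> (b p).2 -> par (b p).1 <> (b p).1.
  by move=> vb b2; apply/eqP/(par_neq rtd)/(valid_root vb b2).
move: (ne c vc) (ne c' vc') h1 h2; case: (c p) (c' p) => [u [|]] [u' [|]] //= h h' h1 h2.
- by rewrite h2.
- by case: (h isT); rewrite h1.
- by case: (h' isT); rewrite -h1.
- by rewrite h2.
Qed.

Lemma rk_hi c : valid c -> dimc c = 1%N -> (rk (hi c) < rk (lo c))%N.
Proof.
move=> vc d1; have [p [cp hp]] := dim1_ex d1.
rewrite /depth_sum (bigD1 p) //= [X in (_ < X)%N](bigD1 p) //= !ffunE cp.
rewrite (dep_par rtd (valid_root vc cp)) (eq_bigr (fun q => dep (lo c q))); last first.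
  by move=> q qp; rewrite !ffunE hp.
by rewrite addSn ltnS.
Qed.

Lemma ends_tok0 w : ends par (tok0 w) = [set w].
Proof.
apply/setP => w'; rewrite in_set1; apply/in_ends/eqP => [h|-> p]; last by rewrite ffunE inE.
by apply/ffunP => p; have := h p; rewrite ffunE inE => /eqP.
Qed.

Lemma ends_dim1 c : dimc c = 1%N -> ends par c = [set lo c; hi c].
Proof.
move=> d1; have [p [cp hp]] := dim1_ex d1; apply/setP => w; rewrite !inE.
apply/forallP/orP => [h|[/eqP->|/eqP->] q]; first last.
- by rewrite ffunE /verts; case: (c q).2; rewrite !inE eqxx ?orbT.
- by rewrite ffunE cl_self.
have wq q : q != p -> w q = (c q).1.
  by move=> qp; have := h q; rewrite /verts hp // inE => /eqP.
have := h p; rewrite /verts cp !inE => /orP[] /eqP wp; [left|right]; apply/eqP/ffunP => q;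
  rewrite ffunE; (have [->|qp] := eqVneq q p; first by rewrite ?cp).
  exact: wq.
by rewrite hp // wq.
Qed.

Lemma tok0_lo c p : valid c -> col c p -> dimc c = 1%N ->
  red (tok0 (lo c)) p /\ par0 (lo c) = hi c.
Proof.
move=> vc cc d1; have [q [cq hq]] := dim1_ex d1.
have pq : p = q.
  by apply/eqP; apply: contraT => /hq h; move: cc => /andP[_]; rewrite h.
have tE : tok0 (lo c) = tog c p.
  apply/ffunP => k; rewrite /tog !ffunE; have [->|kp] := eqVneq k p; first by rewrite pq cq.
  by rewrite -(hq k) ?pq -?pq //; case: (c k).
have [_ rt'] := col_down vc cc; rewrite -tE in rt'; split=> //.
rewrite (par0_red (lo_inj_conf vc) rt'); apply/ffunP => k; rewrite !ffunE.
have [->|kp] := eqVneq k p; first by rewrite pq cq.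
by rewrite hq // -pq.
Qed.

Lemma no_red_inK c : valid c -> dimc c = 1%N -> (forall p, ~~ red c p) -> inK r par dep 0 c.
Proof.
by move=> vc d1 nr; apply/(inK0P rtd (@no_critical3 V r par) _); split=> //; right.
Qed.

Lemma crit_inK c : c \in crit -> inK r par dep 0 c.
Proof.
case/critP => vc d1 nc; apply: no_red_inK => // p.
by apply: contra (nc p) => /andP[/andP[]].
Qed.

Lemma crit_act mu c : c \in crit -> cact mu c \in crit.
Proof.
case/critP => vc d1 nc; apply/critP; split; rewrite ?dimc_act //; first exact: valid_act.
by move=> p; rewrite cand_act.
Qed.

Lemma crit_normal c : c \in crit -> cact (lbl (lo c))^-1%g c \in crit1.
Proof.
move=> cQ; have [vc _ _] := elimT (critP c) cQ; rewrite inE crit_act //=.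
by rewrite lo_act (lbl_act rtd ch0 ch1) ?lo_inj_conf // mulVg.
Qed.

Variables (E : finType) (qc : E -> cell).
Hypotheses (qcQ : forall i, qc i \in crit1) (qc_inj : injective qc)
  (qc_surj : forall c, c \in crit1 -> exists i, qc i = c).

Lemma qc_crit i : qc i \in crit.
Proof. by have := qcQ i; rewrite inE => /andP[]. Qed.

(** A surviving 1-cell is collapsible or critical. The collapsible ones are the single flow steps
    from [lo c] to [hi c], that is, the forest edges; the critical ones are the translates of the
    cells [qc i]. *)
Lemma Kg_tree_graph : Kg r par dep =
  tree_graph (@wact V) A0 par0 root (fun i => lo (qc i)) (fun i => hi (qc i)).
Proof.
apply/setP => k; apply/idP/idP.
  case/KgP => c cK ->; have [vc h] := elimT (inK0P rtd (@no_critical3 V r par) c) cK.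
  case: h => [d0|[d1 nr]].
    apply/setUP; left; apply/setUP; left.
    have -> : c = tok0 (lo c).
      apply/ffunP => p; rewrite !ffunE; have : (c p).2 = false.
        by apply/negbTE/negP => cp; move: d0; rewrite /dimc (bigD1 p) //= cp.
      by case: (c p) => u b /= ->.
    by rewrite ends_tok0; apply: imset_f; apply: lo_inj_conf.
  rewrite ends_dim1 //; have [/existsP[p mp]|/existsPn nm] := boolP [exists p, mc c p].
    have cp : (c p).2 by apply: contraT => cp; have := nr p; rewrite /redundant mp cp.
    have cc : col c p by rewrite /collapsible mp cp.
    have [rt' pE] := tok0_lo vc cc d1; rewrite -pE.
    apply/setUP; left; apply/setUP; right.
    apply: (imset_f (fun w => [set w; par0 w])); apply/andP; split; first exact: lo_inj_conf.
    by apply/forallPn; exists p; rewrite negbK.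
  have cQ : c \in crit.
    by apply/critP; split=> // p; apply/negP => /mc_ex[q mq]; have := nm q; rewrite mq.
  have [i iE] := qc_surj (crit_normal cQ).
  apply/setUP; right; apply/bigcupP; exists i => //; apply/orbP; exists (lbl (lo c)).
  have actK mu : cact mu (cact mu^-1%g c) = c by rewrite -{1}[mu]invgK cactK.
  by rewrite pi_set2 iE -lo_act -hi_act actK.
case/setUP => [/setUP[/imsetP[w wA ->]|/imsetP[w /andP[wA nrw] ->]]|/bigcupP[i _ /orbP[mu ->]]].
- apply/KgP; exists (tok0 w); last by rewrite ends_tok0.
  apply/(inK0P rtd (@no_critical3 V r par) _); rewrite valid_tok0; split=> //; left.
  by rewrite /dimc big1 // => p _; rewrite ffunE.
- have [p rp] := nroot_ex nrw; have vw : valid (tok0 w) by rewrite valid_tok0.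
  have [vc cc] := red_up rtd vw rp; set c := tog (tok0 w) p in vc cc.
  have d1 : dimc c = 1%N.
    rewrite /c dimc_tog; last by rewrite ffunE.
    by rewrite /dimc big1 // => q _; rewrite ffunE.
  have lc : lo c = w.
    by apply/ffunP => q; rewrite !ffunE; case: eqVneq => [->|] /=; rewrite ?ffunE.
  have [_ pE] := tok0_lo vc cc d1; rewrite lc in pE.
  apply/KgP; exists c; last by rewrite ends_dim1 // lc -pE.
  apply: no_red_inK => // q; apply/negP => /andP[mq cq]; move: cc => /andP[mp cp].
  by rewrite (mc_uniq vc mq mp) cp in cq.
- have cQ := qc_crit i; have [vc d1 _] := elimT (critP _) cQ.
  rewrite -ends_dim1 // -ends_act; apply/KgP; exists (cact mu (qc i)) => //.
  by apply: inK_act; apply: crit_inK.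
Qed.

Lemma crit_lo_par0 c : c \in crit -> ~~ root (lo c) -> par0 (lo c) <> hi c.
Proof.
case/critP => vc d1 nc nr; have [p rp] := nroot_ex nr.
rewrite (par0_red (lo_inj_conf vc) rp) => /ffunP h.
have [q [cq hq]] := dim1_ex d1; have qp : q = p.
  have := h q; rewrite !ffunE cq; case: eqVneq => // _ h'.
  by have := par_neq rtd (valid_root vc cq); rewrite -h' eqxx.
have tE : tok0 (lo c) = tog c p.
  apply/ffunP => k; rewrite /tog !ffunE; have [->|kp] := eqVneq k p; first by rewrite -qp cq.
  by rewrite -(hq k) ?qp //; case: (c k).
have vs : valid (tog c p) by rewrite -tE valid_tok0; apply: lo_inj_conf.
rewrite tE in rp; have [_ /andP[/andP[cc _] _]] := red_up rtd vs rp.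
by rewrite togK in cc; have := nc p; rewrite cc.
Qed.

Theorem Kg_petals (R : realType) :
  ghe R (actI (@wact V)) (actI (@piI _ W E (@wact V))) (@real R W (Kg r par dep))
    (@real R _ (Bs _ W E :|: \bigcup_i petal (@wact V) (fun i => lbl (hi (qc i))) i)).
Proof.
rewrite Kg_tree_graph.
have qv i : valid (qc i) /\ dimc (qc i) = 1%N by have [] := elimT (critP _) (qc_crit i).
have qlbl i : lbl (lo (qc i)) = 1%g by have := qcQ i; rewrite inE => /andP[_ /eqP].
have [cA cr] := conf_root rtd ch0 ch1 1%g.
apply: (@graph_to_petals R _ W E (@wact V) (@wact_act V) A0 par0 root rk lbl (conf r v1 v2 1%g)).
- by move=> mu w; apply: inj_conf_act.
- by move=> mu w; apply: wact_free.
- by move=> mu w _; apply: root_act.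
- move=> w wA nr; split; first exact: par0_inj_conf.
    exact: (rk_par0 rtd).
  exact: (lbl_par0 rtd ch0 ch1).
- by move=> mu w wA _; apply: par0_act.
- by move=> mu w _; apply: rk_act.
- by move=> mu w wA; apply: (lbl_act rtd ch0 ch1).
- by move=> w w' wA wA' rw rw'; apply: (root_lbl_inj rtd ch0 ch1).
- by split=> //; apply: (lbl_conf rtd ch0 ch1).
- by move=> i; apply: lo_inj_conf; case: (qv i).
- by move=> i; apply: hi_inj_conf; case: (qv i).
- exact: qlbl.
- move=> i mu h; have [vc d1] := qv i; have := rk_hi vc d1.
  by rewrite -(rk_act dep mu (hi _)) h ltnn.
- move=> i nr h; have [vc d1] := qv i; have := rk_hi vc d1.
  by rewrite -h; have := rk_par0 rtd (hi_inj_conf vc) nr; move=> h1 h2; have := ltn_trans h1 h2; rewrite ltnn.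
- by move=> i nr; apply: crit_lo_par0 => //; apply: qc_crit.
(* The end away from the root has the larger depth sum. So a translation that identifies two edges
   respects their directions, and the labels 1 at these ends force [mu = 1]. *)
- move=> i j mu ji; rewrite pi_set2 => h; case/negP: ji; apply/eqP/qc_inj.
  have [vi di] := qv i; have [vj dj] := qv j.
  have ri := rk_hi vi di; have rj := rk_hi vj dj.
  have [hl hh] : wact mu (lo (qc j)) = lo (qc i) /\ wact mu (hi (qc j)) = hi (qc i).
    have : lo (qc i) \in [set wact mu (lo (qc j)); wact mu (hi (qc j))] by rewrite h !inE eqxx.
    have : hi (qc i) \in [set wact mu (lo (qc j)); wact mu (hi (qc j))] by rewrite h !inE eqxx orbT.
    rewrite !inE => /orP[] /eqP h1 /orP[] /eqP h2 //.
    - by move: ri; rewrite h1 h2 ltnn.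
    - by move: ri rj; rewrite h1 h2 !rk_act => h3 h4; have := ltn_trans h3 h4; rewrite ltnn.
    - by move: ri; rewrite h1 h2 ltnn.
  have mu1 : mu = 1%g.
    have := lbl_act rtd ch0 ch1 mu (lo_inj_conf vj); rewrite hl !qlbl mulg1 => //.
  by apply: cell_lo_hi => //; rewrite -?hl -?hh mu1 (pi_id (@wact_act V)).
Qed.
End CriticalCells.

(** [S] is listed in increasing order. Splitting off its largest element lowers the number of larger
    elements by one for each of the others, whence the shifted [F] in the induction. *)
Lemma rank_sum (V : finType) (S : {set V}) (F : nat -> nat -> nat) :
  (\sum_(w in S) F #|[set u in S | ord u < ord w]| #|[set u in S | ord w < ord u]| =
   \sum_(i < #|S|) F i (#|S| - i.+1))%N.
Proof.
have [n] := ubnP #|S|; elim: n S F => // n IH S F Sn.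
have [->|/set0Pn[x0 x0S]] := eqVneq S set0; first by rewrite cards0 big_set0 big_ord0.
case: (@arg_maxnP _ x0 (mem S) (@ord V) x0S) => m mS mmax.
have {}mS : m \in S by exact: mS.
have {}mmax u : u \in S -> (ord u <= ord m)%N by exact: mmax.
have lt u : u \in S -> u != m -> (ord u < ord m)%N.
  by move=> uS um; rewrite ltn_neqAle mmax // andbT; apply: contraNneq um => /ord_inj->.
have kS : #|S| = #|S :\ m|.+1 by rewrite (cardsD1 m) mS.
have lS w : w \in S :\ m -> [set u in S | (ord u < ord w)%N] = [set u in S :\ m | (ord u < ord w)%N].
  rewrite !inE => /andP[wm wS]; apply/setP => u; rewrite !inE.
  by case: eqVneq => //= ->; rewrite ltnNge ltnW ?andbF // lt.
have gS w : w \in S :\ m -> #|[set u in S | (ord w < ord u)%N]| = #|[set u in S :\ m | (ord w < ord u)%N]|.+1.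
  rewrite !inE => /andP[wm wS]; rewrite (cardsD1 m) !inE mS lt //= add1n; congr _.+1.
  by apply: eq_card => u; rewrite !inE andbA.
rewrite (bigD1 m) //= kS big_ord_recr /= subnn addnC; congr (_ + F _ _)%N; first last.
- apply/eqP; rewrite cards_eq0; apply/eqP/setP => u; rewrite !inE; apply/negbTE/negP => /andP[uS].
  by rewrite ltnNge mmax.
- apply: eq_card => u; rewrite !inE andbC; have [->|um] := eqVneq u m; first by rewrite ltnn.
  by have [uS|] := boolP (u \in S); rewrite ?andbF // lt.
rewrite (eq_bigl (fun w => w \in S :\ m)); last by move=> w; rewrite !inE andbC.
under eq_bigr => w wS do rewrite lS // gS //.
rewrite (IH (S :\ m) (fun i j => F i j.+1)); last by rewrite kS in Sn.
by apply: eq_bigr => i _; rewrite subSn.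
Qed.

(** The summand is the number of critical triples of [edge_triples], for an edge with [i] smaller
    and [k - i - 1] larger siblings. *)
Lemma rank_sum_value k :
  (\sum_(i < k) i * (i + 2 * (k - i.+1) + 5) = 6 * 'C(k, 2) + 4 * 'C(k, 3))%N.
Proof.
have s1 m : (\sum_(i < m) i = 'C(m, 2))%N.
  by elim: m => [|m IH]; rewrite ?big_ord0 // big_ord_recr /= IH binS bin1 addnC.
elim: k => [|k IH]; first by rewrite big_ord0.
rewrite big_ord_recr /= subnn (eq_bigr (fun i : 'I_k => i * (i + 2 * (k - i.+1) + 5) + 2 * i)%N); last first.
  by move=> i _; have := ltn_ord i; nia.
rewrite big_split /= IH -big_distrr /= s1 !binS bin1.
have : ('C(k, 2) * 2 + k = k * k)%N.
  have := bin_ffact k 2; rewrite ffactnS ffactn1 (_ : 2`! = 2)%N //.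
  by move: ('C(k, 2)) => x; clear; nia.
by move: ('C(k, 2)) ('C(k, 3)) (k * k)%N (mulnDr k k 5) => x y z; rewrite muln0 addn0; lia.
Qed.

Definition o0 : 'I_3 := @Ordinal 3 0 isT.
Definition o1 : 'I_3 := @Ordinal 3 1 isT.
Definition o2 : 'I_3 := @Ordinal 3 2 isT.

Lemma ord3_cases (P : 'I_3 -> Prop) : P o0 -> P o1 -> P o2 -> forall p, P p.
Proof.
move=> h0 h1 h2 [[|[|[|]]]] //= h.
- by rewrite (_ : Ordinal h = o0) //; apply: val_inj.
- by rewrite (_ : Ordinal h = o1) //; apply: val_inj.
- by rewrite (_ : Ordinal h = o2) //; apply: val_inj.
Qed.

(** * Counting the critical 1-cells *)

Section Triples.
Variables (V : finType) (e : rel V) (r : V) (par : V -> V) (dep : V -> nat).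
Hypothesis rtd : rooted e r par dep.
Local Notation cell := {ffun 'I_3 -> V * bool}.
Local Notation cl := (verts par).
Local Notation crit := (crit r par).
Local Notation ch := (children r par).
Implicit Types (u w z : V).

Definition triple w u z : cell :=
  [ffun p : 'I_3 => if p == o0 then (w, true) else if p == o1 then (u, false) else (z, false)].

Definition blocked_by w u z := [|| u == r, par u == w, par u == par w | par u == z].
Definition low_sib w u := [&& u != r, par u == par w & (ord u < ord w)%N].
(** The five separate inequalities and [u != z] express validity; then neither waiting point can
    move, and one of them makes the point on the edge yield. *)
Definition crit_triple w u z :=
  [&& [&& w != r, u != w, u != par w, z != w & z != par w],
      u != z, blocked_by w u z, blocked_by w z u & low_sib w u || low_sib w z].

Lemma crit_tripleP w u z : (triple w u z \in crit) = crit_triple w u z.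
Proof.
have t0 : triple w u z o0 = (w, true) by rewrite ffunE.
have t1 : triple w u z o1 = (u, false) by rewrite ffunE.
have t2 : triple w u z o2 = (z, false) by rewrite ffunE.
have clE : (cl (triple w u z o0) = [set w; par w]) * (cl (triple w u z o1) = [set u]) *
  (cl (triple w u z o2) = [set z]) by rewrite t0 t1 t2.
apply/critP/idP.
  case=> vt _ nc.
  have d p q v : p != q -> v \in cl (triple w u z p) -> v \notin cl (triple w u z q) := valid_disj vt.
  have wr : w != r by have := valid_root vt (p := o0); rewrite t0; apply.
  have uw : u != w by have := d o0 o1 w isT; rewrite !clE !inE eqxx /= => /(_ isT); rewrite eq_sym.
  have up : u != par w by have := d o0 o1 (par w) isT; rewrite !clE !inE eqxx orbT => /(_ isT); rewrite eq_sym.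
  have zw : z != w by have := d o0 o2 w isT; rewrite !clE !inE eqxx /= => /(_ isT); rewrite eq_sym.
  have zp : z != par w by have := d o0 o2 (par w) isT; rewrite !clE !inE eqxx orbT => /(_ isT); rewrite eq_sym.
  have uz : u != z by have := d o1 o2 u isT; rewrite !clE !inE eqxx => /(_ isT).
  rewrite /crit_triple wr uw up zw zp uz /=; apply/and3P; split.
  - apply: contraT; rewrite /blocked_by !negb_or => /and4P[h1 h2 h3 h4].
    have := nc o1; rewrite /cand; case/norP => /negP[]; apply/unblP; rewrite t1; split=> //.
    by apply: ord3_cases; rewrite ?eqxx // clE !inE ?negb_or ?h2 ?h3.
  - apply: contraT; rewrite /blocked_by !negb_or => /and4P[h1 h2 h3 h4].
    have := nc o2; rewrite /cand; case/norP => /negP[]; apply/unblP; rewrite t2; split=> //.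
    by apply: ord3_cases; rewrite ?eqxx // clE !inE ?negb_or ?h2 ?h3.
  - apply: contraT => /norP[n1 n2].
    have := nc o0; rewrite /cand; case/norP => _ /negP[]; apply/respP; rewrite t0; split=> //.
    by apply: ord3_cases; rewrite /smaller_sib ?t0 ?t1 ?t2.
case/and5P => /and5P[wr uw up zw zp] uz bu bz sib.
have cd p q v : p != q -> v \in cl (triple w u z p) -> v \notin cl (triple w u z q).
  move: p q; apply: ord3_cases; apply: ord3_cases; rewrite ?eqxx // => _; rewrite !clE !inE.
  - by move=> /orP[/eqP->|/eqP->]; rewrite eq_sym.
  - by move=> /orP[/eqP->|/eqP->]; rewrite eq_sym.
  - by move=> /eqP->; rewrite negb_or uw.
  - by move=> /eqP->.
  - by move=> /eqP->; rewrite negb_or zw.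
  - by move=> /eqP->; rewrite eq_sym.
split.
- by apply: validI => //; apply: ord3_cases; rewrite ?t0 ?t1 ?t2.
- by rewrite /dimc !big_ord_recl big_ord0 !ffunE.
- apply: ord3_cases.
  + apply/norP; split; first by rewrite /unbl t0.
    rewrite /resp t0 /=; case/orP: sib => /and3P[h1 h2 h3]; apply/forallPn; [exists o1|exists o2];
      by rewrite negbK /smaller_sib ?t0 ?t1 ?t2 /= h1 h2 h3.
  + apply/norP; split; last by rewrite /resp t1.
    apply/negP => /unblP[_]; rewrite t1 /= => ur h; have := h o0 isT; have := h o2 isT.
    by rewrite !clE !inE; move: bu; rewrite /blocked_by (negbTE ur) /= => /or3P[->|->|->]; rewrite ?orbT.
  + apply/norP; split; last by rewrite /resp t2.
    apply/negP => /unblP[_]; rewrite t2 /= => ur h; have := h o0 isT; have := h o1 isT.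
    by rewrite !clE !inE; move: bz; rewrite /blocked_by (negbTE ur) /= => /or3P[->|->|->]; rewrite ?orbT.
Qed.

(** The factor 3 counts the choices of the moving point; a transposition turns it into point 0. *)
Lemma card_crit_triples :
  #|crit| = (3 * \sum_w \sum_u \sum_z crit_triple w u z)%N.
Proof.
have -> : #|crit| = (\sum_p \sum_(c in crit) (c p).2)%N.
  rewrite exchange_big -sum1_card /=; apply: eq_bigr => c /critP[_ d1 _].
  by rewrite -[LHS]d1.
have E0 : (\sum_(c in crit) (c o0).2 = \sum_w \sum_u \sum_z crit_triple w u z)%N.
  have b2n (b : bool) : nat_of_bool b = if b then 1%N else 0%N by case: b.
  rewrite !pair_bigA /= (eq_bigr _ (fun x _ => b2n _)) -big_mkcond /=.
  rewrite (eq_bigr _ (fun (c : cell) _ => b2n (c o0).2)) -big_mkcondr /=.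
  rewrite (reindex_onto (fun x : V * V * V => triple x.1.1 x.1.2 x.2)
    (fun c : cell => ((c o0).1, (c o1).1, (c o2).1))) /=; last first.
    move=> c /andP[/critP[_ d1 _] c0]; have [p [cp hp]] := dim1_ex d1.
    have p0 : p = o0 by apply/eqP; apply: contraLR c0; rewrite eq_sym => /hp->.
    apply/ffunP; apply: ord3_cases; rewrite ffunE /=; first by case: (c o0) c0 => u [].
      by have := hp o1; rewrite p0 => /(_ isT); case: (c o1) => u [].
    by have := hp o2; rewrite p0 => /(_ isT); case: (c o2) => u [].
  apply: eq_bigl => -[[w u] z] /=.
  by rewrite crit_tripleP !ffunE /= eqxx !andbT.
rewrite (eq_bigr (fun=> \sum_(c in crit) (c o0).2)%N); last first.
  move=> p _; have hK : cancel (@cact V 3 (tperm o0 p)) (cact (tperm o0 p)).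
    by move=> c; apply/ffunP => q; rewrite !ffunE tpermK.
  rewrite (reindex_inj (can_inj hK)) /=; apply: eq_big => [c|c _]; last by rewrite ffunE tpermR.
  by apply/idP/idP => [/(crit_act (tperm o0 p))|/crit_act//]; rewrite hK.
by rewrite sum_nat_const card_ord E0.
Qed.

Variables (v1 v2 : V).
Hypotheses (ch0 : ch r = [set v1])
  (sub1 : forall u w, u != r -> w != r -> u != w -> par u = par w -> #|ch w| = 1%N).

Let dparE u : u != r -> dep u = (dep (par u)).+1 := dep_par rtd (v := u).

Section FixedEdge.
Variable w : V.
Hypothesis wr : w != r.
Let S := ch (par w).
Let L := [set u in S | (ord u < ord w)%N].
Let G := [set u in S | (ord w < ord u)%N].
(** The places, other than siblings of [w], where the third point is blocked when the second waits
    at [u]. There are three of them, since [w] and [u] have one child each. *)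
Let X u := [set z | [|| z == r, (z != r) && (par z == w) | (z != r) && (par z == u)]].

Let inS u : (u \in S) = (u != r) && (par u == par w).
Proof. by rewrite inE. Qed.

Let par_w_neq u : u \in L -> par w != r.
Proof.
rewrite !inE => /andP[/andP[ur /eqP up] uw]; apply/negP => /eqP pr.
have chr v : v != r -> par v = r -> v = v1.
  by move=> vr vp; apply/set1P; rewrite -ch0 inE vr vp eqxx.
by move: uw; rewrite (chr u ur) ?up // (chr w wr pr) ltnn.
Qed.

Let neq_uw u : u \in L -> u != w.
Proof. by rewrite !inE => /andP[_]; apply: contraTneq => ->; rewrite ltnn. Qed.

Let crit_L u z : u \in L -> crit_triple w u z = [|| (z \in L) && (z != u), z \in G | z \in X u].
Proof.
move=> uL; have uw := neq_uw uL; have pr := par_w_neq uL.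
have uS : u \in S by move: uL; rewrite inE => /andP[].
move: (uS); rewrite inS => /andP[ur /eqP up].
have ul : (ord u < ord w)%N by move: uL; rewrite inE => /andP[].
have du := dparE ur; have dw := dparE wr; rewrite up in du.
have upw : u != par w by apply/eqP => h; move: du; rewrite -h; clear; lia.
rewrite /crit_triple /blocked_by /low_sib wr uw upw ur up ul !eqxx !orbT /= andbT.
have [->|zr] := eqVneq z r; first by rewrite [r == w]eq_sym [r == par w]eq_sym wr pr ur /= !inE eqxx !orbT.
have dz := dparE zr; rewrite !inE zr (negbTE zr) /=.
have [zpw|zpw] := eqVneq (par z) w.
  rewrite orbT /= !orbT !andbT -andbA; apply/and3P.
  split; apply/eqP => h; move: dz dw du; rewrite zpw ?h; clear; lia.
have [zpu|zpu] := eqVneq (par z) u.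
  rewrite !orbT !andbT -andbA; apply/and3P.
  split; apply/eqP => h; move: dz dw du; rewrite zpu -?h; clear; lia.
have [zpp|zpp] := eqVneq (par z) (par w); last by rewrite /= ?orbF ?andbF.
have zp : z != par w by apply/eqP => h; move: dz; rewrite zpp -h; clear; lia.
rewrite zp /= ?orbF ?andbT (eq_sym u z); have [->|zw] := eqVneq z w; first by rewrite !ltnn.
have [->|zu] := eqVneq z u; first by rewrite /= andbF ltnNge (ltnW ul).
by rewrite /= andbT -neq_ltn; apply/esym; apply: contra zw => /eqP/ord_inj->.
Qed.

Let critC u z : crit_triple w u z = crit_triple w z u.
Proof.
rewrite /crit_triple [z == u]eq_sym [low_sib w z || _]orbC.
by case: (w != r); case: (u != w); case: (u != par w); case: (z != w); case: (z != par w);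
  case: (u != z); case: (blocked_by w u z); case: (blocked_by w z u).
Qed.

Let crit_low u z : crit_triple w u z -> (u \in L) || (z \in L).
Proof.
case/and5P => _ _ _ _ /orP[] /and3P[h1 h2 h3]; apply/orP; [left|right];
  by rewrite inE inS h1 h2 h3.
Qed.

Let card_X u : u \in L -> #|X u| = 3%N.
Proof.
move=> uL; have uw := neq_uw uL.
move: (uL); rewrite !inE => /andP[/andP[ur /eqP up] _].
have /cards1P[x xE] : #|ch w| == 1%N by apply/eqP/(sub1 ur wr uw up).
have /cards1P[y yE] : #|ch u| == 1%N by apply/eqP/(sub1 wr ur); rewrite // eq_sym.
have xP z : ((z != r) && (par z == w)) = (z == x) by move/setP: xE => /(_ z); rewrite !inE.
have yP z : ((z != r) && (par z == u)) = (z == y) by move/setP: yE => /(_ z); rewrite !inE.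
have -> : X u = [set r; x; y] by apply/setP => z; rewrite !inE xP yP orbA.
have /andP[xr /eqP xw] : (x != r) && (par x == w) by rewrite xP.
have /andP[yr /eqP yu] : (y != r) && (par y == u) by rewrite yP.
have xy : x != y by apply: contra uw => /eqP xy; rewrite -yu -xw xy.
by rewrite setUC cardsU1 cards2 !inE (negbTE yr) (eq_sym y x) (negbTE xy) (eq_sym r x) xr.
Qed.

Let disj_X u z : u \in L -> z \in X u -> z \notin S.
Proof.
move=> uL; move: (uL); rewrite !inE => /andP[/andP[ur /eqP up] _].
have du := dparE ur; have dw := dparE wr; rewrite up in du.
case/or3P=> [/eqP->|/andP[zr /eqP zw]|/andP[zr /eqP zu]]; rewrite ?eqxx // zr /=.
  by apply/eqP => h; move: dw; rewrite -h zw; clear; lia.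
by apply/eqP => h; move: du; rewrite -h zu; clear; lia.
Qed.

Let row_L u : u \in L -> (\sum_z crit_triple w u z = #|L| + #|G| + 2)%N.
Proof.
move=> uL; have LS z : z \in L -> z \in S by rewrite inE => /andP[].
have GS z : z \in G -> z \in S by rewrite inE => /andP[].
have LG z : z \in L -> z \notin G.
  by rewrite !inE => /andP[-> h]; rewrite /= -leqNgt ltnW.
rewrite (eq_bigr (fun z => ((z \in L :\ u) + (z \in G) + (z \in X u))%N)); last first.
  move=> z _; rewrite crit_L // !in_setD1 andbC.
  have [zX|zX] := boolP (z \in X u).
    have zS := disj_X uL zX; rewrite (negbTE (contra (@LS z) zS)) (negbTE (contra (@GS z) zS)).
    by rewrite orbT andbF.
  rewrite orbF addn0; have [zL|zL] := boolP (z \in L); last by rewrite andbF.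
  by rewrite (negbTE (LG z zL)) andbT orbF addn0.
rewrite !big_split /= -!(big_mkcond _ (fun=> 1%N)) !sum1_card card_X //.
by have := cardsD1 u L; rewrite uL; move: #|L| #|G| #|L :\ u|; clear; lia.
Qed.

Let row_notL u : u \in L -> (\sum_(z | z \notin L) crit_triple w u z = #|G| + 3)%N.
Proof.
move=> uL; have := row_L uL; rewrite (bigID (mem L)) /=.
rewrite (eq_bigr (fun z => (z != u : nat))); last by move=> z zL; rewrite crit_L // zL;
  have -> : z \in G = false by [move: zL; rewrite !inE => /andP[-> h]; rewrite /= ltnNge ltnW];
  have -> : z \in X u = false by [apply: contraTF zL => /(disj_X uL); rewrite [z \in L]inE => /negbTE->];
  rewrite !orbF.
rewrite -big_mkcondr /= sum1dep_card (_ : #|_| = #|L :\ u|); last first.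
  by apply: eq_card => z; rewrite !inE andbC.
by have := cardsD1 u L; rewrite uL; move: (\sum_(z | z \notin L) _)%N #|L| #|G| #|L :\ u|; clear; lia.
Qed.

(** For [u] in [L] the third point has [#|L| - 1] places in [L], [#|G|] in [G] and 3 in [X u]. The
    pairs with [z] but not [u] in [L] mirror those with [u] but not [z] in [L], and there are
    [#|G| + 3] of them for each [z]. *)
Lemma edge_triples :
  (\sum_u \sum_z crit_triple w u z = #|L| * (#|L| + 2 * #|G| + 5))%N.
Proof.
rewrite (bigID (mem L)) /= (eq_bigr (fun=> #|L| + #|G| + 2)%N); last by move=> u /row_L.
rewrite sum_nat_const.
have -> : (\sum_(u | u \notin L) \sum_z crit_triple w u z = \sum_(z in L) (#|G| + 3))%N.
  rewrite exchange_big /= (bigID (mem L)) /= [X in (_ + X)%N]big1 ?addn0; last first.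
    move=> z zL; rewrite big1 // => u uL; apply/eqP; rewrite eqb0; apply/negP => /crit_low.
    by rewrite (negbTE uL) (negbTE zL).
  apply: eq_bigr => z zL; rewrite -(row_notL zL); apply: eq_bigr => u _; by rewrite critC.
by rewrite sum_nat_const; move: #|L| #|G| => x y; clear; nia.
Qed.
End FixedEdge.

(** Edges are grouped by their upper vertex. A vertex with [k] children contributes
    [6 C(k,2) + 4 C(k,3)] triples, and [k] is the degree minus one away from the root; the factor 3
    for the moving point gives the rest. *)
Lemma card_crit : #|crit| = (6 * (3 * m_r e 2 + 2 * m_r e 3))%N.
Proof.
have mE k : (1 < k)%N -> m_r e k = (\sum_v 'C(#|ch v|, k))%N.
  move=> k1; rewrite /m_r [LHS]big_mkcond; apply: eq_bigr => v _; rewrite (deg_children rtd).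
  have [->|vr] /= := eqVneq v r; first by rewrite addn0 ch0 cards1 /= ltnNge ltnW //= bin_small.
  by rewrite addn1 subn1 /= ltnS; case: leqP => // h; rewrite bin_small.
rewrite card_crit_triples (bigID (fun w => w == r)) /= big_pred1_eq [X in (X + _)%N]big1; last first.
  by move=> u _; rewrite big1 // => z _; rewrite /crit_triple eqxx.
rewrite add0n (eq_bigr (fun w => #|[set u in ch (par w) | (ord u < ord w)%N]| *
   (#|[set u in ch (par w) | (ord u < ord w)%N]| + 2 * #|[set u in ch (par w) | (ord w < ord u)%N]| + 5)))%N; last first.
  by move=> w wr; rewrite edge_triples.
rewrite (partition_big par predT) //=.
rewrite (eq_bigr (fun v => 6 * 'C(#|ch v|, 2) + 4 * 'C(#|ch v|, 3))%N); last first.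
  move=> v _; rewrite -rank_sum_value -(rank_sum (ch v) (fun i j => i * (i + 2 * j + 5))%N).
  by apply: eq_big => [w|w /andP[_ /eqP->] //]; rewrite inE.
by rewrite big_split /= -!big_distrr /= -!mE //; move: (m_r e 2) (m_r e 3) => x y; clear; lia.
Qed.
End Triples.

Lemma tperm12_of_lt (x y : 'S_3) : (x o1 < x o0)%N -> (x o2 < x o1)%N ->
  (y o0 < y o1)%N -> (y o2 < y o0)%N -> (x^-1 * y)%g = tperm (inord 1) (inord 2).
Proof.
have in1 : (inord 1 : 'I_3) = o1 by apply: val_inj; rewrite /= inordK.
have in2 : (inord 2 : 'I_3) = o2 by apply: val_inj; rewrite /= inordK.
have H (a b c : 'I_3) : (a < b)%N -> (c < a)%N -> [/\ b = o2, a = o1 & c = o0].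
  by move: a b c; apply: ord3_cases; apply: ord3_cases; apply: ord3_cases.
move=> x1 x2 y1 y2; have [x0E x1E x2E] := H _ _ _ x1 x2; have [y1E y0E y2E] := H _ _ _ y1 y2.
apply/permP => i; rewrite permM -[in RHS](permKV x i) in1 in2; move: (x^-1%g i).
apply: ord3_cases; first by rewrite x0E tpermR.
  by rewrite x1E tpermL.
by rewrite x2E tpermD.
Qed.

(** * Two critical cells with known labels *)

Section Labels.
Variables (V : finType) (e : rel V) (r : V) (par : V -> V) (dep : V -> nat).
Hypothesis rtd : rooted e r par dep.
Variables (v1 v2 : V).
Hypotheses (ch0 : children r par r = [set v1]) (ch1 : children r par v1 = [set v2]).
Local Notation lbl := (lbl r par dep v1 v2).
Local Notation hi := (hi par).
Local Notation crit := (crit r par).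
Local Notation crit1 := (crit1 r par dep v1 v2).

Lemma card_crit_crit1 : #|crit| = (6 * #|crit1|)%N.
Proof.
rewrite -sum1_card (partition_big (fun c => lbl (lo c)) predT) //=.
rewrite (eq_bigr (fun=> #|crit1|)); last first.
  move=> mu _; have hK : cancel (@cact V 3 mu) (cact mu^-1%g) by exact: cactK.
  have hV : cancel (@cact V 3 mu^-1%g) (cact mu) by move=> c; rewrite -{1}[mu]invgK cactK.
  rewrite -[RHS]sum1_card (reindex_inj (can_inj hK)) /=; apply: eq_bigl => c.
  rewrite [in RHS]inE; have -> : (cact mu c \in crit) = (c \in crit).
    by apply/idP/idP => [/(crit_act mu^-1%g)|/crit_act//]; rewrite hK.
  apply: andb_id2l => /critP[vc _ _].
  rewrite lo_act (lbl_act rtd ch0 ch1); last exact: lo_inj_conf vc.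
  by rewrite -{2}[mu]mulg1 (inj_eq (mulgI mu)).
by rewrite big_const iter_addn addn0 mulnC card_Sn.
Qed.

Variables (w u : V).
Hypotheses (wr : w != r) (ur : u != r) (uw : u != w) (puw : par u = par w)
  (oul : (ord u < ord w)%N).

Let dw := dep_par rtd wr.
Let du := dep_par rtd ur.

Let pr : par w != r.
Proof.
apply/eqP => h; have c0 v : v != r -> par v = r -> v = v1.
  by move=> vr vp; apply/set1P; rewrite -ch0 inE vr vp eqxx.
by case/negP: uw; rewrite (c0 u) ?puw // (c0 w).
Qed.

Let anc_root x : anc par r x.
Proof.
have [n] := ubnP (dep x); elim: n x => // n IH x xn; have [->|xr] := eqVneq x r; first by exists 0.
have [|k kE] := IH (par x); first by move: xn; rewrite (dep_par rtd xr); lia.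
by exists k.+1; rewrite iterSr.
Qed.

(** The point at [u] is next to move: the one at [w] has a larger number, and the third is at the
    root or blocked behind [w]. *)
Let lo_step z : triple w u z \in crit -> (z == r) || (par z == w) ->
  lbl (lo (triple w u z)) = lbl ([ffun p : 'I_3 => if p == o0 then w else if p == o1 then par w else z]).
Proof.
move=> tc hz; have [vt _ _] := elimT (critP r par _) tc; have lA := lo_inj_conf vt.
set l := lo _ in lA *; have l0 : l o0 = w by rewrite !ffunE.
have l1 : l o1 = u by rewrite !ffunE.
have l2 : l o2 = z by rewrite !ffunE.
have zp : par w != z.
  move: tc; rewrite crit_tripleP => /andP[/and5P[_ _ _ _]]; by rewrite eq_sym.
have pw : par w != w := par_neq rtd wr.
have tE p : tok0 l p = (l p, false) by rewrite ffunE.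
have rd : redundant r par (tok0 l) o1.
  apply/andP; split; last by rewrite ffunE.
  apply: mcI => [|q].
    apply/orP; left; apply/unblP; rewrite tE l1; split=> //.
    by apply: ord3_cases => // _; rewrite tE ?l0 ?l2 /verts /= in_set1 puw ?(negbTE pw).
  rewrite /cand /resp [(tok0 l q).2](_ : _ = false) ?tE // orbF l1 /=.
  move: q; apply: ord3_cases; first by move=> _; rewrite l0 ltnW.
    by move=> _; rewrite l1.
  case/unblP => _; rewrite tE l2 /= => zr /(_ o0 isT); rewrite tE l0 /verts /= in_set1.
  by move: hz; rewrite (negbTE zr) /= => ->.
rewrite -(lbl_par0 rtd ch0 ch1 lA) (par0_red lA rd); congr lbl.
by apply/ffunP; apply: ord3_cases; rewrite !ffunE ?l0 ?l1 ?l2 ?puw.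
Qed.

Let lo_step_inj z : triple w u z \in crit -> (z == r) || (par z == w) ->
  [ffun p : 'I_3 => if p == o0 then w else if p == o1 then par w else z] \in inj_conf V.
Proof.
rewrite crit_tripleP => /andP[/and5P[_ _ _ zw zp] _] _.
have pw : par w != w := par_neq rtd wr.
apply/inj_confP; apply: ord3_cases; apply: ord3_cases; rewrite !ffunE //= => /eqP;
  by rewrite ?(negbTE pw) ?(negbTE zw) ?(negbTE zp) // eq_sym ?(negbTE pw) ?(negbTE zw) ?(negbTE zp).
Qed.

(** The third point rests at the root and stays first. At the lower end of the edge the point from
    [u] gets to [par w] ahead of the one at [w]; at the upper end [par w] is occupied by the latter,
    which therefore stays ahead. The two orders differ in the last two places. *)
Lemma swap_cell : exists2 c, c \in crit1 & lbl (hi c) = tperm (inord 1) (inord 2).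
Proof.
have rw : r != w by rewrite eq_sym. have rp : r != par w by rewrite eq_sym.
have upw : u != par w by apply/eqP => h; move: du; rewrite puw -h; clear; lia.
have tc : triple w u r \in crit.
  rewrite crit_tripleP /crit_triple /blocked_by /low_sib wr uw upw rw rp ur puw oul !eqxx.
  by rewrite ?orbT.
have [vt _ _] := elimT (critP r par _) tc.
have hz : (r == r) || (par r == w) by rewrite eqxx.
have h1 := lo_step tc hz; have h2 := lo_step_inj tc hz.
set f := finfun _ in h1 h2; have f0 : f o0 = w by rewrite ffunE.
have f1 : f o1 = par w by rewrite ffunE.
have f2 : f o2 = r by rewrite ffunE.
have a1 := @anc_lbl _ _ _ _ _ rtd _ _ ch0 ch1 f o1 o0 h2 isT.
rewrite f0 f1 in a1; have {}a1 := a1 (ex_intro _ 1%N erefl).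
have a2 := @anc_lbl _ _ _ _ _ rtd _ _ ch0 ch1 f o2 o1 h2 isT.
rewrite f2 in a2; have {}a2 := a2 (anc_root _).
have hA := hi_inj_conf vt; set g := hi _ in hA.
have g0 : g o0 = par w by rewrite !ffunE.
have g1 : g o1 = u by rewrite !ffunE.
have g2 : g o2 = r by rewrite !ffunE.
have b1 := @anc_lbl _ _ _ _ _ rtd _ _ ch0 ch1 g o0 o1 hA isT.
rewrite g0 g1 in b1; have {}b1 := b1 (ex_intro _ 1%N puw).
have b2 := @anc_lbl _ _ _ _ _ rtd _ _ ch0 ch1 g o2 o0 hA isT.
rewrite g2 in b2; have {}b2 := b2 (anc_root _).
exists (cact (lbl (lo (triple w u r)))^-1%g (triple w u r)); first exact: (crit_normal rtd ch0 ch1 tc).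
rewrite hi_act (lbl_act rtd ch0 ch1) // -/g h1.
by apply: tperm12_of_lt.
Qed.

(** The third point is held behind [w]. From the lower end point 1 arrives first of all; from the
    upper end point 0 is ahead of point 1. Hence the label does not fix 0. *)
Lemma move_cell z : z != r -> par z = w ->
  exists2 c, c \in crit1 & lbl (hi c) o0 != o0.
Proof.
move=> zr pz; have dz := dep_par rtd zr.
have upw : u != par w by apply/eqP => h; move: du; rewrite puw -h; clear; lia.
have zw : z != w by apply/eqP => h; move: dz; rewrite pz h; clear; lia.
have zp : z != par w by apply/eqP => h; move: dz dw; rewrite pz -h; clear; lia.
have uz : u != z by apply/eqP => h; move: du dz dw; rewrite puw pz h; clear; lia.
have tc : triple w u z \in crit.
  rewrite crit_tripleP /crit_triple /blocked_by /low_sib wr uw upw zw zp uz ur puw pz oul !eqxx.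
  by rewrite ?orbT.
have [vt _ _] := elimT (critP r par _) tc.
have hz : (z == r) || (par z == w) by rewrite pz eqxx orbT.
have h1 := lo_step tc hz; have h2 := lo_step_inj tc hz.
set f := finfun _ in h1 h2; have f0 : f o0 = w by rewrite ffunE.
have f1 : f o1 = par w by rewrite ffunE.
have f2 : f o2 = z by rewrite ffunE.
have a1 := @anc_lbl _ _ _ _ _ rtd _ _ ch0 ch1 f o1 o0 h2 isT.
rewrite f0 f1 in a1; have {}a1 := a1 (ex_intro _ 1%N erefl).
have a2 := @anc_lbl _ _ _ _ _ rtd _ _ ch0 ch1 f o0 o2 h2 isT.
rewrite f0 f2 in a2; have {}a2 := a2 (ex_intro _ 1%N pz).
have hA := hi_inj_conf vt; set g := hi _ in hA.
have g0 : g o0 = par w by rewrite !ffunE.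
have g1 : g o1 = u by rewrite !ffunE.
have b1 := @anc_lbl _ _ _ _ _ rtd _ _ ch0 ch1 g o0 o1 hA isT.
rewrite g0 g1 in b1; have {}b1 := b1 (ex_intro _ 1%N puw).
exists (cact (lbl (lo (triple w u z)))^-1%g (triple w u z)); first exact: (crit_normal rtd ch0 ch1 tc).
rewrite hi_act (lbl_act rtd ch0 ch1) // -/g h1.
have e0 : (lbl f)^-1%g o0 = o1.
  apply: (@perm_inj _ (lbl f)); rewrite permKV; move: (lbl f o0) (lbl f o1) (lbl f o2) a1 a2.
  by apply: ord3_cases; apply: ord3_cases; apply: ord3_cases.
by rewrite permM e0; apply/eqP => h; move: b1; rewrite h.
Qed.
End Labels.

(** Two transpositions of the index set correct an arbitrary bijection at [x] and [y]. *)
Lemma bij_prescribed (E Q : finType) (A : {set Q}) (x y : E) (a b : Q) : #|E| = #|A| ->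
  x != y -> a \in A -> b \in A -> a != b ->
  exists f : E -> Q, [/\ injective f, forall i, f i \in A,
    forall c, c \in A -> exists i, f i = c & f x = a /\ f y = b].
Proof.
move=> EA xy aA bA ab.
pose f0 (i : E) : Q := enum_val (cast_ord EA (enum_rank i)).
have f0i : injective f0 by move=> i j /enum_val_inj/cast_ord_inj/enum_rank_inj.
have f0A i : f0 i \in A by apply: enum_valP.
have f0s c : c \in A -> exists i, f0 i = c.
  move=> cA; exists (enum_val (cast_ord (esym EA) (enum_rank_in cA c))).
  by rewrite /f0 enum_valK cast_ordKV enum_rankK_in.
have [i0 i0E] := f0s a aA; pose f1 := f0 \o tperm x i0.
have f1x : f1 x = a by rewrite /f1 /= tpermL.
have f1i : injective f1 by apply: inj_comp => //; apply: perm_inj.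
have f1s c : c \in A -> exists i, f1 i = c.
  by move=> /f0s[i <-]; exists (tperm x i0 i); rewrite /f1 /= tpermK.
have [j0 j0E] := f1s b bA; exists (f1 \o tperm y j0); split.
- by apply: inj_comp => //; apply: perm_inj.
- by move=> i; apply: f0A.
- by move=> c /f1s[i <-]; exists (tperm y j0 i); rewrite /= tpermK.
- rewrite /= tpermL j0E tpermD ?f1x // 1?eq_sym //.
  by apply: contraNneq ab => h; rewrite -f1x -j0E h.
Qed.

(* In S_3 the stabilizer of a point is generated by a transposition and is maximal. *)
Lemma petal_rel_connected (E : finType) (lab : E -> 'S_3) (D : {set E}) e1 e2 :
  e1 \in D -> e2 \in D -> lab e1 = tperm (inord 1) (inord 2) -> lab e2 o0 != o0 ->
  forall x y, connect (petal_rel lab D) x y.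
Proof.
move=> e1D e2D lab1 lab2; pose t : 'S_3 := lab e1; pose g : 'S_3 := lab e2.
have step x i : i \in D -> connect (petal_rel lab D) x (x * lab i)%g.
  by move=> iD; apply: connect1; apply/existsP; exists i; rewrite iD eqxx.
have sym : connect_sym (petal_rel lab D).
  apply: sym_connect_sym => x y /=; apply: eq_existsb => i; by rewrite orbC.
have in1 : (inord 1 : 'I_3) = o1 by apply: val_inj; rewrite /= inordK.
have in2 : (inord 2 : 'I_3) = o2 by apply: val_inj; rewrite /= inordK.
have t0 : t o0 = o0 by rewrite /t lab1 tpermD // ?in1 ?in2.
have t1 : t o1 = o2 by rewrite /t lab1 in1 in2 tpermL.
have t2 : t o2 = o1 by rewrite /t lab1 in1 in2 tpermR.
have fix0 (s : 'S_3) : s o0 = o0 -> s = 1%g \/ s = t.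
  move=> s0; have ne p q : p != q -> s p != s q by rewrite (inj_eq perm_inj).
  case E1: (s o1) (ne o1 o0 isT) (ne o2 o0 isT) (ne o1 o2 isT) => [a ha].
  case E2: (s o2) => [b hb]; move: (E1) (E2); rewrite s0; move: (Ordinal ha) (Ordinal hb).
  apply: ord3_cases; apply: ord3_cases => // s1 s2 _ _ _; [left|right];
    by apply/permP; apply: ord3_cases; rewrite ?perm1 ?s0 ?s1 ?s2 ?t0 ?t1 ?t2.
have reach0 i : exists h : 'S_3, h o0 = i /\ forall x, connect (petal_rel lab D) x (x * h)%g.
  have cg : exists h : 'S_3, h o0 = g o0 /\ forall x, connect (petal_rel lab D) x (x * h)%g.
    by exists g; split=> // x; apply: step.
  have cgt : exists h : 'S_3, h o0 = t (g o0) /\ forall x, connect (petal_rel lab D) x (x * h)%g.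
    exists (g * t)%g; rewrite permM; split=> // x; rewrite mulgA.
    by apply: connect_trans (step _ _ e2D) (step _ _ e1D).
  move: (g o0) lab2 cg cgt => j; move: j i; apply: ord3_cases; apply: ord3_cases => //; rewrite ?t1 ?t2 // => _ _ _;
    by exists 1%g; rewrite perm1; split=> // x; rewrite mulg1.
move=> x y; pose z := (x^-1 * y)%g; have -> : y = (x * z)%g by rewrite mulKVg.
have [h [h0 hc]] := reach0 (z o0).
apply: connect_trans (_ : connect _ (x * (z * h^-1))%g _); last first.
  by have := hc (x * (z * h^-1))%g; rewrite -!mulgA mulVg mulg1.
have [|->|->] := fix0 (z * h^-1)%g; first by rewrite permM -h0 permK.
  by rewrite mulg1.
exact: step.
Qed.

(** The petal [e1] keeps its label throughout. At first [e2] is the second generator, and every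
    label except those of [e1] and [e2] is changed; thereby [e0] has got its final label and can
    replace [e2], so that the label of [e2] can be changed too. *)
Lemma relabel_all (R : realType) (W E : finType) (wact : 'S_3 -> W -> W) (lab lab' : E -> 'S_3)
    (e0 e1 e2 : E) : is_act wact ->
  lab e1 = tperm (inord 1) (inord 2) -> lab' e1 = tperm (inord 1) (inord 2) ->
  lab e2 o0 != o0 -> lab' e0 o0 != o0 -> e1 != e2 -> e0 != e2 ->
  heq R (@piI _ W E wact) (Bs _ W E :|: \bigcup_e petal wact lab e)
                          (Bs _ W E :|: \bigcup_e petal wact lab' e).
Proof.
move=> actW l1 l1' l2 l0' ne12 ne02; have actI_ := piI_act E actW.
have inv l : inv_cplx (@piI _ W E wact) (Bs _ W E :|: \bigcup_e petal wact l e).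
  apply: (inv_setU (inv_Bs wact)); apply: inv_bigcup => e; exact: inv_petal.
pose lab2 e := if e == e2 then lab e else lab' e.
have l21 : lab2 e1 = tperm (inord 1) (inord 2) by rewrite /lab2 (negbTE ne12).
have l20 : lab2 e0 o0 != o0 by rewrite /lab2 (negbTE ne02).
apply: (@heq_trans _ _ _ _ actI_ _ _ _ (inv lab) (inv lab')).
  apply: (relabel R actW (lab' := lab2) (D := [set e1; e2])).
    by move=> e; rewrite !inE => /orP[] /eqP ->; rewrite ?l1 ?l21 // /lab2 eqxx.
  by apply: (petal_rel_connected (e1 := e1) (e2 := e2)); rewrite ?inE ?eqxx ?orbT.
apply: (relabel R actW (lab := lab2) (D := [set e1; e0])).
  by move=> e; rewrite !inE => /orP[] /eqP ->; rewrite ?l1' ?l21 // /lab2 (negbTE ne02).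
by apply: (petal_rel_connected (e1 := e1) (e2 := e0)); rewrite ?inE ?eqxx ?orbT.
Qed.

(** * Degrees in a 3-sufficiently subdivided tree *)

Section Tree.
Variables (V : finType) (e : rel V) (r : V) (par : V -> V) (dep : V -> nat).
Hypothesis rtd : rooted e r par dep.
Hypotheses (degr : deg e r = 1%N) (sub : suff_subdivided e 3).

(** For [n = 3] a path between vertices of degree other than 2 has at least two edges, so two such
    vertices are never adjacent. *)
Lemma deg2_edge u v : u != v -> e u v -> deg e u != 2%N -> deg e v = 2%N.
Proof.
move=> uv euv du; apply/eqP; apply: contraT => dv.
by have := sub uv du dv (p := [:: v]); rewrite /= euv => /(_ isT erefl).
Qed.

Lemma child_edge w : w != r -> e (par w) w.
Proof. by move=> wr; rewrite (edge_par rtd) wr eqxx orbT. Qed.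

Lemma one_child_root : exists v1, children r par r = [set v1].
Proof. by apply/cards1P; move: degr; rewrite (deg_children rtd) eqxx addn0 => ->. Qed.

Lemma one_child w : w != r -> deg e (par w) != 2%N -> #|children r par w| = 1%N.
Proof.
move=> wr dp; have := deg2_edge _ (child_edge wr) dp.
by rewrite (deg_children rtd) wr addn1 => /(_ (par_neq rtd wr))[].
Qed.

Lemma siblings_deg w u : w != r -> u != r -> u != w -> par u = par w -> (2 < deg e (par w))%N.
Proof.
move=> wr ur uw p; have c2 : (1 < #|children r par (par w)|)%N.
  by apply/card_gt1P; exists u, w; split; rewrite // inE ?ur ?wr ?p eqxx.
rewrite (deg_children rtd); have [h|_] := eqVneq (par w) r; last by rewrite addn1.
by move: degr c2; rewrite (deg_children rtd) h eqxx addn0 => ->.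
Qed.

Lemma siblings_ex : (exists v, essential e v) ->
  exists w u, [/\ w != r, u != r, u != w, par u = par w & (ord u < ord w)%N].
Proof.
move=> [v]; rewrite /essential (deg_children rtd) => dv.
have /card_gt1P[u [w [+ + uw]]] : (1 < #|children r par v|)%N.
  by move: dv; case: (v != r); rewrite ?addn1 ?addn0 //; exact: ltnW.
rewrite !inE => /andP[ur /eqP up] /andP[wr /eqP wp].
have : ord u != ord w by apply: contra uw => /eqP/ord_inj->.
by rewrite neq_ltn => /orP[h|h]; [exists w, u|exists u, w]; split; rewrite ?up ?wp // eq_sym.
Qed.
End Tree.

Lemma m_r2_gt0 (V : finType) (e : rel V) : (exists v, essential e v) -> (0 < m_r e 2)%N.
Proof.
move=> [v dv]; rewrite /m_r (bigD1 v) //= ltn_addr // bin_gt0.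
by move: dv; rewrite /essential; clear; lia.
Qed.

Theorem theorem4p3 (R : realType) (V : finType) (e : rel V) :
  is_tree e -> suff_subdivided e 3 -> (exists v : V, essential e v) ->
  @equiv_htpy_equiv R _ _ _ (@actD R 3 #|V|)
    (@actG R (m_r e 2 + m_r e 3)%N)
    (@Dconf V e R 3) (@Greal R (m_r e 2) (m_r e 3)).
Proof.
move=> tree sub ess; have [r [par [dep [rtd degr]]]] := leaf_rooted tree ess.
have [v1 ch0] := one_child_root rtd degr.
have /setP/(_ v1) := ch0; rewrite !inE eqxx => /andP[v1r /eqP pv1].
(* The root segment has room for three points, because the neighbour of the leaf [r] has degree
   2. *)
have [v2 ch1] : exists v2, children r par v1 = [set v2].
  by apply/cards1P; rewrite (one_child rtd sub v1r) // pv1 degr.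
have deg3 u w := siblings_deg rtd degr (w := w) (u := u).
have sub1 u w : u != r -> w != r -> u != w -> par u = par w -> #|children r par w| = 1%N.
  move=> ur wr uw p; rewrite (one_child rtd sub wr) //.
  by have := deg3 u w wr ur uw p; case: ltngtP.
have [w [u [wr ur uw p oul]]] := siblings_ex rtd ess.
have /eqP/cards1P[z /setP/(_ z)] := sub1 u w ur wr uw p.
rewrite !inE eqxx => /andP[zr /eqP pz].
set m2 := m_r e 2; set m3 := m_r e 3; have m2p : (0 < m2)%N := m_r2_gt0 ess.
have Np : (0 < m2 + m3)%N by rewrite addn_gt0 m2p.
pose E := petal_index m2 m3; pose i0 := Ordinal Np.
have pet (k : 'I_3) : (i0 < mult m2 m3 k)%N by rewrite /mult; case: ifP.
pose pe k : E := exist _ (k, i0) (pet k).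
have pe_neq k l : k != l -> pe k != pe l by move=> kl; rewrite -(inj_eq val_inj) xpair_eqE (negbTE kl).
have [c1 c1Q l1] := swap_cell rtd ch0 ch1 wr ur uw p oul.
have [c2 c2Q l2] := move_cell rtd ch0 ch1 wr ur uw p oul zr pz.
have in0 : (inord 0 : 'I_3) = o0 by apply: val_inj; rewrite /= inordK.
have in1 : (inord 1 : 'I_3) = o1 by apply: val_inj; rewrite /= inordK.
have in2 : (inord 2 : 'I_3) = o2 by apply: val_inj; rewrite /= inordK.
have c12 : c1 != c2 by apply: contraNneq l2 => <-; rewrite l1 in1 in2 tpermD.
have cardE : #|E| = #|crit1 r par dep v1 v2|.
  rewrite card_petal_index //; apply/eqP; rewrite -(eqn_pmul2l (isT : (0 < 6)%N)).
  by rewrite -(card_crit_crit1 rtd ch0 ch1) (card_crit rtd ch0 sub1).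
(* The cell with label (1 2) is assigned to a petal of family 2, whose target label is the same. The
   cell that moves 0 goes to family 1, so that a petal of family 0, whose target label moves 0, is
   distinct from it and can take over in [relabel_all]. *)
have [qc [qci qcQ qcs [q1 q2]]] := bij_prescribed cardE (pe_neq o2 o1 isT) c1Q c2Q c12.
have [M [inM fil]] := filtration rtd (@no_critical3 V r par) R.
have actK := wact_act V; have actP := piI_act E actK.
have actD_inv := @cub_act R V 3 _ (@Kc_inv V r par dep 3 _).
have Ginv y mu : @Greal R m2 m3 y -> @Greal R m2 m3 (actG y mu).
  rewrite Greal_real // => yG; apply: real_act yG; first exact: piG_act.
  move=> nu _ /imsetP[k kK ->]; apply/imsetP; exists [set piJ nu x | x in k]; first exact: inv_rose.
  by rewrite -!imset_comp; apply: eq_imset => j; rewrite /= kappa_act.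
apply: ghe_equiv_htpy_equiv; rewrite (Dconf_cub rtd R inM).
apply: (ghe_trans (actD_inv _) Ginv fil).
apply: (ghe_trans (actD_inv _) Ginv (cub_graph rtd R)).
apply: (ghe_trans (real_act actK (Kg_inv (dep := dep))) Ginv (Kg_petals rtd ch0 ch1 qcQ qci qcs R)).
have invP l : inv_cplx (@piI _ _ E (@wact V)) (Bs _ _ E :|: \bigcup_i petal (@wact V) l i).
  by apply: (inv_setU (inv_Bs _)); apply: inv_bigcup => i; apply: inv_petal.
apply: (ghe_trans (real_act actP (invP _)) Ginv).
  apply: (@relabel_all R _ E (@wact V) _ (@target_label m2 m3) (pe o0) (pe o2) (pe o1) actK).
  - by rewrite q1.
  - by [].
  - by rewrite q2.
  - by rewrite /target_label /gen /= in0 in1 in2 permM tpermL tpermD.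
  - exact: pe_neq.
  - exact: pe_neq.
apply: (ghe_trans (real_act actP (invP _)) Ginv (shorten_petals R actK (@target_label_neq1 m2 m3))).
have invS l : inv_cplx (@piI _ _ E (@wact V)) (Bs _ _ E :|: \bigcup_i short (@wact V) l i).
  by apply: (inv_setU (inv_Bs _)); apply: inv_bigcup => i; apply: inv_short.
apply: (ghe_trans (real_act actP (invS _)) Ginv _ (rose_Greal R m3 m2p)).
rewrite -rose_reindexed; apply: ghe_sym.
apply: (reindex_ghe R actP (@piJ_act _ _)); last exact: inv_rose.
  by move=> [x|[x i]] [y|[y j]] //= [->] // ->.
by move=> mu [x|[x i]].
Qed.
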